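(* Let $X_t = Y_t + \sigma W_t$, $t\in[0,1]$, be a Lévy process, where $\sigma>0$, $W=\{W_t\}_{t\in[0,1]}$ is a standard Brownian motion, and $Y$ is a pure jump Lévy process with jump (Lévy) measure $\Pi$, independent of $W$. Let $\beta^* := \inf\big\{p>0 : \int_{(-1,1)} |x|^p\,\Pi(dx)<\infty\big\}$. For $n\ge 1$ set $$\widetilde W^{(n)}_t := n^{-1/2}\sum_{i=1}^{\lfloor nt\rfloor} Q\!\left(\frac{R_i(\Delta_n X)}{n+1}\right),\qquad t\in[0,1],$$ where $Q$ is the standard normal quantile function and $R_i(\Delta_n X)$ is the rank of the $i$-th increment of $X$ on the grid $\{k/n: 0\le k\le n\}$ among all $n$ such increments. Then for any $p\in(\beta^*,2]\cup\{2\}$, as $n\to\infty$, $$\sup_{t\in[0,1]}\big| W_t - \widetilde W^{(n)}_t - (W_1-\widetilde W^{(n)}_1)\,t\big| = o_P\big(n^{-1/2+p/4}\big).$$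
   Context: For a process $V=\{V_t\}_{t\in[0,1]}$ and $n\ge1$, $\Delta_n V := (V_{1/n}-V_0,\ V_{2/n}-V_{1/n},\ \ldots,\ V_1-V_{(n-1)/n})\in\mathbb{R}^n$. For an $n$-tuple $\mathcal X=(x_1,\dots,x_n)$ of pairwise distinct real numbers, the rank of $x_k$ is $R_k(\mathcal X):=\sum_{j=1}^n \mathbf 1(x_j\le x_k)$. The components of $\Delta_n X$ are almost surely pairwise distinct, so the ranks are a.s. well defined. $Q:=\Phi^{-1}$ on $(0,1)$, where $\Phi$ is the standard normal distribution function. An empty sum equals $0$. ''Pure jump'' means that the Lévy process $Y$ has no Gaussian component. $\xi_n=o_P(a_n)$ means $\xi_n/a_n\to0$ in probability. *)

(* Defs.v *)
From HB Require Import structures.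
From mathcomp Require Import all_boot all_order all_algebra.
From mathcomp Require Import all_classical all_reals all_analysis.

Set Implicit Arguments.
Unset Strict Implicit.
Unset Printing Implicit Defensive.

Import Order.TTheory GRing.Theory Num.Theory.
Import numFieldNormedType.Exports.

Local Open Scope classical_set_scope.
Local Open Scope ring_scope.

(* A process on [0, 1] is a family V : R -> T -> R (time, then outcome); its
   values at times outside [0, 1] are never constrained nor used. *)

Section processes.
Context {d : measure_display} {T : measurableType d} {R : realType}.
Variable P : probability T R.
Implicit Types V Y W : R -> T -> R.

Definition incr V (s t : R) : T -> R := fun w => V t w - V s w.

Definition measurable_process V : Prop :=
  forall t, 0 <= t <= 1 -> measurable_fun [set: T] (V t : T -> measurableTypeR R).

(* Taking some A i to be the whole line gives the product rule for every
   subfamily, so this is mutual independence of Z 0, ..., Z (n - 1). *)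
Definition independent_rvs (n : nat) (Z : nat -> T -> R) : Prop :=
  forall A : nat -> set (measurableTypeR R), (forall i, measurable (A i)) ->
    P (\bigcap_(i < n) (Z i @^-1` A i)) = (\prod_(i < n) P (Z i @^-1` A i))%E.

Definition independent_increments V : Prop :=
  forall (n : nat) (tau : nat -> R),
    (forall i, 0 <= tau i <= 1) -> nondecreasing_seq tau ->
    independent_rvs n (fun i => incr V (tau i) (tau i.+1)).

Definition stationary_increments V : Prop :=
  forall s h : R, 0 <= s -> 0 <= h -> s + h <= 1 ->
  forall A : set (measurableTypeR R), measurable A ->
    P (incr V s (s + h) @^-1` A) = P (incr V 0 h @^-1` A).

Definition cadlag (f : R -> R) : Prop :=
  (forall t, 0 <= t < 1 -> f x @[x --> t^'+] --> f t) /\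
  (forall t, 0 < t <= 1 -> cvg (f x @[x --> t^'-])).

(* Stochastic continuity is a consequence of cadlag paths and stationarity. *)
Definition levy_process V : Prop :=
  [/\ measurable_process V,
      (\forall w \ae P, V 0 w = 0),
      independent_increments V,
      stationary_increments V &
      (\forall w \ae P, cadlag (V ^~ w))].

Definition standard_brownian_motion W : Prop :=
  [/\ measurable_process W,
      (\forall w \ae P, W 0 w = 0),
      independent_increments W,
      (* the second parameter of normal_prob is the standard deviation *)
      (forall s t : R, 0 <= s -> s < t -> t <= 1 ->
       forall A : set (measurableTypeR R), measurable A ->
         P (incr W s t @^-1` A) = normal_prob 0 (Num.sqrt (t - s)) A) &
      (\forall w \ae P, {within `[0, 1], continuous (W ^~ w)})].

Definition sigma_of_process V : set (set T) :=
  <<s [set E | exists t (A : set (measurableTypeR R)),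
         [/\ 0 <= t <= 1, measurable A & E = V t @^-1` A]] >>.

Definition independent_processes Y W : Prop :=
  forall E F, sigma_of_process Y E -> sigma_of_process W F ->
    P (E `&` F) = (P E * P F)%E.

Definition levy_measure (Pi : {measure set (measurableTypeR R) -> \bar R}) :
    Prop :=
  Pi [set 0] = 0%E /\
  (\int[Pi]_(x in [set: measurableTypeR R]) (Num.min (x ^+ 2) 1)%:E < +oo)%E.

Section triplet.
Variables (b a : R) (Pi : {measure set (measurableTypeR R) -> \bar R}).

(* Real and imaginary parts of the Levy-Khintchine exponent
   psi(u) = i b u - a u^2 / 2 + \int (e^(iux) - 1 - iux 1(|x| <= 1)) Pi(dx). *)
Definition levy_exponent_re (u : R) : R :=
  - (a * u ^+ 2 / 2) + \int[Pi]_x (cos (u * x) - 1).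
Definition levy_exponent_im (u : R) : R :=
  b * u + \int[Pi]_x (sin (u * x) - u * x * \1_(`[-1, 1] : set R) x).

(* The two parts of E[e^(iu V_t)] = e^(t psi(u)). *)
Definition has_levy_triplet V : Prop :=
  forall t u : R, 0 <= t <= 1 ->
    \int[P]_w cos (u * V t w) =
      expR (t * levy_exponent_re u) * cos (t * levy_exponent_im u) /\
    \int[P]_w sin (u * V t w) =
      expR (t * levy_exponent_re u) * sin (t * levy_exponent_im u).

End triplet.

(* Pure jump: the Gaussian variance of the triplet is 0; a drift is allowed. *)
Definition pure_jump_levy_process V
    (Pi : {measure set (measurableTypeR R) -> \bar R}) : Prop :=
  [/\ levy_process V, levy_measure Pi & exists b, has_levy_triplet b 0 Pi V].

(* xi_n = o_P(a_n), for xi_n with values in the extended reals.  The events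
   are measured with the outer measure of P, which is P on measurable sets:
   a supremum over an uncountable set of times need not be measurable when
   path regularity only holds almost surely. *)
Definition littleo_in_probability (xi : nat -> T -> \bar R) (a : nat -> R) : Prop :=
  forall eps : R, 0 < eps ->
    mu_ext P [set w | (eps%:E < `|xi n w * ((a n)^-1)%:E|)%E]
      @[n --> \oo] --> 0%E.

End processes.

Section rank_statistics.
Context {R : realType}.

(* beta^* = inf {p > 0 : \int_(-1, 1) |x|^p Pi(dx) < oo}. *)
Definition beta_star (Pi : {measure set (measurableTypeR R) -> \bar R}) : R :=
  inf [set p : R | 0 < p /\
    (\int[Pi]_(x in [set` `]-1, 1[%R])
       (`|x| `^ p)%:E < +oo)%E].

Definition std_normal_cdf (x : R) : R := fine (normal_prob 0 1 `]-oo, x]).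

(* The inverse of the normal cdf on its range ]0, 1[; the default value 0 is
   only taken off ]0, 1[. *)
Definition std_normal_quantile : R -> R :=
  'pinv_(fun=> 0) [set: R] std_normal_cdf.

Definition rank (n : nat) (x : 'I_n -> R) (k : 'I_n) : nat :=
  (\sum_(j < n) (x j <= x k)%R)%N.

(* Index i : 'I_n stands for the (i+1)-st increment. *)
Definition grid_incr {T : Type} (V : R -> T -> R) (n : nat) (w : T) :
    'I_n -> R :=
  fun i => V (i.+1%:R / n%:R) w - V (i%:R / n%:R) w.
Arguments grid_incr {T} V n w i : assert.

(* Sum over i < floor (n t): truncn is the floor since 0 <= n t. *)
Definition rank_process {T : Type} (V : R -> T -> R) (n : nat) (t : R) (w : T) :
    R :=
  n%:R `^ (- 2^-1) *
  \sum_(i < n | (i < Num.truncn (n%:R * t))%N)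
     std_normal_quantile ((rank (grid_incr V n w) i)%:R / n.+1%:R).

End rank_statistics.

(* Main.v *)
(** Normalise the increments: x_i = xi_i + zeta_i with xi_i = sqrt n (W_(i/n) - W_((i-1)/n))
    i.i.d. N(0,1) and zeta_i the rescaled increments of Y, recentred by a constant
    that does not affect the ranks.  With D_i = xi_i - Q (R_i / (n+1)), the deviation
    at t splits into the oscillation of W between t and the grid, the centred partial sum
    n^(-1/2) sum_(i <= nt) (D_i - mean D), and a rounding term of size |sum_i D_i| n^(-3/2).

    The pairs (xi_i, zeta_i) are exchangeable, so the partial sums are those of a uniformly
    random permutation of (D_i), and a maximal inequality for sampling without replacement
    bounds their maximum by E (sum_i D_i^2).  The scores Q (R_i / (n+1)) are increasing in x_i, as
    are the values of x_i clipped at M; by the rearrangement inequality the scores are closer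
    to the clipped x_i than the scores built from the ranks of xi are.  This leaves the
    Gaussian tail beyond M, M^2 E (min (zeta_i^2, 1)), and the mean square error of the normal scores of an
    i.i.d. Gaussian sample, which is of order (log n)^(5/2) / n.

    Averaging the characteristic function of the increment of Y over frequencies in [0, 1] bounds
    E (min (zeta_i^2, 1)) by a multiple of the integral of min (x^2, 1/n) under Pi,
    which tends to 0, and is O(n^(q/2 - 1)) when |x|^q is integrable near 0. *)
From HB Require Import structures.
From mathcomp Require Import all_boot all_order all_algebra.
From mathcomp Require Import all_classical all_reals all_analysis.
From mathcomp Require Import all_fingroup measurable_realfun.
From mathcomp Require Import ring lra zify.
Require Import Defs.
Set Implicit Arguments.
Unset Strict Implicit.
Unset Printing Implicit Defensive.
Import Order.TTheory GRing.Theory Num.Theory.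
Import numFieldNormedType.Exports.
Local Open Scope classical_set_scope.
Local Open Scope ring_scope.

(** The ranks couple all the increments, so the errors D_i are neither independent nor centred.
    Exchangeability survives, and the bridge term of the statement removes their mean, which
    exchangeability cannot control. Hence only S = E (sum_i D_i^2) has to be estimated: the
    deviation is of order (S/n)^(1/2), so the target n^(-1/2 + p/4) asks for S = o(n^(p/2)).

    The pieces of S are of order n exp(-M^2/2), n M^2 J_n and (log n)^(5/2), where J_n is the
    integral of min(x^2, 1/n) under Pi, up to a term 1/n. For p < 2 an exponent q strictly between
    beta^* and p gives J_n = O(n^(q/2 - 1)); M is then of order (log n)^(1/2), and the gap n^((p -
    q)/2) absorbs all logarithms. For p = 2 no rate for J_n is available, since beta^* may equal 2;
    M is then a large constant fixed before n tends to infinity.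

    Y may have infinite variance and enters only through its triplet. This is why its increments are
    truncated in min(zeta^2, 1) and handled by their characteristic function, the centring constant
    being obtained by an existence argument. *)

(** * Maximal inequality for sampling without replacement *)

Section permutation_maximal_inequality.
Variable R : realFieldType.

Fixpoint running_max (M : nat -> R) (k : nat) : R :=
  if k is j.+1 then Num.max (running_max M j) (M j.+1) else Num.max 0 (M 0%N).

Lemma running_max_ub (M : nat -> R) k j : (j <= k)%N -> M j <= running_max M k.
Proof.
elim: k => [|k IH]; first by rewrite leqn0 => /eqP ->; rewrite /= le_max lexx orbT.
by rewrite leq_eqVlt => /orP[/eqP -> |/IH jk] /=; rewrite le_max ?lexx ?orbT// jk.
Qed.

Lemma running_max_ge0 (M : nat -> R) k : 0 <= running_max M k.
Proof. by elim: k => [|k IH] /=; rewrite le_max ?lexx// IH. Qed.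

(** A deterministic form of Doob's L^2 inequality: the sum is a discrete stochastic integral whose
    integrand is known before each increment, so it averages to zero for a martingale. Summation by
    parts bounds twice that sum by [2 a M - a^2], with [a] the final maximum and [M] the final
    value; the square [(a - 2 M)^2 >= 0] does the rest. *)
Lemma pathwise_doob (M : nat -> R) m : M 0%N = 0 ->
  running_max M m ^+ 2 + 4 * (\sum_(k < m) running_max M k * (M k.+1 - M k))
    <= 4 * M m ^+ 2.
Proof.
move=> M0.
suff H : 2 * (\sum_(k < m) running_max M k * (M k.+1 - M k))
    <= 2 * running_max M m * M m - running_max M m ^+ 2.
  have : 0 <= (running_max M m - 2 * M m) ^+ 2 by exact: sqr_ge0.
  nra.
elim: m => [|m IH].
  rewrite big_ord0 /= M0 maxxx; lra.
rewrite big_ord_recr /=.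
set a := running_max M m in IH *; set S := (\sum_(i < m) _) in IH *.
have [h|h] := leP a (M m.+1); nra.
Qed.

Variables (n : nat) (d : 'I_n -> R).
Hypothesis sumd : \sum_i d i = 0.

Definition perm_psum (k : nat) (s : {perm 'I_n}) : R :=
  \sum_(i < n | (i < k)%N) d (s i).

(** Given the first [k] draws, the next one has mean minus the partial sum over [n - k], because all
    the values add up to zero. Dividing by [n - k] turns the partial sums into a martingale for
    [k < n]. *)
Definition perm_mart (k : nat) (s : {perm 'I_n}) : R :=
  perm_psum k s / (n%:R - k%:R).

Lemma perm_psum_tail k (s : {perm 'I_n}) :
  \sum_(i < n | (k <= i)%N) d (s i) = - perm_psum k s.
Proof.
apply/eqP; rewrite -addr_eq0 addrC /perm_psum; apply/eqP.
rewrite -[RHS]sumd [RHS](reindex_inj (@perm_inj _ s)) /=.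
rewrite [RHS](bigID (fun i : 'I_n => (i < k)%N)) /=; congr (_ + _).
by apply: eq_bigl => i; rewrite -leqNgt.
Qed.

(** Measurability with respect to the first [k] draws, written as invariance under swapping two
    later positions: [(tperm i j * s)%g] applies [tperm i j] first, hence acts on positions. *)
Definition depends_on_first (k : nat) (f : {perm 'I_n} -> R) :=
  forall (s : {perm 'I_n}) (i j : 'I_n), (k <= i)%N -> (k <= j)%N ->
  f (tperm i j * s)%g = f s.

Lemma depends_psum k j : (j <= k)%N -> depends_on_first k (perm_psum j).
Proof.
move=> jk s i1 i2 h1 h2; apply: eq_bigr => i ij; rewrite permM tpermD //.
  by apply/eqP => E; move: ij; rewrite -E ltnNge (leq_trans jk h1).
by apply/eqP => E; move: ij; rewrite -E ltnNge (leq_trans jk h2).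
Qed.

(** Swapping positions [i] and [j] with [i <= j] leaves [f] unchanged, so [d (s i)] may be replaced
    by any later [d (s j)]; the sum over the [n - i] choices of [j] is the tail sum, minus the
    partial sum. This is the conditional expectation of the next draw. *)
Lemma depends_martingale (f : {perm 'I_n} -> R) (i : 'I_n) :
  depends_on_first i f ->
  \sum_s f s * d (s i) * (n%:R - i%:R) = - \sum_s f s * perm_psum i s.
Proof.
move=> df.
transitivity (\sum_(j < n | (i <= j)%N) \sum_s f s * d (s j)).
  transitivity (\sum_(j < n | (i <= j)%N) \sum_s f s * d (s i)).
    rewrite -mulr_suml [RHS]sumr_const -[RHS]mulr_natr; congr (_ * _).
    have -> : #|[pred j : 'I_n | (i <= j)%N]| = (n - i)%N.
      rewrite -sum1_card -[RHS]muln1 -sum_nat_const_nat.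
      by rewrite [RHS]big_geq_mkord.
    by rewrite natrB // ltnW.
  apply: eq_bigr => j ij.
  rewrite (reindex_inj (mulgI (tperm i j))) /=; apply: eq_bigr => s _.
  by rewrite df // permM tpermL.
rewrite exchange_big /= -sumrN; apply: eq_bigr => s _.
by rewrite -mulr_sumr perm_psum_tail mulrN.
Qed.

Lemma sum_depends_mart_incr k (f : {perm 'I_n} -> R) :
  (k.+1 < n)%N -> depends_on_first k f ->
  \sum_s f s * (perm_mart k.+1 s - perm_mart k s) = 0.
Proof.
move=> kn df; have kn' : (k < n)%N := ltnW kn.
have n1 : n%:R - k.+1%:R != 0 :> R by rewrite subr_eq0 eqr_nat gtn_eqF.
have n2 : n%:R - k%:R != 0 :> R by rewrite subr_eq0 eqr_nat gtn_eqF.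
transitivity (\sum_s (f s * d (s (Ordinal kn')) * (n%:R - k%:R) + f s * perm_psum k s)
   / ((n%:R - k.+1%:R) * (n%:R - k%:R))).
  apply: eq_bigr => s _; rewrite /perm_mart.
  have -> : perm_psum k.+1 s = perm_psum k s + d (s (Ordinal kn')).
    rewrite /perm_psum (bigD1 (Ordinal kn')) //= addrC; congr (_ + _).
    apply: eq_bigl => i; rewrite ltnS leq_eqVlt -val_eqE /=.
    by case: (ltngtP i k) => //= _; rewrite ?andbF.
  move: n1 n2; rewrite -[k.+1%:R]natr1 => n1 n2.
  field; by rewrite n1 n2.
by rewrite -mulr_suml big_split /= (@depends_martingale f (Ordinal kn') df) addNr mul0r.
Qed.

(** Draws without replacement are negatively correlated: the cross term of a partial sum with the
    next draw is a nonpositive multiple of the mean square of that partial sum. *)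
Lemma sum_perm_psum_sqr m : (m <= n)%N ->
  \sum_s perm_psum m s ^+ 2 <= n`!%:R * \sum_i d i ^+ 2.
Proof.
move=> mn.
have H : \sum_s perm_psum m s ^+ 2 <= \sum_(i < n | (i < m)%N) \sum_(s : {perm 'I_n}) d (s i) ^+ 2.
  elim: m mn => [_|m IH mn].
    rewrite [leLHS]big1 => [|s _]; last by rewrite /perm_psum big_pred0 ?expr0n.
    by apply: sumr_ge0 => i _; apply: sumr_ge0 => s _; exact: sqr_ge0.
  have {}IH := IH (ltnW mn).
  rewrite (bigD1 (Ordinal mn)) //= addrC.
  rewrite (eq_bigl (fun i : 'I_n => (i < m)%N)); last first.
    move=> i; rewrite ltnS leq_eqVlt -val_eqE /=.
    by case: (ltngtP i m) => //= _; rewrite ?andbF.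
  rewrite (_ : \sum_s perm_psum m.+1 s ^+ 2 = \sum_s perm_psum m s ^+ 2 +
    2 * \sum_s perm_psum m s * d (s (Ordinal mn)) + \sum_(s : {perm 'I_n}) d (s (Ordinal mn)) ^+ 2).
    have := @depends_martingale (perm_psum m) (Ordinal mn) (depends_psum (leqnn m)).
    rewrite -mulr_suml.
    have nm : 0 < n%:R - m%:R :> R by rewrite subr_gt0 ltr_nat.
    have : 0 <= \sum_s perm_psum m s * perm_psum m s by apply: sumr_ge0 => s _; rewrite -expr2 sqr_ge0.
    move=> h1 h2.
    have : \sum_s perm_psum m s * d (s (Ordinal mn)) <= 0.
      by rewrite -(pmulr_lle0 _ nm) [_ * (_ - _)]h2 oppr_le0.
    move: IH; lra.
  rewrite mulr_sumr -!big_split; apply: eq_bigr => s _ /=.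
  have -> : perm_psum m.+1 s = perm_psum m s + d (s (Ordinal mn)).
    rewrite /perm_psum (bigD1 (Ordinal mn)) //= addrC; congr (_ + _).
    apply: eq_bigl => i; rewrite ltnS leq_eqVlt -val_eqE /=.
    by case: (ltngtP i m) => //= _; rewrite ?andbF.
  ring.
apply: le_trans H _.
apply: (@le_trans _ _ (\sum_i \sum_(s : {perm 'I_n}) d (s i) ^+ 2)).
  rewrite [leRHS](bigID (fun i : 'I_n => (i < m)%N)) /= lerDl.
  by apply: sumr_ge0 => i _; apply: sumr_ge0 => s _; exact: sqr_ge0.
rewrite exchange_big /= (eq_bigr (fun=> \sum_i d i ^+ 2)); last first.
  by move=> s _; rewrite [RHS](reindex_inj (@perm_inj _ s)).
by rewrite sumr_const mulr_natl -card_Sn.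
Qed.

(** The pathwise bound only sees the maximum from above; the sign [e] is used with both values to
    control absolute values. *)
Lemma perm_doob (e : R) m : e ^+ 2 = 1 -> (m < n)%N ->
  \sum_s running_max (fun k => e * perm_mart k s) m ^+ 2
    <= 4 * \sum_s perm_mart m s ^+ 2.
Proof.
move=> e1 mn.
pose a k s := running_max (fun k => e * perm_mart k s) k.
have H s : a m s ^+ 2 + 4 * (\sum_(k < m) a k s * (e * perm_mart k.+1 s - e * perm_mart k s))
    <= 4 * (e * perm_mart m s) ^+ 2.
  apply: (pathwise_doob (M := fun k => e * perm_mart k s)).
  by rewrite /perm_mart /perm_psum big_pred0 // mul0r mulr0.
(* The running maximum at time [k] depends on the first [k] draws only, so each martingale increment
   averages to zero against it. *)
have Z : \sum_s \sum_(k < m) a k s * (e * perm_mart k.+1 s - e * perm_mart k s) = 0.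
  rewrite exchange_big /= big1 // => k _.
  have := @sum_depends_mart_incr k (a k).
  have km : (k.+1 < n)%N by apply: leq_ltn_trans mn.
  move=> /(_ km) Hk.
  under eq_bigr do rewrite -mulrBr mulrCA.
  rewrite -mulr_sumr Hk ?mulr0// => s i j ik jk.
  have E l : (l <= k)%N -> perm_mart l (tperm i j * s)%g = perm_mart l s.
    by move=> lk; rewrite /perm_mart (@depends_psum k l).
  rewrite /a /=; move: (nat_of_ord k) E {ik jk Hk km} => k0.
  elim: k0 => [|l IH] E /=; first by rewrite E.
  by rewrite E // IH // => l' ll'; rewrite E // ltnW.
have : \sum_s (a m s ^+ 2 + 4 * (\sum_(k < m) a k s * (e * perm_mart k.+1 s - e * perm_mart k s))) <=
   \sum_s 4 * (e * perm_mart m s) ^+ 2 by apply: ler_sum => s _; exact: H.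
rewrite big_split /= -mulr_sumr Z mulr0 addr0 -mulr_sumr.
by under [in X in _ <= X -> _]eq_bigr do rewrite exprMn e1 mul1r.
Qed.

(** Passing between the sums and the martingale costs the factor [n / (n - m)], which explodes near
    [n] but is at most 2 in the first half. With Doob's 4 for each of two signs the constant is
    [2^2 * 8 = 32]. The maximum is represented by any [F] dominated, at each permutation, by one of
    the squared partial sums. *)
Lemma perm_maximal_half (F : {perm 'I_n} -> R) m : (m < n)%N -> (n <= (n - m).*2)%N ->
  (forall s, exists2 k, (k <= m)%N & F s <= perm_psum k s ^+ 2) ->
  \sum_s F s <= 32 * n`!%:R * \sum_i d i ^+ 2.
Proof.
move=> mn nm HF.
have nm0 : 0 < n%:R - m%:R :> R by rewrite subr_gt0 ltr_nat.
have n2 : n%:R <= 2 * (n%:R - m%:R) :> R.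
  by rewrite -natrB 1?ltnW// -natrM mul2n ler_nat.
pose a e s := running_max (fun k => e * perm_mart k s) m.
have FE s : F s <= n%:R ^+ 2 * (a 1 s ^+ 2 + a (- 1) s ^+ 2).
  have [k km Fk] := HF s; apply: (le_trans Fk).
  have nk : (k < n)%N := leq_ltn_trans km mn.
  have nk0 : 0 < n%:R - k%:R :> R by rewrite subr_gt0 ltr_nat.
  have -> : perm_psum k s = (n%:R - k%:R) * perm_mart k s.
    by rewrite /perm_mart mulrC mulfVK // gt_eqF.
  rewrite exprMn; apply: ler_pM; rewrite ?sqr_ge0//.
    rewrite ler_sqr ?nnegrE ?ler0n//; last exact: ltW.
    by rewrite gerBl.
  have h1 := running_max_ub (fun k => 1 * perm_mart k s) km.
  have h2 := running_max_ub (fun k => - 1 * perm_mart k s) km.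
  have h3 := running_max_ge0 (fun k => 1 * perm_mart k s) m.
  have h4 := running_max_ge0 (fun k => - 1 * perm_mart k s) m.
  rewrite /a; move: h1 h2 h3 h4; rewrite mul1r mulN1r.
  set x := running_max _ m; set y := running_max _ m => h1 h2 h3 h4.
  have [h|h] := leP 0 (perm_mart k s); nra.
have nmartm : \sum_s n%:R ^+ 2 * perm_mart m s ^+ 2 <= 4 * (n`!%:R * \sum_i d i ^+ 2).
  apply: (@le_trans _ _ (4 * \sum_s perm_psum m s ^+ 2)); last first.
    by rewrite ler_pM2l// sum_perm_psum_sqr// ltnW.
  rewrite mulr_sumr; apply: ler_sum => s _; rewrite /perm_mart exprMn.
  have -> : n%:R ^+ 2 * (perm_psum m s ^+ 2 * (n%:R - m%:R)^-1 ^+ 2) =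
    (n%:R / (n%:R - m%:R)) ^+ 2 * perm_psum m s ^+ 2.
    by rewrite exprMn; ring.
  apply: ler_wpM2r; first exact: sqr_ge0.
  have -> : 4 = 2 ^+ 2 :> R by ring.
  rewrite ler_sqr ?nnegrE ?divr_ge0 ?ler0n//; last exact: ltW.
  by rewrite ler_pdivrMr.
have D1 := @perm_doob 1 m (expr1n _ _) mn.
have D2 := @perm_doob (- 1) m (sqrr_sign R 1) mn.
apply: (@le_trans _ _ (n%:R ^+ 2 * (\sum_s a 1 s ^+ 2 + \sum_s a (- 1) s ^+ 2))).
  rewrite -big_split mulr_sumr /=; apply: ler_sum => s _; exact: FE.
move: nmartm; rewrite -mulr_sumr => nmartm.
apply: (@le_trans _ _ (n%:R ^+ 2 * (8 * \sum_s perm_mart m s ^+ 2))); last by nra.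
by apply: ler_wpM2l; [exact: sqr_ge0|move: D1 D2; rewrite /a; lra].
Qed.

(** A partial sum over more than half of the draws is minus the sum of the remaining ones, that is,
    a short partial sum of the reversed permutation. Both halves contribute 32. *)
Lemma perm_maximal (F : {perm 'I_n} -> R) :
  (forall s, exists2 k, (k <= n)%N & F s <= perm_psum k s ^+ 2) ->
  \sum_s F s <= 64 * n`!%:R * \sum_i d i ^+ 2.
Proof.
move=> HF.
have [n0|n0] := posnP n.
  have D0 : (0:R) <= 64 * n`!%:R * \sum_i d i ^+ 2.
    by rewrite !mulr_ge0 ?ler0n// sumr_ge0// => i _; exact: sqr_ge0.
  apply: le_trans D0; rewrite -oppr_ge0 -sumrN; apply: sumr_ge0 => s _.
  have [k _ /le_trans] := HF s; rewrite /perm_psum big_pred0 ?expr0n/=; last first.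
    by case=> i /=; lia.
  by rewrite oppr_ge0; apply.
pose m := n./2.
have mn : (m < n)%N by rewrite /m; lia.
have nm : (n <= (n - m).*2)%N by rewrite /m; lia.
have F0 (G : R -> R) (P : bool) x : (if P then x else 0) = x * P%:R by case: P; rewrite ?mulr1 ?mulr0.
pose P s := [exists k : 'I_m.+1, F s <= perm_psum k s ^+ 2].
pose F1 s := if P s then F s else 0.
pose F2 s := if P s then 0 else F s.
have -> : \sum_s F s = \sum_s F1 s + \sum_s F2 s.
  by rewrite -big_split; apply: eq_bigr => s _; rewrite /F1 /F2; case: (P s); rewrite /= ?addr0 ?add0r.
have B1 : \sum_s F1 s <= 32 * n`!%:R * \sum_i d i ^+ 2.
  apply: (perm_maximal_half mn nm) => s; rewrite /F1; case: ifPn => [/existsP[k Fk]|_].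
    by exists k => //; rewrite -ltnS.
  by exists 0%N => //; exact: sqr_ge0.
(* Summing over all permutations is invariant under composition with the reversal of positions. *)
pose rv : {perm 'I_n} := perm (@rev_ord_inj n).
have B2 : \sum_s F2 s <= 32 * n`!%:R * \sum_i d i ^+ 2.
  rewrite (reindex_inj (mulgI rv)) /=.
  apply: (perm_maximal_half mn nm) => s; rewrite /F2; case: ifPn => [_|].
    by exists 0%N => //; exact: sqr_ge0.
  move=> /existsPn nP; have [k kn Fk] := HF (rv * s)%g.
  have mk : (m < k)%N.
    rewrite ltnNge; apply/negP => km.
    by have := nP (inord k); rewrite inordK ?ltnS// Fk.
  exists (n - k)%N; first by rewrite /m in mk *; lia.
  apply: (le_trans Fk); rewrite -sqrrN -perm_psum_tail.
  rewrite /perm_psum (reindex_inj (@rev_ord_inj n)) /= le_eqVlt; apply/orP; left; apply/eqP.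
  congr (_ ^+ 2); apply: eq_big => [i|i _]; first by rewrite /=; have := ltn_ord i; lia.
  by rewrite permM permE rev_ordK.
move: B1 B2; lra.
Qed.

End permutation_maximal_inequality.

(** * Ranks, rearrangement and clipping *)

Section ranks.
Variables (R : realType) (n : nat).
Implicit Types (x y : 'I_n -> R) (q : nat -> R).

Lemma rank_ge1 x i : (0 < rank x i)%N.
Proof. by rewrite /rank (bigD1 i) //= lexx. Qed.

Lemma rank_len x i : (rank x i <= n)%N.
Proof.
rewrite /rank -[leqRHS]card_ord -sum1_card; apply: leq_sum => j _.
exact: leq_b1.
Qed.

Lemma rank_lt x i j : x i < x j -> (rank x i < rank x j)%N.
Proof.
move=> ij; rewrite /rank [ltnRHS](bigD1 j) //= lexx add1n ltnS.
rewrite [leqLHS](bigD1 j) //= leNgt ij add0n; apply: leq_sum => k _.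
by case: leP => // /le_trans -> //; exact: ltW.
Qed.

Lemma rank_inj x : injective x -> injective (rank x).
Proof.
move=> xi i j ij; apply: xi; case: (ltgtP (x i) (x j)) => // /rank_lt.
  by rewrite ij ltnn.
by rewrite ij ltnn.
Qed.

Lemma eq_rank (m : nat) (x x' : 'I_m -> R) i i' :
  (forall j, (x j <= x i) = (x' j <= x' i')) -> rank x i = rank x' i'.
Proof. by move=> H; apply: eq_bigr => j _; rewrite H. Qed.

Lemma rank_perm x (s : {perm 'I_n}) i : rank (x \o s) i = rank x (s i).
Proof. by rewrite /rank [RHS](reindex_inj (@perm_inj _ s)). Qed.

Lemma sum_rank (V : nmodType) x (F : nat -> V) : injective x ->
  \sum_i F (rank x i) = \sum_(k < n) F k.+1.
Proof.
move=> xi.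
have r_lt i : ((rank x i).-1 < n)%N by have := rank_ge1 x i; have := rank_len x i; lia.
pose r i := Ordinal (r_lt i).
have r_inj : injective r.
  move=> i j /(congr1 val) /= ij; apply: (rank_inj xi).
  by have := rank_ge1 x i; have := rank_ge1 x j; lia.
rewrite [RHS](reindex_inj r_inj) /=; apply: eq_bigr => i _.
by rewrite prednK // rank_ge1.
Qed.

(** A threshold [c] separates the values of [y] on [A] from those off [A]. As the two sets have the
    same size, [y] may be replaced by [y - c], after which the difference of the sums is nonnegative
    term by term. *)
Lemma sum_top_set y (A B : pred 'I_n) :
  (\sum_i (A i : nat) = \sum_i (B i : nat))%N ->
  (forall i j, A i -> ~~ A j -> y j <= y i) ->
  \sum_i (B i)%:R * y i <= \sum_i (A i)%:R * y i.
Proof.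
move=> AB Ay.
suff [c [c1 c2]] : exists c, (forall i, A i -> c <= y i) /\ (forall i, ~~ A i -> y i <= c).
  have E : \sum_i ((A i)%:R - (B i)%:R) = 0 :> R.
    by rewrite big_split /= sumrN -!natr_sum AB subrr.
  rewrite -subr_ge0 -sumrB.
  have -> : \sum_i ((A i)%:R * y i - (B i)%:R * y i) =
     \sum_i ((A i)%:R - (B i)%:R) * (y i - c) :> R.
    under [RHS]eq_bigr do rewrite mulrBr.
    rewrite [RHS]sumrB -[X in _ = _ - X]mulr_suml E mul0r subr0.
    by apply: eq_bigr => i _; rewrite mulrBl.
  apply: sumr_ge0 => i _.
  have := c1 i; have := c2 i.
  case: (A i); case: (B i) => //= h1 h2; rewrite ?subrr ?mul0r ?subr0 ?mul1r ?sub0r ?mulN1r ?oppr_ge0 ?subr_ge0 ?subr_le0; auto.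
case: (pickP A) => [i0 Ai0|A0].
  exists (y [arg min_(i < i0 | A i) y i]%O).
  case: (Order.TotalTheory.arg_minP y Ai0) => i Ai Hi; split => [j Aj|j Aj]; first exact: Hi.
  exact: Ay.
exists (\sum_i `|y i|); split => [i|i _]; first by rewrite A0.
rewrite (bigD1 i) //=; apply: le_trans (ler_norm _) _.
by rewrite lerDl; apply: sumr_ge0.
Qed.

(** Layer decomposition of a score: a monotone [q] is a nonnegative combination of the indicators of
    high ranks, which reduces rearrangement to [sum_top_set]. *)
Lemma rank_layers q r : (0 < r <= n)%N ->
  q r = q 1%N + \sum_(k < n) (k.+1 < r)%N%:R * (q k.+2 - q k.+1).
Proof.
move=> /andP[r0 rn].
rewrite -(big_mkord predT (fun k => (k.+1 < r)%N%:R * (q k.+2 - q k.+1))) /=.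
rewrite (big_cat_nat _ (n := r.-1)) //=; last by lia.
rewrite [X in _ + (_ + X)]big_nat_cond [X in _ + (_ + X)]big1 ?addr0; last first.
  by move=> i /andP[/andP[h _] _]; rewrite ltnNge (_ : (r <= i.+1)%N) ?mul0r//; lia.
rewrite big_nat_cond (eq_bigr (fun k => q k.+2 - q k.+1)); last first.
  by move=> i /andP[/andP[_ h] _]; rewrite (_ : (i.+1 < r)%N) ?mul1r//; lia.
rewrite -big_nat_cond (telescope_sumr (fun k => q k.+1)) // prednK // addrC subrK //.
Qed.

(** Ranks without ties run through [1..n], so the sums of squares agree for [x] and [x'] and only
    the cross terms differ. In each layer the top set of [x] collects the largest values of [y],
    since [y] is nondecreasing in [x]. *)
Lemma rearrangement x x' y q : injective x -> injective x' ->
  (forall i j, x i <= x j -> y i <= y j) ->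
  (forall k, (0 < k < n)%N -> q k <= q k.+1) ->
  \sum_i (y i - q (rank x i)) ^+ 2 <= \sum_i (y i - q (rank x' i)) ^+ 2.
Proof.
move=> xi xi' xy qm.
have E (z : 'I_n -> R) : \sum_i (y i - q (rank z i)) ^+ 2 =
   \sum_i y i ^+ 2 + \sum_i q (rank z i) ^+ 2 - 2 * \sum_i q (rank z i) * y i.
  rewrite mulr_sumr -big_split -sumrB /=; apply: eq_bigr => i _; ring.
have E2 (z : 'I_n -> R) : \sum_i q (rank z i) * y i = q 1%N * (\sum_i y i) +
   \sum_(k < n) (q k.+2 - q k.+1) * \sum_i (k.+1 < rank z i)%N%:R * y i.
  under eq_bigr => i _ do rewrite (@rank_layers q (rank z i)) ?rank_ge1 ?rank_len// mulrDl.
  rewrite big_split -mulr_sumr /=; congr (_ + _).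
  under eq_bigr do rewrite mulr_suml.
  rewrite exchange_big /=; apply: eq_bigr => k _; rewrite mulr_sumr.
  by apply: eq_bigr => i _; rewrite mulrCA mulrA.
rewrite !E (sum_rank (fun r => q r ^+ 2) xi) (sum_rank (fun r => q r ^+ 2) xi').
rewrite lerD2l lerN2 ler_pM2l // !E2 lerD2l.
apply: ler_sum => k _.
have [kn|kn] := ltnP k.+1 n.
  apply: ler_wpM2l; first by rewrite subr_ge0 qm.
  apply: (sum_top_set (A := fun i => (k.+1 < rank x i)%N)
      (B := fun i => (k.+1 < rank x' i)%N)) => /=.
    rewrite (sum_rank (fun r => (k.+1 < r)%N : nat) xi).
    by rewrite (sum_rank (fun r => (k.+1 < r)%N : nat) xi').
  move=> i j ki kj; apply: xy; rewrite leNgt; apply/negP => /rank_lt; lia.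
(* The last layer involves [q] beyond rank [n], where no monotonicity is assumed; it vanishes
   because no rank exceeds [n]. *)
have Z (z : 'I_n -> R) : \sum_i (k.+1 < rank z i)%N%:R * y i = 0.
  by apply: big1 => i _; rewrite ltnNge (leq_trans (rank_len z i)) ?mul0r.
by rewrite !Z.
Qed.

Definition clip (M z : R) : R := Num.max (- M) (Num.min z M).

Lemma clip_le M z z' : z <= z' -> clip M z <= clip M z'.
Proof.
by move=> h; rewrite /clip ge_max le_max lexx /= le_max le_min !ge_min h lexx /= !orbT.
Qed.

Definition excess (M z : R) : R := Num.max (`|z| - M) 0.

(** Clipping is a contraction with values in an interval of length [2 M], so moving [u] by [z]
    shifts the clipped value by at most [min(|z|, 2 M)], while clipping [u] itself costs its excess.
    The assumption [1 <= M] turns the truncation at [2 M] into one at 1. *)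
Lemma clip_perturb M u z : 1 <= M ->
  (u - clip M (u + z)) ^+ 2 <=
    2 * excess M u ^+ 2 + 8 * M ^+ 2 * Num.min (z ^+ 2) 1.
Proof.
move=> M1.
have K : `|u - clip M (u + z)| <= excess M u + Num.min `|z| (2 * M).
  rewrite /excess /clip.
  case: (leP (u + z) M) => h1; [case: (leP (- M) (u + z))|case: (leP (- M) M)] => h2;
    case: (ger0P u) => h5; case: (ger0P z) => h6; rewrite ler_norml; apply/andP; split;
    rewrite /Num.max /Num.min; repeat case: ifPn => [?|]; rewrite -?leNgt => *; lra.
have K2 : Num.min `|z| (2 * M) ^+ 2 <= 4 * M ^+ 2 * Num.min (z ^+ 2) 1.
  rewrite -[z ^+ 2]real_normK ?num_real//; have := normr_ge0 z.
  move: (`|z| : R) => a a0.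
  have M2 : 1 <= M ^+ 2 by rewrite expr_ge1 //; lra.
  have aM : 0 <= a ^+ 2 * (4 * M ^+ 2 - 1) by apply: mulr_ge0; [exact: sqr_ge0|lra].
  have [t tE] : exists t, t = 2 * M by exists (2 * M).
  rewrite -tE; case: (leP a t) => h; case: (leP (a ^+ 2) 1) => h'; rewrite tE in h *.
  - lra.
  - by rewrite mulr1; have := ler_pM a0 a0 h h; rewrite -!expr2 exprMn; lra.
  - have : 1 < a by lra.
    by rewrite -(ltr_pXn2r (n := 2)) ?nnegrE ?expr1n//; lra.
  - by rewrite mulr1 exprMn; lra.
have e0 : 0 <= excess M u by rewrite le_max lexx orbT.
have m0 : 0 <= Num.min `|z| (2 * M) by rewrite le_min normr_ge0; lra.
have : (u - clip M (u + z)) ^+ 2 <= (excess M u + Num.min `|z| (2 * M)) ^+ 2.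
  by rewrite -[X in X <= _]real_normK ?num_real// ler_sqr ?nnegrE// addr_ge0.
have := sqr_ge0 (excess M u - Num.min `|z| (2 * M)); move: K2; nra.
Qed.

(* Q is compared with the clipped perturbed values through the rearrangement
   inequality, hence no control of the ranks of u + z is needed. *)
Lemma rank_score_error (u z : 'I_n -> R) M q : 1 <= M ->
  injective u -> injective (fun i => u i + z i) ->
  (forall k, (0 < k < n)%N -> q k <= q k.+1) ->
  \sum_i (u i - q (rank (fun j => u j + z j) i)) ^+ 2 <=
    \sum_i (12 * excess M (u i) ^+ 2 + 48 * M ^+ 2 * Num.min (z i ^+ 2) 1
       + 4 * (u i - q (rank u i)) ^+ 2).
Proof.
move=> M1 ui xi qm; pose x i := u i + z i; pose y i := clip M (x i).
have A : \sum_i (y i - q (rank x i)) ^+ 2 <= \sum_i (y i - q (rank u i)) ^+ 2.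
  by apply: rearrangement => // i j; exact: clip_le.
apply: (@le_trans _ _ (2 * \sum_i (u i - y i) ^+ 2 + 2 * \sum_i (y i - q (rank x i)) ^+ 2)).
  rewrite !mulr_sumr -big_split /=; apply: ler_sum => i _.
  by have := sqr_ge0 ((u i - y i) - (y i - q (rank x i))); rewrite -/x; nra.
(* In total [(u - y)^2] is counted 2 + 4 = 6 times, which with the factors 2 and 8 of [clip_perturb]
   gives 12 and 48. *)
apply: (@le_trans _ _ (2 * \sum_i (u i - y i) ^+ 2 +
    2 * \sum_i (2 * (u i - y i) ^+ 2 + 2 * (u i - q (rank u i)) ^+ 2))).
  rewrite lerD2l ler_pM2l//; apply: (le_trans A); apply: ler_sum => i _.
  by have := sqr_ge0 ((u i - y i) + (u i - q (rank u i))); nra.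
rewrite !mulr_sumr -big_split /=; apply: ler_sum => i _.
by have := clip_perturb (u i) (z i) M1; rewrite -/(x i) -/(y i); lra.
Qed.

End ranks.

(** * Integrals and tails of the standard normal law *)

Section gaussian.
Context {R : realType}.
Local Notation mu := (@lebesgue_measure R).
Local Notation gamma := (@normal_prob R 0 1).

Lemma integral_normal_prob (m s : R) (f : R -> \bar R) :
  measurable_fun [set: R] f -> (forall x, 0 <= f x)%E ->
  (\int[normal_prob m s]_x f x = \int[mu]_x (f x * (normal_pdf m s x)%:E))%E.
Proof.
move=> mf f0; have dom := normal_prob_dominates m s.
rewrite -(Radon_Nikodym_SigmaFinite.change_of_variables dom) //.
have mRN := measurable_int _ (Radon_Nikodym_SigmaFinite.f_integrable dom).
apply: ae_eq_integral => //.
- exact: emeasurable_funM.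
- by apply: emeasurable_funM => //; apply/measurable_EFinP; exact: measurable_normal_pdf.
apply: ae_eqe_mul2l; apply: integral_ae_eq => //.
- exact: Radon_Nikodym_SigmaFinite.f_integrable.
- by apply/measurable_EFinP; exact: measurable_normal_pdf.
- by move=> E _ mE; rewrite -Radon_Nikodym_SigmaFinite.f_integral.
Qed.

Lemma lebesgue_integral_affine (s c : R) (f : R -> \bar R) : 0 < s ->
  measurable_fun [set: R] f -> (forall x, 0 <= f x)%E ->
  (\int[mu]_x f x = s%:E * \int[mu]_x f (s * x + c)%R)%E.
Proof.
move=> s0 mf f0.
pose F (x : R) : measurableTypeR R := s * x + c.
have mF : measurable_fun [set: measurableTypeR R] F.
  by apply: measurable_funD => //; exact: measurable_funM.
pose s' := NngNum (ltW s0).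
pose m0 : {measure set (measurableTypeR R) -> \bar R} := mscale s' (pushforward mu F).
pose m := m0 mF.
have E A : measurable A -> mu A = m A.
  apply: lebesgue_measure_unique => _ [[a b]] _ <- /=.
  have preE : F @^-1` `]a, b] = `](a - c) / s, (b - c) / s]%classic.
    apply/seteqP; split => x /=; rewrite !in_itv /= /F ltr_pdivrMr // ler_pdivlMr //; lra.
  have -> : mscale s' (pushforward mu F) `]a, b]%classic = (s%:E * mu `]((a - c) / s)%R, ((b - c) / s)%R]%classic)%E.
    by rewrite -preE.
  rewrite !lebesgue_measure_itv /= !lte_fin ltr_pM2r ?invr_gt0// ltrD2r.
  case: ifP => _; last by rewrite mule0.
  rewrite -!EFinD -EFinM; congr (_%:E); field; exact: lt0r_neq0.
transitivity (\int[m]_x f x)%E; first by apply: eq_measure_integral => A mA _; exact: E.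
rewrite ge0_integral_mscale //= ge0_integral_pushforward //.
Qed.

Definition gauss_kernel (x : R) : R := expR (- (x ^+ 2 / 2)).
Definition gauss_const : R := normal_peak 1.

Lemma gauss_const_gt0 : 0 < gauss_const.
Proof. exact: normal_peak_gt0. Qed.

Lemma gauss_const_le1 : gauss_const <= 1.
Proof.
rewrite /gauss_const /normal_peak invf_le1 ?sqrtr_gt0.
  rewrite -[leLHS]sqrtr1 ler_sqrt.
    by have := @pi_ge2 R; rewrite expr1n mul1r mulr2n; lra.
  by have := @pi_gt0 R; rewrite expr1n mul1r mulr2n; lra.
by have := @pi_gt0 R; rewrite expr1n mul1r mulr2n; lra.
Qed.

Lemma normal_pdf01E x : normal_pdf 0 1 x = gauss_const * gauss_kernel x.
Proof.
rewrite normal_pdfE ?oner_eq0// /normal_fun subr0 expr1n mulr2n.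
by rewrite /gauss_kernel mulNr.
Qed.

Lemma gauss_kernel_gt0 x : 0 < gauss_kernel x.
Proof. exact: expR_gt0. Qed.

Lemma gauss_kernel_le1 x : gauss_kernel x <= 1.
Proof. by rewrite -expR0 ler_expR oppr_le0 divr_ge0 ?sqr_ge0. Qed.

Lemma normal_prob_scale (s : R) A : 0 < s -> measurable A ->
  normal_prob 0 s A = gamma ((fun x => s * x) @^-1` A).
Proof.
move=> s0 mA.
have mB : measurable ((fun x : measurableTypeR R => s * x : measurableTypeR R) @^-1` A).
  rewrite -[X in measurable X]setTI.
  by apply: (measurable_funM (@measurable_cst _ _ _ _ setT s) (@measurable_id _ _ setT)).
rewrite /normal_prob integral_mkcond [RHS]integral_mkcond.
rewrite (@lebesgue_integral_affine s 0) //; last 2 first.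
- apply/(measurable_restrictT _ _).1 => //; apply: measurable_funTS.
  by apply/measurable_EFinP; exact: measurable_normal_pdf.
- by move=> x; rewrite patchE; case: ifP => // _; rewrite lee_fin normal_pdf_ge0.
rewrite -ge0_integralZl_EFin //; last 3 first.
- by move=> x _; rewrite patchE; case: ifP => // _; rewrite lee_fin normal_pdf_ge0.
- apply: (measurableT_comp (f := ((fun x => (normal_pdf 0 s x)%:E) \_ A))).
    apply/(measurable_restrictT _ _).1 => //; apply: measurable_funTS.
    by apply/measurable_EFinP; exact: measurable_normal_pdf.
  by apply: measurable_funD => //; exact: measurable_funM.
- exact: ltW.
apply: eq_integral => x _; rewrite addr0 !patchE.
have -> : (x \in [eta *%R s] @^-1` A) = (s * x \in A) by [].
case: ifP => _; last by rewrite mule0.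
rewrite -EFinM normal_pdf01E normal_pdfE ?gt_eqF//; congr (_%:E).
rewrite /normal_fun subr0 /gauss_kernel /gauss_const mulrA; congr (_ * expR _).
  rewrite /normal_peak expr1n mul1r -mulrnAr sqrtrM ?sqr_ge0// sqrtr_sqr gtr0_norm//.
  by rewrite invfM mulrA divff ?gt_eqF// mul1r.
rewrite mulNr -mulr_natr; congr (- _); field; exact: lt0r_neq0.
Qed.

Lemma measurable_normal_pdf01 : measurable_fun [set: R] (normal_pdf 0 1 : R -> R).
Proof. exact: measurable_normal_pdf. Qed.

(** When [y] and [c] have the same sign, [(y + c)^2 >= y^2 + c^2], so shifting by [c] extracts the
    factor [gauss_kernel c] from the density. All the Gaussian tail bounds come from this. *)
Lemma gamma_shift_le (c : R) (h k : R -> R) :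
  measurable_fun [set: R] h -> measurable_fun [set: R] k ->
  (forall x, 0 <= h x) -> (forall x, 0 <= k x) ->
  (forall y, 0 < h (y + c) -> 0 <= y * c /\ h (y + c) <= k y) ->
  (\int[gamma]_x (h x)%:E <= (gauss_kernel c)%:E * \int[gamma]_x (k x)%:E)%E.
Proof.
move=> mh mk h0 k0 hk.
have mpdf := measurable_normal_pdf01.
rewrite !integral_normal_prob //; try exact/measurable_EFinP.
rewrite (@lebesgue_integral_affine 1 c) //; last 2 first.
- by under eq_fun do rewrite -EFinM; apply/measurable_EFinP; exact: measurable_funM.
- by move=> x; rewrite -EFinM lee_fin mulr_ge0 // normal_pdf_ge0.
rewrite mul1e -ge0_integralZl_EFin //; last 3 first.
- by move=> x _; rewrite -EFinM lee_fin mulr_ge0 // normal_pdf_ge0.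
- by under eq_fun do rewrite -EFinM; apply/measurable_EFinP; exact: measurable_funM.
- exact/ltW/gauss_kernel_gt0.
have mc : measurable_fun [set: R] (fun x : R => 1 * x + c).
  by apply: measurable_funD => //; exact: measurable_funM.
apply: ge0_le_integral => //.
- by move=> x _; rewrite -EFinM lee_fin mulr_ge0 // normal_pdf_ge0.
- under eq_fun do rewrite -EFinM; apply/measurable_EFinP; apply: measurable_funM.
    exact: (measurableT_comp (f := h)).
  exact: (measurableT_comp (f := normal_pdf 0 1)).
- under eq_fun do rewrite -!EFinM; apply/measurable_EFinP.
  by apply: measurable_funM => //; exact: measurable_funM.
move=> x _; rewrite -!EFinM lee_fin mul1r !normal_pdf01E.
have [hx|hx] := leP (h (x + c)) 0.
  have -> : h (x + c) = 0 by apply/le_anti; rewrite hx h0.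
  by rewrite mul0r !mulr_ge0 // ltW ?gauss_kernel_gt0 ?gauss_const_gt0.
have [xc hk'] := hk _ hx.
have E : gauss_kernel (x + c) <= gauss_kernel c * gauss_kernel x.
  by rewrite /gauss_kernel -expRD ler_expR sqrrD; lra.
apply: (@le_trans _ _ (k x * (gauss_const * (gauss_kernel c * gauss_kernel x)))).
  apply: ler_pM => //; last by rewrite ler_pM2l ?gauss_const_gt0.
  by rewrite mulr_ge0 // ltW ?gauss_kernel_gt0 ?gauss_const_gt0.
by rewrite le_eqVlt; apply/orP; left; apply/eqP; ring.
Qed.

Lemma gamma_tail_le (M : R) (h k : R -> R) : 0 <= M ->
  measurable_fun [set: R] h -> measurable_fun [set: R] k ->
  (forall x, 0 <= h x) -> (forall x, 0 <= k x) ->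
  (forall x, `|x| <= M -> h x = 0) ->
  (forall y, 0 <= y -> h (y + M) <= k y /\ h (- y - M) <= k (- y)) ->
  (\int[gamma]_x (h x)%:E <= (2 * gauss_kernel M)%:E * \int[gamma]_x (k x)%:E)%E.
Proof.
move=> M0 mh mk h0 k0 hM hk.
pose h1 x := h x * \1_(`]M, +oo[%classic : set R) x.
pose h2 x := h x * \1_(`]-oo, - M[%classic : set R) x.
have mh1 : measurable_fun [set: R] h1.
  by apply: measurable_funM => //; apply: measurable_indic; exact: measurable_itv.
have mh2 : measurable_fun [set: R] h2.
  by apply: measurable_funM => //; apply: measurable_indic; exact: measurable_itv.
have h10 x : 0 <= h1 x by rewrite mulr_ge0.
have h20 x : 0 <= h2 x by rewrite mulr_ge0.
have hE x : h x = h1 x + h2 x.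
  rewrite /h1 /h2 !indicE !mem_setE !in_itv /= andbT.
  have [xM|] := leP `|x| M; first by rewrite hM // !mul0r addr0.
  by rewrite ltr_normr => /orP[]; case: (ltP M x); case: (ltP x (- M)) => *; rewrite ?mulr1 ?mulr0 ?addr0 ?add0r //; lra.
have -> : (\int[gamma]_x (h x)%:E = \int[gamma]_x (h1 x)%:E + \int[gamma]_x (h2 x)%:E)%E.
  rewrite -ge0_integralD //.
  - by apply: eq_integral => x _; rewrite hE EFinD.
  - by move=> x _; rewrite lee_fin.
  - exact/measurable_EFinP.
  - by move=> x _; rewrite lee_fin.
  - exact/measurable_EFinP.
have A1 : (\int[gamma]_x (h1 x)%:E <= (gauss_kernel M)%:E * \int[gamma]_x (k x)%:E)%E.
  apply: gamma_shift_le => // y; rewrite /h1 indicE mem_setE in_itv /= andbT ltrDr.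
  case: (ltP 0 y) => y0; rewrite ?mulr0 ?ltxx// mulr1 => _.
  by split; [rewrite mulr_ge0// ltW|exact: (hk y (ltW y0)).1].
have A2 : (\int[gamma]_x (h2 x)%:E <= (gauss_kernel M)%:E * \int[gamma]_x (k x)%:E)%E.
  have -> : gauss_kernel M = gauss_kernel (- M) by rewrite /gauss_kernel sqrrN.
  apply: gamma_shift_le => // y; rewrite /h2 indicE mem_setE in_itv /= gtrDr.
  case: (ltP y 0) => y0; rewrite ?mulr0 ?ltxx// mulr1 => _; split; first by nra.
  by have := (hk (- y) _).2; rewrite opprK oppr_ge0; apply; exact: ltW.
apply: (le_trans (leeD A1 A2)).
suff -> : 2 * gauss_kernel M = gauss_kernel M + gauss_kernel M.
  have e0 : (0 <= (gauss_kernel M)%:E :> \bar R)%E by rewrite lee_fin ltW ?gauss_kernel_gt0.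
  by rewrite EFinD ge0_muleDl.
ring.
Qed.

End gaussian.

(** * The normal distribution function and its quantiles *)

Section normal_cdf.
Context {R : realType}.
Local Notation mu := (@lebesgue_measure R).
Local Notation gamma := (@normal_prob R 0 1).
Local Notation Phi := (@std_normal_cdf R).
Local Notation Q := (@std_normal_quantile R).

Lemma std_normal_cdfE (x : R) : gamma `]-oo, x]%classic = (Phi x)%:E.
Proof. by rewrite /std_normal_cdf fineK // fin_num_measure. Qed.

Lemma std_normal_cdfB (a b : R) : a <= b ->
  gamma `]a, b]%classic = (Phi b - Phi a)%:E.
Proof.
move=> ab.
have E : gamma `]-oo, b]%classic = (gamma `]-oo, a]%classic + gamma `]a, b]%classic)%E.
  rewrite -measureU //.
    by congr (gamma _); apply/seteqP; split => x /=; rewrite !in_itv /=; case: (leP x a) => //= h; [left|right|case|case] => //; lra.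
  by apply/seteqP; split => x //= [] /=; rewrite !in_itv /= => h /andP[]; rewrite ltNge h.
move: E; rewrite !std_normal_cdfE => E.
have : gamma `]a, b]%classic \is a fin_num by rewrite fin_num_measure.
move: E; case: (gamma _) => // r; rewrite -EFinD => -[->] _; congr (_%:E); ring.
Qed.

Lemma std_normal_cdfB_ge (a b m : R) : a <= b ->
  (forall x, a < x <= b -> m <= gauss_kernel x) ->
  gauss_const * m * (b - a) <= Phi b - Phi a.
Proof.
move=> ab hm.
have [m0|m0] := leP m 0.
  apply: (@le_trans _ _ 0); last by rewrite -lee_fin -std_normal_cdfB.
  by rewrite mulr_le0_ge0 ?subr_ge0 // mulr_ge0_le0 // ltW // gauss_const_gt0.
rewrite -lee_fin -std_normal_cdfB // /normal_prob.
have -> : (gauss_const * m * (b - a))%:E =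
   (\int[mu]_(x in `]a, b]%classic) (gauss_const * m)%:E)%E.
  rewrite integral_cst //= lebesgue_measure_itv /= lte_fin.
  case: ltP => h; first by rewrite -EFinD -EFinM.
  by rewrite mule0 (_ : b = a) ?subrr ?mulr0 //; apply/le_anti; rewrite ab h.
apply: ge0_le_integral => //.
- by move=> x _; rewrite lee_fin mulr_ge0 // ltW // gauss_const_gt0.
- by apply/measurable_funTS/measurable_EFinP; exact: measurable_normal_pdf.
- move=> x /=; rewrite in_itv /= => /hm h.
  by rewrite lee_fin normal_pdf01E ler_pM2l // gauss_const_gt0.
Qed.

Lemma std_normal_cdfB_le (a b : R) : a <= b -> Phi b - Phi a <= b - a.
Proof.
move=> ab; rewrite -lee_fin -std_normal_cdfB // /normal_prob.
have -> : (b - a)%:E = (\int[mu]_(x in `]a, b]%classic) 1%:E)%E.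
  rewrite integral_cst //= mul1e lebesgue_measure_itv /= lte_fin.
  by case: ltP => // h; rewrite (_ : b = a) ?subrr //; apply/le_anti; rewrite ab h.
apply: ge0_le_integral => //.
- by move=> x _; rewrite lee_fin normal_pdf_ge0.
- by apply/measurable_funTS/measurable_EFinP; exact: measurable_normal_pdf.
- move=> x _; rewrite lee_fin normal_pdf01E.
  have := @gauss_const_gt0 R; have := @gauss_const_le1 R.
  have := gauss_kernel_gt0 x; have := gauss_kernel_le1 x; nra.
Qed.

Lemma std_normal_cdf_lt (a b : R) : a < b -> Phi a < Phi b.
Proof.
move=> ab; rewrite -subr_gt0.
have := @std_normal_cdfB_ge a b (expR (- ((`|a| + `|b|) ^+ 2 / 2))) (ltW ab).
have H : forall x, a < x <= b -> expR (- ((`|a| + `|b|) ^+ 2 / 2)) <= gauss_kernel x.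
  move=> x /andP[ax xb]; rewrite ler_expR lerN2 ler_pM2r ?invr_gt0 //.
  rewrite -[leLHS]real_normK ?num_real// ler_sqr ?nnegrE ?addr_ge0//.
  rewrite ler_norml; apply/andP; split.
    by have := ler_norm (- a); rewrite normrN; have := normr_ge0 b; lra.
  by have := ler_norm b; have := normr_ge0 a; lra.
move=> /(_ H); apply: lt_le_trans.
by rewrite !mulr_gt0 ?gauss_const_gt0 ?expR_gt0 // subr_gt0.
Qed.

Lemma std_normal_cdf_le (a b : R) : a <= b -> Phi a <= Phi b.
Proof. by rewrite le_eqVlt => /orP[/eqP -> //|/std_normal_cdf_lt/ltW]. Qed.

Lemma integral_gamma_indic (A : set (measurableTypeR R)) : measurable A ->
  (\int[gamma]_x (\1_A x)%:E = gamma A)%E.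
Proof. by move=> mA; rewrite integral_indic // setIT. Qed.

Lemma integral_gamma_cst1 : (\int[gamma]_z ((cst 1 : R -> R) z)%:E = 1)%E.
Proof.
transitivity (\int[gamma]_z (cst 1%E z))%E; first by [].
by rewrite integral_cst // mul1e; exact: probability_setT.
Qed.

Lemma std_normal_cdf_left_tail (x : R) : x <= 0 -> Phi x <= gauss_kernel x.
Proof.
move=> x0; rewrite -lee_fin -std_normal_cdfE -integral_gamma_indic //.
have -> : (gauss_kernel x)%:E = ((gauss_kernel x)%:E * \int[gamma]_z ((cst 1 : R -> R) z)%:E)%E.
  by rewrite integral_gamma_cst1 mule1.
apply: gamma_shift_le => //.
move=> y; rewrite indicE mem_setE in_itv /=.
case: (leP (y + x) x); last by rewrite ltxx.
by move=> h _; split => //; nra.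
Qed.

Lemma std_normal_cdf_right_tail (x : R) : 0 <= x -> 1 - Phi x <= gauss_kernel x.
Proof.
move=> x0.
have -> : 1 - Phi x = fine (gamma `]x, +oo[%classic).
  rewrite -setCitvl probability_setC //.
  by rewrite -[LHS]/(fine (1 - Phi x)%:E) EFinB -std_normal_cdfE.
rewrite -lee_fin fineK ?fin_num_measure // -integral_gamma_indic //.
have -> : (gauss_kernel x)%:E = ((gauss_kernel x)%:E * \int[gamma]_z ((cst 1 : R -> R) z)%:E)%E.
  by rewrite integral_gamma_cst1 mule1.
apply: gamma_shift_le => //.
move=> y; rewrite indicE mem_setE in_itv /= andbT.
case: (ltP x (y + x)); last by rewrite ltxx.
by move=> h _; split => //; nra.
Qed.

Lemma std_normal_cdf_ge0 x : 0 <= Phi x.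
Proof. by rewrite -lee_fin -std_normal_cdfE. Qed.

Lemma std_normal_cdf_le1 x : Phi x <= 1.
Proof. by rewrite -lee_fin -std_normal_cdfE probability_le1. Qed.

(** The left side is the variance of the indicator that a normal variable is at most [x]. Its decay
    at the rate of the density later cancels one of the two inverse densities brought in by the
    slope of the quantile function. *)
Lemma std_normal_cdf_variance x : Phi x * (1 - Phi x) <= gauss_kernel x.
Proof.
have := std_normal_cdf_ge0 x; have := std_normal_cdf_le1 x => h1 h0.
have [x0|x0] := leP x 0.
  by have := std_normal_cdf_left_tail x0; nra.
by have := std_normal_cdf_right_tail (ltW x0); nra.
Qed.

Lemma gauss_kernel_sqrt_ln (a : R) : 1 <= a ->
  gauss_kernel (Num.sqrt (2 * ln a)) = a^-1.
Proof.
move=> a1; rewrite /gauss_kernel sqr_sqrtr ?mulr_ge0 ?ln_ge0//.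
by rewrite mulrAC divff // mul1r expRN lnK // posrE; lra.
Qed.

Lemma std_normal_cdf_surj (u : R) : 0 < u < 1 -> exists x, Phi x = u.
Proof.
move=> /andP[u0 u1].
(* Chosen so that [a^-1] is below both [u] and [1 - u]: the points where the tail bounds equal
   [a^-1] then enclose a solution. *)
pose a := Num.max u^-1 (1 - u)^-1 + 1.
have ai : a^-1 < u /\ a^-1 < 1 - u /\ 1 <= a.
  have p1 : 0 < u^-1 by rewrite invr_gt0.
  have p2 : 0 < (1 - u)^-1 by rewrite invr_gt0; lra.
  have h1 : u^-1 < a by rewrite (@le_lt_trans _ _ (Num.max u^-1 (1 - u)^-1)) ?le_max ?lexx// /a; lra.
  have h2 : (1 - u)^-1 < a.
    by rewrite (@le_lt_trans _ _ (Num.max u^-1 (1 - u)^-1)) ?le_max ?lexx ?orbT// /a; lra.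
  have a0 : 0 < a by apply: lt_trans h1.
  split; [|split].
  - by rewrite -[u]invrK ltf_pV2 ?posrE.
  - by rewrite -[1 - u]invrK ltf_pV2 ?posrE.
  - by have := @invf_gt1 R u u0; rewrite u1; lra.
have [a1 [a2 a3]] := ai.
pose L := Num.sqrt (2 * ln a).
have L0 : 0 <= L by exact: sqrtr_ge0.
have e1 : Phi (- L) < u.
  have := @std_normal_cdf_left_tail (- L); rewrite oppr_le0 => /(_ L0).
  by rewrite /gauss_kernel sqrrN -/(gauss_kernel L) gauss_kernel_sqrt_ln //; lra.
have e2 : u < Phi L.
  by have := std_normal_cdf_right_tail L0; rewrite gauss_kernel_sqrt_ln //; lra.
have [] := @IVT R Phi (- L) L u; [lra| | |by move=> c _ <-; exists c].
- apply: continuous_subspaceT => x; apply/cvgrPdist_le => e e0; near=> y.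
  have : `|x - y| <= e by near: y; exact: cvgr_dist_le.
  case: (leP x y) => [xy|/ltW xy].
    have := std_normal_cdfB_le xy; have := std_normal_cdf_le xy.
    by move=> ? ?; rewrite !ler_norml => /andP[? ?]; apply/andP; split; lra.
  have := std_normal_cdfB_le xy; have := std_normal_cdf_le xy.
  by move=> ? ?; rewrite !ler_norml => /andP[? ?]; apply/andP; split; lra.
- by rewrite ge_min le_max (ltW e1) (ltW e2) /= ?orbT.
Unshelve. all: by end_near. Qed.

Lemma std_normal_quantileK (u : R) : 0 < u < 1 -> Phi (Q u) = u.
Proof.
move=> /std_normal_cdf_surj[x xu]; apply: (pinvK (fun=> 0)).
by apply/mem_set; exists x.
Qed.

Lemma std_normal_quantile_le (u v : R) : 0 < u -> u <= v -> v < 1 -> Q u <= Q v.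
Proof.
move=> u0 uv v1; rewrite leNgt; apply/negP => /std_normal_cdf_lt.
by rewrite !std_normal_quantileK; [rewrite ltNge uv|lra|lra].
Qed.

Lemma std_normal_quantile_bound (a u : R) : 1 <= a -> a^-1 <= u -> u <= 1 - a^-1 ->
  `|Q u| <= Num.sqrt (2 * ln a).
Proof.
move=> a1 au ua; set L := Num.sqrt _.
have L0 : 0 <= L by exact: sqrtr_ge0.
have a0 : 0 < a^-1 by rewrite invr_gt0; lra.
have u01 : 0 < u < 1 by lra.
rewrite ler_norml; apply/andP; split; rewrite leNgt; apply/negP => /std_normal_cdf_lt; rewrite std_normal_quantileK //.
  have := @std_normal_cdf_left_tail (- L); rewrite oppr_le0 => /(_ L0).
  by rewrite /gauss_kernel sqrrN -/(gauss_kernel L) gauss_kernel_sqrt_ln //; lra.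
by have := std_normal_cdf_right_tail L0; rewrite gauss_kernel_sqrt_ln //; lra.
Qed.

(* Within distance 1/L of x the density is comparable to its value at x. *)
Lemma std_normal_cdf_inverse_lipschitz (L x y : R) : 1 <= L -> `|x| <= L -> `|y| <= L ->
  gauss_const * expR (- 2) * gauss_kernel x * `|x - y| <= 2 * L ^+ 2 * `|Phi x - Phi y|.
Proof.
move=> L1 xL yL.
pose K := gauss_const * expR (- 2) * gauss_kernel x.
have K0 : 0 < K by rewrite !mulr_gt0 ?gauss_const_gt0 ?expR_gt0.
(* Within [1/L] of [x] the square grows by at most [2 |x| / L + 1 / L^2 <= 3], so the density keeps
   at least the fraction [exp(-2)] of its value at [x]. *)
have key z z' : z <= z' -> (z = x \/ z' = x) -> z' - z <= L^-1 ->
    K * (z' - z) <= Phi z' - Phi z.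
  move=> zz' zx zL; apply: (le_trans _ (@std_normal_cdfB_ge z z' (expR (- 2) * gauss_kernel x) zz' _)).
    by rewrite /K mulrA.
  move=> w /andP[zw wz']; rewrite -expRD ler_expR.
  have wx : `|w| <= `|x| + L^-1.
    have -> : w = x + (w - x) by ring.
    apply: (le_trans (ler_normD _ _)); rewrite lerD2l ler_norml.
    by case: zx => E; apply/andP; split; lra.
  have Li : L * L^-1 = 1 by rewrite divff //; lra.
  have Li1 : L^-1 <= 1 by rewrite invf_le1 //; lra.
  have Li0 : 0 < L^-1 by rewrite invr_gt0; lra.
  have : w ^+ 2 <= (`|x| + L^-1) ^+ 2.
    by rewrite -[leLHS]real_normK ?num_real// ler_sqr ?nnegrE ?addr_ge0// ltW.
  have -> : x ^+ 2 = `|x| ^+ 2 by rewrite real_normK ?num_real.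
  have := normr_ge0 x; nra.
have Li0 : 0 < L^-1 by rewrite invr_gt0; lra.
have LiL : L^-1 * L ^+ 2 = L by rewrite expr2 mulrA mulVf ?mul1r//; lra.
have main z z' : z < z' -> (z = x \/ z' = x) -> `|z| <= L -> `|z'| <= L ->
    K * (z' - z) <= 2 * L ^+ 2 * (Phi z' - Phi z).
  move=> zz' zx zL z'L.
  have d2 : z' - z <= 2 * L by move: zL z'L; rewrite !ler_norml => /andP[? ?] /andP[? ?]; lra.
  have L2 : 1 <= L ^+ 2 by rewrite expr_ge1 //; lra.
  have dP : 0 <= Phi z' - Phi z by rewrite subr_ge0 std_normal_cdf_le // ltW.
  have [h|h] := leP (z' - z) L^-1.
    by have := key _ _ (ltW zz') zx h; nra.
  (* For larger gaps monotonicity reduces to a subinterval of length [1/L] ending at [x]. The whole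
     gap is at most [2 L], that is [2 L^2] times longer. *)
  have : K * L^-1 <= Phi z' - Phi z.
    case: zx => E.
      have := key z (z + L^-1); rewrite addrAC subrr add0r; move=> /(_ _ _ _)/le_trans; apply; [lra|by left|lra|].
      by rewrite lerD2r std_normal_cdf_le //; lra.
    have := key (z' - L^-1) z'; rewrite subKr; move=> /(_ _ _ _)/le_trans; apply; [lra|by right|lra|].
    by rewrite lerD2l lerN2 std_normal_cdf_le //; lra.
  move=> h2; apply: (@le_trans _ _ (2 * L ^+ 2 * (K * L^-1))); last first.
    by rewrite ler_pM2l //; lra.
  have -> : 2 * L ^+ 2 * (K * L^-1) = K * (2 * L) by rewrite -[in RHS]LiL; ring.
  by rewrite ler_pM2l.
case: (ltgtP x y) => [xy|yx|->].
- rewrite distrC [X in _ <= _ * X]distrC !ger0_norm ?subr_ge0 ?(ltW xy) ?std_normal_cdf_le ?(ltW xy) //.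
  by apply: main => //; left.
- rewrite !ger0_norm ?subr_ge0 ?(ltW yx) ?std_normal_cdf_le ?(ltW yx) //.
  by apply: main => //; right.
- by rewrite !subrr normr0 !mulr0.
Qed.

End normal_cdf.

(** * Integration under independence *)

Section independence.
Context {d : measure_display} {T : measurableType d} {R : realType}.
Variable P : probability T R.

Lemma integral_law d1 (T1 : measurableType d1) (U : T -> T1)
    (m : {measure set T1 -> \bar R}) (f : T1 -> \bar R) :
  measurable_fun [set: T] U ->
  (forall A, measurable A -> P (U @^-1` A) = m A) ->
  measurable_fun [set: T1] f -> (forall x, 0 <= f x)%E ->
  (\int[P]_w f (U w) = \int[m]_x f x)%E.
Proof.
move=> mU Um mf f0.
transitivity (\int[pushforward P U]_x f x)%E.
  by rewrite ge0_integral_pushforward.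
apply: (eq_measure_integral m).
by move=> A mA _; rewrite -[LHS]/(P (U @^-1` A)) Um.
Qed.

Section freezing.
Context {d1 d2 : measure_display} {T1 : measurableType d1} {T2 : measurableType d2}.
Variables (U : T -> T1) (V : T -> T2).
Hypotheses (mU : measurable_fun [set: T] U) (mV : measurable_fun [set: T] V).

Definition independent_pair :=
  forall A B, measurable A -> measurable B ->
  P (U @^-1` A `&` V @^-1` B) = (P (U @^-1` A) * P (V @^-1` B))%E.

Lemma integral_independent (f : T1 * T2 -> \bar R) : independent_pair ->
  measurable_fun [set: T1 * T2] f -> (forall x, 0 <= f x)%E ->
  (\int[P]_w f (U w, V w) = \int[P]_w \int[P]_w' f (U w, V w'))%E.
Proof.
move=> ind mf f0.
pose U' : {mfun T >-> T1} := HB.pack U (isMeasurableFun.Build _ _ _ _ _ mU).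
pose V' : {mfun T >-> T2} := HB.pack V (isMeasurableFun.Build _ _ _ _ _ mV).
pose m1 : probability T1 R := distribution P U'.
pose m2 : probability T2 R := distribution P V'.
have mUV : measurable_fun [set: T] (fun w => (U w, V w)) by exact: measurable_fun_pair.
transitivity (\int[(m1 \x m2)%E]_x f x)%E.
  apply: (integral_law mUV) => // A mA.
  pose m'0 : {measure set (T1 * T2) -> \bar R} := pushforward P (fun w => (U w, V w)).
  pose m' := m'0 mUV.
  have := @product_measure_unique _ _ _ _ _ m1 m2 m'.
  by move=> H; apply/esym; apply: H => // A1 A2 mA1 mA2; exact: ind.
rewrite fubini_tonelli1 //.
have mF := measurable_fun_fubini_tonelli_F (m2 := m2) f mf.
rewrite -(@integral_law _ _ U m1 (fun x => \int[m2]_y f (x, y))%E) //; last 2 first.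
- exact: mF.
- by move=> x; exact: integral_ge0.
apply: eq_integral => w _.
rewrite -(@integral_law _ _ V m2 (fun y => f (U w, y))) //.
exact: measurableT_comp.
Qed.

End freezing.

(** For fixed [A], both sides of the product rule are finite measures in the second argument, and
    they agree on the rectangles, which are stable under intersection and generate the product
    sigma-algebra. *)
Lemma independent_pair_triple d1 d2 d3 (T1 : measurableType d1)
    (T2 : measurableType d2) (T3 : measurableType d3)
    (U : T -> T1) (V : T -> T2) (Z : T -> T3) :
  measurable_fun [set: T] U -> measurable_fun [set: T] V -> measurable_fun [set: T] Z ->
  (forall A B C, measurable A -> measurable B -> measurable C ->
    P (U @^-1` A `&` (V @^-1` B `&` Z @^-1` C)) =
    (P (U @^-1` A) * P (V @^-1` B `&` Z @^-1` C))%E) ->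
  independent_pair U (fun w => (V w, Z w)).
Proof.
move=> mU mV mZ ind A D mA mD.
have mVZ : measurable_fun [set: T] (fun w => (V w, Z w)) by exact: measurable_fun_pair.
have mUA : measurable (U @^-1` A) by rewrite -[X in measurable X]setTI; exact: mU.
pose m1' : {measure set (T2 * T3) -> \bar R} :=
  pushforward (mrestr P mUA) (fun w => (V w, Z w)).
pose m1 := m1' mVZ.
have fA : P (U @^-1` A) \is a fin_num by rewrite fin_num_measure.
have pA : 0 <= fine (P (U @^-1` A)) by exact: fine_ge0.
pose m2' : {measure set (T2 * T3) -> \bar R} :=
  mscale (NngNum pA) (pushforward P (fun w => (V w, Z w))).
pose m2 := m2' mVZ.
have E1 B : m1 B = P ((fun w => (V w, Z w)) @^-1` B `&` U @^-1` A) by [].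
have E2 B : m2 B = (P (U @^-1` A) * P ((fun w => (V w, Z w)) @^-1` B))%E.
  by rewrite -[P (U @^-1` A)]fineK.
rewrite setIC -E1 -E2.
apply: (measure_unique [set C | exists A, measurable A /\ exists B, measurable B /\ C = A `*` B] (fun=> setT)) => //.
- rewrite measurable_prod_measurableType //; congr (<<s _ >>).
  rewrite predeqE; split => [[X mX [B mB <-]]|[X [mX [B [mB ->]]]]].
    by exists X; split => //; exists B.
  by exists X => //; exists B.
- move=> /= _ _ [X1 [mX1 [X2 [mX2 ->]]]] [Y1 [mY1 [Y2 [mY2 ->]]]].
  rewrite -setXI; exists (X1 `&` Y1); split; first exact: measurableI.
  by exists (X2 `&` Y2); split => //; exact: measurableI.
- by move=> _; exists setT; split => //; exists setT; rewrite setXTT.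
- by rewrite bigcup_const.
- move=> _ [X [mX [B [mB ->]]]]; rewrite E1 E2 setIC.
  have -> : (fun w => (V w, Z w)) @^-1` (X `*` B) = V @^-1` X `&` Z @^-1` B by [].
  exact: ind.
- by move=> _; rewrite E1; apply: (le_lt_trans (probability_le1 _ _)); rewrite ?ltry //;
    apply: measurableI => //; rewrite preimage_setT.
Qed.

End independence.

(** * Ranks in an i.i.d. normal sample *)

Section sample_ranks.
Context {d : measure_display} {T : measurableType d} {R : realType}.
Variable P : probability T R.
Local Notation mu := (@lebesgue_measure R).
Local Notation gamma := (@normal_prob R 0 1).
Local Notation Phi := (@std_normal_cdf R).
Local Notation Q := (@std_normal_quantile R).

Lemma measurable_std_normal_cdf : measurable_fun [set: R] Phi.
Proof. by apply: nondecreasing_measurable => // x y; exact: std_normal_cdf_le. Qed.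

Lemma measurable_le_indicator d' (T' : measurableType d') (f g : T' -> R) :
  measurable_fun [set: T'] f -> measurable_fun [set: T'] g ->
  measurable_fun [set: T'] (fun x => (f x <= g x)%R%:R : R).
Proof.
move=> mf mg; apply: (@measurableT_comp _ _ _ _ _ _ (fun b : bool => b%:R : R)) => //.
exact: measurable_fun_ler.
Qed.

Definition iid_normal_sample n (xi : 'I_n -> T -> R) :=
  (forall i, measurable_fun [set: T] (xi i)) /\
  (forall A : 'I_n -> set (measurableTypeR R), (forall i, measurable (A i)) ->
    P (\bigcap_(i in [set: 'I_n]) (xi i @^-1` A i)) = (\prod_i gamma (A i))%E).

Section sample.
Variables (n : nat) (xi : 'I_n -> T -> R).
Hypothesis iid : iid_normal_sample xi.

Let mxi i : measurable_fun [set: T] (xi i). Proof. exact: iid.1. Qed.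

Lemma iid_law i A : measurable A -> P (xi i @^-1` A) = gamma A.
Proof.
move=> mA; pose B j : set (measurableTypeR R) := if j == i then A else setT.
have mB j : measurable (B j) by rewrite /B; case: ifP.
have := iid.2 B mB; rewrite (bigD1 i) //= /B eqxx big1 ?mule1; last first.
  by move=> j /negbTE ->; exact: probability_setT.
move=> <-; congr (P _); apply/seteqP; split => w.
  by move=> Aw j _; case: ifP => // /eqP ->.
by move=> /(_ i I); rewrite /= eqxx.
Qed.

Lemma iid_law_triple i j k A B C : i != j -> i != k -> j != k ->
  measurable A -> measurable B -> measurable C ->
  P (xi i @^-1` A `&` (xi j @^-1` B `&` xi k @^-1` C)) = (gamma A * (gamma B * gamma C))%E.
Proof.
move=> ij ik jk mA mB mC.
pose D l : set (measurableTypeR R) := if l == i then A else if l == j then B else if l == k then C else setT.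
have mD l : measurable (D l) by rewrite /D; do 3 (case: ifP => // _).
have := iid.2 D mD; rewrite (bigD1 i) //= (bigD1 j) /=; last by rewrite eq_sym ij.
rewrite (bigD1 k) /=; last by rewrite eq_sym ik eq_sym jk.
rewrite big1 ?mule1; last first.
  by move=> l /andP[/andP[/negbTE h1 /negbTE h2] /negbTE h3]; rewrite /D h1 h2 h3; exact: probability_setT.
rewrite /D !eqxx ![_ == i]eq_sym (negbTE ij) (negbTE ik) [k == j]eq_sym (negbTE jk) => <-.
congr (P _); apply/seteqP; split => w /=.
  by move=> [Aw [Bw Cw]] l _; rewrite /D; case: eqVneq => [->//|_]; case: eqVneq => [->//|_]; case: eqVneq => [->//|].
move=> H; have := H i I; have := H j I; have := H k I; rewrite /D !eqxx.
by rewrite ![_ == i]eq_sym (negbTE ij) (negbTE ik) [k == j]eq_sym (negbTE jk).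
Qed.

Lemma iid_law_pair i j A B : i != j -> measurable A -> measurable B ->
  P (xi i @^-1` A `&` xi j @^-1` B) = (gamma A * gamma B)%E.
Proof.
move=> ij mA mB.
pose D l : set (measurableTypeR R) := if l == i then A else if l == j then B else setT.
have mD l : measurable (D l) by rewrite /D; do 2 (case: ifP => // _).
have := iid.2 D mD; rewrite (bigD1 i) //= (bigD1 j) /=; last by rewrite eq_sym ij.
rewrite big1 ?mule1; last first.
  by move=> l /andP[/negbTE h1 /negbTE h2]; rewrite /D h1 h2; exact: probability_setT.
rewrite /D !eqxx ![_ == i]eq_sym (negbTE ij) => <-.
congr (P _); apply/seteqP; split => w /=.
  by move=> [Aw Bw] l _; rewrite /D; case: eqVneq => [->//|_]; case: eqVneq => [->//|_].
by move=> H; have := H i I; have := H j I; rewrite /D !eqxx ![_ == i]eq_sym (negbTE ij).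
Qed.

Lemma iid_independent_pair i j : i != j -> independent_pair P (xi i) (xi j).
Proof. by move=> ij A B mA mB; rewrite iid_law_pair // !iid_law. Qed.

Lemma iid_independent_triple i j k : i != j -> i != k -> j != k ->
  independent_pair P (xi i) (fun w => (xi j w, xi k w)).
Proof.
move=> ij ik jk; apply: independent_pair_triple => // A B C mA mB mC.
by rewrite iid_law_triple // iid_law // iid_law_pair.
Qed.

Lemma iid_le i x : P [set w | xi i w <= x] = (Phi x)%:E.
Proof.
by rewrite -std_normal_cdfE -(iid_law i).
Qed.

Lemma iid_integral i (f : R -> \bar R) : measurable_fun [set: R] f ->
  (forall x, 0 <= f x)%E -> (\int[P]_w f (xi i w) = \int[gamma]_x f x)%E.
Proof.
move=> mf f0.
exact: (@integral_law _ _ _ P _ (measurableTypeR R) (xi i) gamma f (mxi i) (@iid_law i) mf f0).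
Qed.

Lemma measurable_iid_le i x : measurable [set w | xi i w <= x].
Proof.
rewrite -[X in measurable X]setTI.
exact: (mxi i measurableT (measurable_itv `]-oo, x])).
Qed.

Lemma integral_le1 (g : R -> R) i j : i != j ->
  measurable_fun [set: R] g -> (forall x, 0 <= g x) ->
  (\int[P]_w (g (xi i w) * (xi j w <= xi i w)%R%:R)%:E = \int[gamma]_x (g x * Phi x)%:E)%E.
Proof.
move=> ij mg g0.
pose f (z : R * R) : \bar R := (g z.1 * (z.2 <= z.1)%R%:R)%:E.
have mf : measurable_fun [set: R * R] f.
  apply/measurable_EFinP; apply: measurable_funM; first exact: measurableT_comp.
  exact: measurable_le_indicator.
have := @integral_independent _ _ _ P _ _ _ _ _ _ (mxi i) (mxi j) f (iid_independent_pair ij) mf.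
rewrite /f /= => ->; last by move=> x; rewrite lee_fin mulr_ge0.
rewrite -(iid_integral i) //; last 2 first.
- apply/measurable_EFinP; apply: measurable_funM => //; exact: measurable_std_normal_cdf.
- by move=> x; rewrite lee_fin mulr_ge0 ?std_normal_cdf_ge0.
apply: eq_integral => w _.
under eq_integral do rewrite EFinM.
rewrite ge0_integralZl_EFin //; last first.
  apply/measurable_EFinP; apply: measurable_le_indicator => //.
rewrite EFinM -(iid_le j); congr (_ * _)%E.
have mE := measurable_iid_le j (xi i w).
rewrite -[X in _ = P X]setIT -[in RHS]integral_indic //.
apply: eq_integral => w' _; rewrite indicE; congr (_%:R%:E); congr nat_of_bool.
by apply/idP/idP => [h|/set_mem //]; exact/mem_set.
Qed.

Lemma integral_le2 (g : R -> R) i j k : i != j -> i != k -> j != k ->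
  measurable_fun [set: R] g -> (forall x, 0 <= g x) ->
  (\int[P]_w (g (xi i w) * ((xi j w <= xi i w)%R%:R * (xi k w <= xi i w)%R%:R))%:E
     = \int[gamma]_x (g x * Phi x ^+ 2)%:E)%E.
Proof.
move=> ij ik jk mg g0.
pose f (z : R * (R * R)) : \bar R := (g z.1 * ((z.2.1 <= z.1)%R%:R * (z.2.2 <= z.1)%R%:R))%:E.
have m1 : measurable_fun [set: R * (R * R)] (fun z : R * (R * R) => z.2.1).
  exact: (measurableT_comp measurable_fst measurable_snd).
have m2 : measurable_fun [set: R * (R * R)] (fun z : R * (R * R) => z.2.2).
  exact: (measurableT_comp measurable_snd measurable_snd).
have mf : measurable_fun [set: R * (R * R)] f.
  apply/measurable_EFinP; apply: measurable_funM; first exact: measurableT_comp.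
  by apply: measurable_funM; exact: measurable_le_indicator.
have mjk : measurable_fun [set: T] (fun w => (xi j w, xi k w)) by exact: measurable_fun_pair.
have := @integral_independent _ _ _ P _ _ _ _ _ _ (mxi i) mjk f (iid_independent_triple ij ik jk) mf.
rewrite /f /= => ->; last by move=> x; rewrite lee_fin !mulr_ge0.
rewrite -(iid_integral i) //; last 2 first.
- apply/measurable_EFinP; apply: measurable_funM => //; apply: measurable_funX.
  exact: measurable_std_normal_cdf.
- by move=> x; rewrite lee_fin mulr_ge0 ?sqr_ge0.
apply: eq_integral => w _.
under eq_integral do rewrite EFinM.
rewrite ge0_integralZl_EFin //; last first.
  apply/measurable_EFinP; apply: measurable_funM; exact: measurable_le_indicator.
rewrite EFinM; congr (_ * _)%E.
have mE l := measurable_iid_le l (xi i w).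
have <- : P ([set w' | xi j w' <= xi i w] `&` [set w' | xi k w' <= xi i w]) = (Phi (xi i w) ^+ 2)%:E.
  rewrite expr2 EFinM -!std_normal_cdfE -(iid_law_pair jk) //.
rewrite -[X in _ = P X]setIT -[in RHS]integral_indic //; last exact: measurableI.
apply: eq_integral => w' _; rewrite indicI /= !indicE; congr ((_%:R * _%:R)%:E); congr nat_of_bool; by apply/idP/idP => [h|/set_mem //]; exact/mem_set.
Qed.

Lemma measurable_sum_cond (I : finType) (p : pred I) (f : I -> T -> R) :
  (forall k, measurable_fun [set: T] (f k)) ->
  measurable_fun [set: T] (fun w => \sum_(k | p k) f k w).
Proof. by move=> mf; under eq_fun do rewrite -big_filter; exact: measurable_sum. Qed.

Lemma integral_sum_cond (I : finType) (p : pred I) (f : I -> T -> R) :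
  (forall k, measurable_fun [set: T] (f k)) -> (forall k w, 0 <= f k w) ->
  (\int[P]_w (\sum_(k | p k) f k w)%:E = \sum_(k | p k) \int[P]_w (f k w)%:E)%E.
Proof.
move=> mf f0; under eq_integral do rewrite -sumEFin -big_filter.
rewrite ge0_integral_sum //; first by rewrite big_filter.
- by move=> k; exact/measurable_EFinP.
- by move=> k w _; rewrite lee_fin.
Qed.

Lemma bounded_integral_gamma (g : R -> R) (B : R) : measurable_fun [set: R] g ->
  (forall x, 0 <= g x <= B) -> exists2 a : R, 0 <= a & (\int[gamma]_x (g x)%:E = a%:E)%E.
Proof.
move=> mg gB.
have g0 : (0 <= \int[gamma]_x (g x)%:E)%E.
  by apply: integral_ge0 => x _; rewrite lee_fin; case/andP: (gB x).
have gfin : (\int[gamma]_x (g x)%:E \is a fin_num)%E.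
  rewrite ge0_fin_numE //; apply: (@le_lt_trans _ _ (\int[gamma]_x (cst B%:E x))%E).
    apply: ge0_le_integral => //.
    - by move=> x _; rewrite lee_fin; case/andP: (gB x).
    - exact/measurable_EFinP.
    - by move=> x _; rewrite lee_fin; case/andP: (gB x).
  rewrite integral_cst //= (_ : gamma setT = 1%E) ?mule1 ?ltry //.
  exact: probability_setT.
by exists (fine (\int[gamma]_x (g x)%:E)); [exact: fine_ge0|rewrite fineK].
Qed.

Let below i w : R := \sum_(j | j != i) (xi j w <= xi i w)%R%:R.

Lemma rank_below i w : (rank (fun j => xi j w) i)%:R = 1 + below i w.
Proof.
rewrite /rank (bigD1 i) //= lexx natrD; congr (_ + _).
by rewrite natr_sum.
Qed.

(** Given [xi i], the number of other points below it is binomial with parameters [n - 1] and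
    [Phi (xi i)]; the right side integrates its variance against the weight [h]. Boundedness of [h]
    makes every integral finite, so that terms can be cancelled. *)
Lemma integral_rank_noise (h : R -> R) (B : R) i : measurable_fun [set: R] h ->
  (forall x, 0 <= h x <= B) ->
  (\int[P]_w (h (xi i w) * (below i w - n.-1%:R * Phi (xi i w)) ^+ 2)%:E =
   n.-1%:R%:E * \int[gamma]_x (h x * (Phi x * (1 - Phi x)))%:E)%E.
Proof.
move=> mh hB.
have h0 x : 0 <= h x by case/andP: (hB x).
have hB' x : h x <= B by case/andP: (hB x).
have p0 x : 0 <= Phi x by exact: std_normal_cdf_ge0.
have p1 x : Phi x <= 1 by exact: std_normal_cdf_le1.
have mPhi := measurable_std_normal_cdf.
have mhP : measurable_fun [set: R] (fun x => h x * Phi x) by exact: measurable_funM.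
have mhP2 : measurable_fun [set: R] (fun x => h x * Phi x ^+ 2).
  by apply: measurable_funM => //; exact: measurable_funX.
have mhP0 : measurable_fun [set: R] (fun x => h x * (Phi x * (1 - Phi x))).
  by apply: measurable_funM => //; apply: measurable_funM => //; exact: measurable_funB.
have [a2 a20 E2] : exists2 a : R, 0 <= a & (\int[gamma]_x (h x * Phi x ^+ 2)%:E = a%:E)%E.
  apply: (@bounded_integral_gamma _ B) => // x; apply/andP; split; first by rewrite mulr_ge0 ?sqr_ge0.
  apply: le_trans (hB' x); rewrite ler_piMr // expr_le1 //.
have [a0 a00 E0] : exists2 a : R, 0 <= a & (\int[gamma]_x (h x * (Phi x * (1 - Phi x)))%:E = a%:E)%E.
  apply: (@bounded_integral_gamma _ B) => // x; apply/andP; split.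
    by rewrite !mulr_ge0 // subr_ge0.
  apply: le_trans (hB' x); rewrite ler_piMr // mulr_ile1 // ?subr_ge0 // lerBlDr lerDl //.
have E1 : (\int[gamma]_x (h x * Phi x)%:E = (a0 + a2)%:E)%E.
  rewrite EFinD -E0 -E2 -ge0_integralD //.
  - by apply: eq_integral => x _; rewrite -EFinD; congr (_%:E); ring.
  - by move=> x _; rewrite lee_fin !mulr_ge0 // subr_ge0.
  - exact/measurable_EFinP.
  - by move=> x _; rewrite lee_fin mulr_ge0 // sqr_ge0.
  - exact/measurable_EFinP.
rewrite E0.
have mi j : measurable_fun [set: T] (fun w => (xi j w <= xi i w)%R%:R : R).
  exact: measurable_le_indicator.
have mb : measurable_fun [set: T] (below i).
  exact: measurable_sum_cond.
have b0 w : 0 <= below i w by exact: sumr_ge0.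
have mhi : measurable_fun [set: T] (fun w => h (xi i w)) by exact: measurableT_comp.
have mPi : measurable_fun [set: T] (fun w => Phi (xi i w)) by exact: measurableT_comp.
set m : R := n.-1%:R.
have cardm : #|[pred j | j != i]| = n.-1.
  by rewrite cardC1 card_ord.
pose I0 w := h (xi i w) * (below i w - m * Phi (xi i w)) ^+ 2.
pose I1 w := 2 * m * (\sum_(j | j != i) h (xi i w) * Phi (xi i w) * (xi j w <= xi i w)%R%:R).
pose I2 w := \sum_(j | j != i) \sum_(k | k != i) h (xi i w) * ((xi j w <= xi i w)%R%:R * (xi k w <= xi i w)%R%:R).
pose I3 w := m ^+ 2 * (h (xi i w) * Phi (xi i w) ^+ 2).
(* The square is expanded with the negative cross term moved to the left, so that all four
   integrands are nonnegative and integrate in the extended reals. *)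
have IE w : I0 w + I1 w = I2 w + I3 w.
  have -> : I1 w = 2 * m * (h (xi i w) * Phi (xi i w) * below i w).
    by rewrite /I1 -mulr_sumr.
  have -> : I2 w = h (xi i w) * (below i w * below i w).
    rewrite /I2 mulr_suml mulr_sumr; by apply: eq_bigr => j _; rewrite !mulr_sumr.
  rewrite /I0 /I3; ring.
have m0 : 0 <= m by [].
have I00 w : 0 <= I0 w by rewrite mulr_ge0 // sqr_ge0.
have I10 w : 0 <= I1 w by rewrite !mulr_ge0 // sumr_ge0 // => j _; rewrite !mulr_ge0.
have I20 w : 0 <= I2 w by do 2 (apply: sumr_ge0 => ? _); rewrite !mulr_ge0.
have I30 w : 0 <= I3 w by rewrite !mulr_ge0 ?sqr_ge0.
have mI0 : measurable_fun [set: T] I0.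
  by apply: measurable_funM => //; apply: measurable_funX; apply: measurable_funB => //; exact: measurable_funM.
have mI1' j : measurable_fun [set: T] (fun w => h (xi i w) * Phi (xi i w) * (xi j w <= xi i w)%R%:R).
  by apply: measurable_funM => //; exact: measurable_funM.
have mI1 : measurable_fun [set: T] I1.
  apply: measurable_funM => //; exact: measurable_sum_cond.
have mI2' j k : measurable_fun [set: T] (fun w => h (xi i w) * ((xi j w <= xi i w)%R%:R * (xi k w <= xi i w)%R%:R)).
  by apply: measurable_funM => //; exact: measurable_funM.
have mI2 : measurable_fun [set: T] I2.
  by apply: measurable_sum_cond => j; exact: measurable_sum_cond.
have mI3 : measurable_fun [set: T] I3.
  by apply: measurable_funM => //; apply: measurable_funM => //; exact: measurable_funX.
have sumc (c : R) : (\sum_(j | j != i) c%:E = (m * c)%:E)%E.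
  by rewrite sumEFin sumr_const cardm /m mulr_natl.
have J1 : (\int[P]_w (I1 w)%:E = (2 * m * (m * a2))%:E)%E.
  under eq_integral do rewrite EFinM.
  rewrite ge0_integralZl_EFin //; last 3 first.
  - by move=> w _; rewrite lee_fin sumr_ge0 // => j _; rewrite !mulr_ge0.
  - by apply/measurable_EFinP; exact: measurable_sum_cond.
  - by rewrite mulr_ge0.
  rewrite integral_sum_cond //; last by move=> j w; rewrite !mulr_ge0.
  rewrite (eq_bigr (fun=> a2%:E)); last first.
    move=> j ji; rewrite (@integral_le1 (fun x => h x * Phi x) i j) //; last 2 first.
    - by rewrite eq_sym.
    - by move=> x; rewrite mulr_ge0.
    by rewrite -E2; apply: eq_integral => x _; rewrite -mulrA.
  by rewrite sumc -EFinM.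
have J2 : (\int[P]_w (I2 w)%:E = (m * (a0 + a2 + (m - 1) * a2))%:E)%E.
  rewrite integral_sum_cond //; last 2 first.
  - by move=> j; exact: measurable_sum_cond.
  - by move=> j w; apply: sumr_ge0 => ? _; rewrite !mulr_ge0.
  rewrite (eq_bigr (fun=> (a0 + a2 + (m - 1) * a2)%:E)); last first.
    move=> j ji; rewrite integral_sum_cond //; last by move=> k w; rewrite !mulr_ge0.
    (* The diagonal [k = j] is a squared indicator and gives the first moment [a0 + a2]; each of the
       other [n - 2] indices gives [a2]. *)
    rewrite (bigD1 j) //= EFinD; congr (_ + _)%E.
      rewrite -E1 -(@integral_le1 h i j) //; last by rewrite eq_sym.
      by apply: eq_integral => w _; rewrite -natrM mulnb andbb.
    rewrite (eq_bigr (fun=> a2%:E)); last first.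
      by move=> k /andP[ki kj]; rewrite (@integral_le2 h i j k) // eq_sym.
    rewrite sumEFin sumr_const; congr (_%:E).
    have -> : #|[pred k | (k != i) && (k != j)]| = n.-1.-1.
      have := cardD1 j [pred j0 | j0 != i]; rewrite cardm inE /= ji /= add1n => -> /=.
      by apply: eq_card => k; rewrite !inE andbC.
    have n1 : (0 < n.-1)%N by rewrite -cardm; apply/card_gt0P; exists j.
    by rewrite /m -{2}(prednK n1) -natr1 addrK mulr_natl.
  by rewrite sumc.
have J3 : (\int[P]_w (I3 w)%:E = (m ^+ 2 * a2)%:E)%E.
  under eq_integral do rewrite EFinM.
  rewrite ge0_integralZl_EFin //; last 3 first.
  - by move=> w _; rewrite lee_fin mulr_ge0 // sqr_ge0.
  - by apply/measurable_EFinP; apply: measurable_funM => //; exact: measurable_funX.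
  - exact: sqr_ge0.
  rewrite (@iid_integral i (fun x => (h x * Phi x ^+ 2)%:E)) ?E2 //; first exact/measurable_EFinP.
  by move=> x; rewrite lee_fin mulr_ge0 // sqr_ge0.
have : (\int[P]_w (I0 w)%:E + \int[P]_w (I1 w)%:E = \int[P]_w (I2 w)%:E + \int[P]_w (I3 w)%:E)%E.
  rewrite -!ge0_integralD //; try exact/measurable_EFinP; try by move=> w _; rewrite lee_fin.
  by apply: eq_integral => w _; rewrite -!EFinD IE.
rewrite J1 J2 J3 -EFinD => E.
have If : (\int[P]_w (I0 w)%:E \is a fin_num)%E.
  rewrite ge0_fin_numE; last by apply: integral_ge0 => w _; rewrite lee_fin.
  apply: (@le_lt_trans _ _ (\int[P]_w (I0 w)%:E + (2 * m * (m * a2))%:E)%E); last by rewrite E ltry.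
  by rewrite leeDl // lee_fin !mulr_ge0.
move: E If; rewrite -/(I0 _); case: (\int[P]_w (I0 w)%:E)%E => [r| |] //= [E] _.
by rewrite -EFinM; congr (_%:E); move: E; lra.
Qed.

End sample.
End sample_ranks.

(** * Pointwise error of the normal scores *)

Section score_error.
Context {R : realType}.
Local Notation mu := (@lebesgue_measure R).
Local Notation gamma := (@normal_prob R 0 1).
Local Notation Phi := (@std_normal_cdf R).
Local Notation Q := (@std_normal_quantile R).

(** Since [x^2 exp(-x^2/4) <= 4], the integrand is dominated by a multiple of the normal density
    with standard deviation [sqrt 2], whose total mass is known. *)
Lemma normal_second_moment :
  exists2 m2 : R, 0 <= m2 & (\int[gamma]_x (x ^+ 2 : R)%:E <= m2%:E)%E.
Proof.
pose s : R := Num.sqrt 2.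
have s2 : s ^+ 2 = 2 by rewrite sqr_sqrtr.
have s0 : s != 0 by rewrite gt_eqF // sqrtr_gt0.
have pk : 0 < normal_peak s by exact: normal_peak_gt0.
exists (4 / normal_peak s); first by rewrite divr_ge0 // ltW.
rewrite integral_normal_prob //; last 2 first.
- by apply/measurable_EFinP; exact: measurable_funX.
- by move=> x; rewrite lee_fin sqr_ge0.
have -> : (4 / normal_peak s)%:E = (\int[mu]_x ((4 / normal_peak s)%:E * (normal_pdf 0 s x)%:E))%E.
  rewrite ge0_integralZl_EFin ?integral_normal_pdf ?mule1 //.
  - by move=> x _; rewrite lee_fin normal_pdf_ge0.
  - by apply/measurable_EFinP; exact: measurable_normal_pdf.
  - by rewrite divr_ge0 // ltW.
apply: ge0_le_integral => //.
- by move=> x _; rewrite -EFinM lee_fin mulr_ge0 ?sqr_ge0 ?normal_pdf_ge0.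
- under eq_fun do rewrite -EFinM; apply/measurable_EFinP; apply: measurable_funM.
    exact: measurable_funX.
  exact: measurable_normal_pdf.
- under eq_fun do rewrite -EFinM; apply/measurable_EFinP; apply: measurable_funM => //.
  exact: measurable_normal_pdf.
move=> x _; rewrite -!EFinM lee_fin normal_pdf01E normal_pdfE // /normal_fun subr0 s2.
have -> (z : R) : 4 / normal_peak s * (normal_peak s * z) = 4 * z by field; rewrite gt_eqF.
have -> : - x ^+ 2 / (2 *+ 2) = - (x ^+ 2 / 4) by rewrite mulNr; congr (- (_ / _)); ring.
rewrite /gauss_kernel.
have -> : - (x ^+ 2 / 2) = - (x ^+ 2 / 4) + - (x ^+ 2 / 4) by field.
rewrite expRD.
have E : x ^+ 2 * expR (- (x ^+ 2 / 4)) <= 4.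
  rewrite expRN ler_pdivrMr ?expR_gt0//.
  by have := expR_ge1Dx (x ^+ 2 / 4); lra.
have e0 := expR_gt0 (- (x ^+ 2 / 4)).
have := @gauss_const_gt0 R; have := @gauss_const_le1 R.
set e := expR _ in E e0 *; set c := gauss_const => c1 c0.
have -> : x ^+ 2 * (c * (e * e)) = (x ^+ 2 * e) * (c * e) by ring.
apply: ler_pM => //.
- by rewrite mulr_ge0 ?sqr_ge0 // ltW.
- by rewrite mulr_ge0 // ltW.
- by rewrite ler_piMl // ltW.
Qed.

Lemma measurable_excess (M : R) : measurable_fun [set: R] (excess M).
Proof.
by apply: measurable_maxr => //; apply: measurable_funB => //; exact: measurableT_comp.
Qed.

Lemma integral_excess (M : R) : 0 <= M ->
  (\int[gamma]_x (excess M x ^+ 2)%:E <=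
   (2 * gauss_kernel M)%:E * \int[gamma]_x (x ^+ 2 : R)%:E)%E.
Proof.
move=> M0; apply: gamma_tail_le => //.
- by apply: measurable_funX; exact: measurable_excess.
- by move=> x; exact: sqr_ge0.
- by move=> x; exact: sqr_ge0.
- by move=> x xM; rewrite /excess max_r ?expr0n// subr_le0.
move=> y y0; rewrite /excess; split.
  by rewrite ger0_norm ?addr_ge0 // addrK max_l.
by rewrite -opprD normrN ger0_norm ?addr_ge0 // addrK max_l // sqrrN.
Qed.

(** Up to a constant, the slope of the quantile function at [Phi x], cut off where [|x|] exceeds
    [l]. Against the normal density it integrates to at most the length [2 l]. *)
Definition inner_weight (l x : R) : R := (gauss_kernel x)^-1 * (`|x| <= l)%R%:R.

Lemma inner_weight_ge0 l x : 0 <= inner_weight l x.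
Proof. by rewrite mulr_ge0 // invr_ge0 ltW // gauss_kernel_gt0. Qed.

Lemma inner_weight_le l x : 0 <= l -> inner_weight l x <= (gauss_kernel l)^-1.
Proof.
move=> l0; rewrite /inner_weight; case: (leP `|x| l) => h; rewrite ?mulr1 ?mulr0.
  rewrite lef_pV2 ?posrE ?gauss_kernel_gt0 // ler_expR lerN2 ler_pM2r //.
  by rewrite -[leLHS]real_normK ?num_real // ler_sqr ?nnegrE.
by rewrite invr_ge0 ltW // gauss_kernel_gt0.
Qed.

Lemma measurable_inner_weight l : measurable_fun [set: R] (inner_weight l).
Proof.
apply: measurable_funM.
  under eq_fun do rewrite /gauss_kernel expRN invrK.
  apply: measurableT_comp => //; apply: measurable_funM => //; exact: measurable_funX.
by apply: measurable_le_indicator => //; exact: measurableT_comp.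
Qed.

Lemma integral_inner_weight l : 0 <= l ->
  (\int[gamma]_x (inner_weight l x)%:E <= (2 * l)%:E)%E.
Proof.
move=> l0; rewrite integral_normal_prob //; last 2 first.
- by apply/measurable_EFinP; exact: measurable_inner_weight.
- by move=> x; rewrite lee_fin inner_weight_ge0.
have -> : (2 * l)%:E = (\int[mu]_x (\1_(`[- l, l]%classic : set R) x)%:E)%E.
  rewrite integral_indic //= setIT lebesgue_measure_itv /= lte_fin.
  case: ltP => h; first by rewrite -EFinD; congr (_%:E); ring.
  by congr (_%:E); lra.
apply: ge0_le_integral => //.
- by move=> x _; rewrite -EFinM lee_fin mulr_ge0 ?inner_weight_ge0 ?normal_pdf_ge0.
- under eq_fun do rewrite -EFinM; apply/measurable_EFinP; apply: measurable_funM.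
    exact: measurable_inner_weight.
  exact: measurable_normal_pdf.
- by apply/measurable_EFinP; apply: measurable_indic.
move=> x _; rewrite -!EFinM lee_fin normal_pdf01E /inner_weight indicE mem_setE in_itv /= -ler_norml.
case: (leP `|x| l) => h; rewrite ?mulr0 ?mul0r // mulr1 mulrC mulfK ?gt_eqF ?gauss_kernel_gt0 //.
exact: gauss_const_le1.
Qed.

Lemma integral_far_square (l m2 : R) : 0 <= l -> 0 <= m2 ->
  (\int[gamma]_x (x ^+ 2 : R)%:E <= m2%:E)%E ->
  (\int[gamma]_x (4 * x ^+ 2 * (l < `|x : R|)%R%:R)%:E <=
    (16 * gauss_kernel l * (l ^+ 2 + m2))%:E)%E.
Proof.
move=> l0 m20 hm2.
have g0 := gauss_kernel_gt0 l.
have mlt : measurable_fun [set: R] (fun x : R => (l < `|x|)%R%:R : R).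
  apply: (@measurableT_comp _ _ _ _ _ _ (fun b : bool => b%:R : R)) => //.
  by apply: measurable_fun_ltr => //; exact: measurableT_comp.
have := @gamma_tail_le R l (fun x => 4 * x ^+ 2 * (l < `|x|)%R%:R)
   (fun x => 8 * l ^+ 2 + 8 * x ^+ 2) l0.
have mk : measurable_fun [set: R] (fun x : R => 8 * l ^+ 2 + 8 * x ^+ 2).
  by apply: measurable_funD => //; apply: measurable_funM => //; exact: measurable_funX.
move=> H; apply: (le_trans (H _ mk _ _ _ _)) => {H}.
- by apply: measurable_funM => //; apply: measurable_funM => //; exact: measurable_funX.
- by move=> x; rewrite mulr_ge0 // mulr_ge0 // sqr_ge0.
- by move=> x; rewrite addr_ge0 // mulr_ge0 // sqr_ge0.
- by move=> x; rewrite ltNge => ->; rewrite mulr0.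
- move=> y y0.
  have H z : `|z| = y + l -> 4 * z ^+ 2 * (l < `|z|)%R%:R <= 8 * l ^+ 2 + 8 * y ^+ 2.
    move=> zE; have -> : z ^+ 2 = (y + l) ^+ 2 by rewrite -zE real_normK ?num_real.
    have := sqr_ge0 (y - l); case: (l < `|z|); rewrite ?mulr1 ?mulr0.
      by lra.
    by move=> _; rewrite addr_ge0 // mulr_ge0 // sqr_ge0.
  by split; [|rewrite sqrrN]; apply: H; rewrite -?opprD ?normrN ger0_norm ?addr_ge0.
apply: (@le_trans _ _ ((2 * gauss_kernel l)%:E * (8 * l ^+ 2 + 8 * m2)%:E)%E); last first.
  by rewrite -EFinM lee_fin; lra.
apply: lee_wpmul2l; first by rewrite lee_fin mulr_ge0 // ltW.
under eq_integral do rewrite EFinD.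
rewrite ge0_integralD //; last 3 first.
- by move=> x _; rewrite lee_fin mulr_ge0 // sqr_ge0.
- by move=> x _; rewrite lee_fin mulr_ge0 // sqr_ge0.
- by apply/measurable_EFinP; apply: measurable_funM => //; exact: measurable_funX.
rewrite EFinD; apply: leeD.
  have -> : (fun=> (8 * l ^+ 2)%:E) = (cst (8 * l ^+ 2)%:E : R -> \bar R) by [].
  by rewrite integral_cst // [X in (_ * X)%E](_ : _ = 1%E) ?mule1 //; exact: probability_setT.
under eq_integral do rewrite EFinM.
rewrite ge0_integralZl_EFin //; last 2 first.
- by move=> x _; rewrite lee_fin sqr_ge0.
- by apply/measurable_EFinP; exact: measurable_funX.
by rewrite EFinM; apply: lee_wpmul2l.
Qed.

(** The level at which [gauss_kernel] equals [1 / (n + 1)]. All the scores lie within this distance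
    of 0, and the normal mass outside is of order [1/n]. *)
Definition log_scale (n : nat) : R := Num.sqrt (2 * ln n.+1%:R).

Definition normal_score (n r : nat) : R := Q (r%:R / n.+1%:R).

Lemma log_scale_ge0 n : 0 <= log_scale n.
Proof. exact: sqrtr_ge0. Qed.

Lemma gauss_kernel_log_scale n : gauss_kernel (log_scale n) = n.+1%:R^-1.
Proof. by rewrite gauss_kernel_sqrt_ln // ler1n. Qed.

Lemma normal_scoreK n r : (0 < r <= n)%N -> Phi (normal_score n r) = r%:R / n.+1%:R.
Proof.
move=> /andP[r0 rn]; apply: std_normal_quantileK.
by rewrite divr_gt0 ?ltr0n // ltr_pdivrMr ?ltr0n // mul1r ltr_nat ltnS rn.
Qed.

Lemma normal_score_le n k : (0 < k < n)%N -> normal_score n k <= normal_score n k.+1.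
Proof.
move=> /andP[k0 kn]; apply: std_normal_quantile_le.
- by rewrite divr_gt0 ?ltr0n.
- by rewrite ler_pM2r ?invr_gt0 ?ltr0n // ler_nat.
- by rewrite ltr_pdivrMr ?ltr0n // mul1r ltr_nat ltnS.
Qed.

Lemma normal_score_bound n r : (0 < r <= n)%N -> `|normal_score n r| <= log_scale n.
Proof.
move=> /andP[r0 rn]; apply: std_normal_quantile_bound; first by rewrite ler1n.
  by rewrite ler_peMl ?invr_ge0 // ler1n.
rewrite lerBrDr -{2}[_^-1]mul1r -mulrDl ler_pdivrMr ?ltr0n // mul1r natr1 ler_nat.
by rewrite ltnS.
Qed.

Definition lipschitz_const : R := (2 / (gauss_const * expR (- 2))) ^+ 2.

(** For moderate [x] the error is transported to the scale of [Phi] by the inverse Lipschitz bound,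
    where it is a rank fluctuation. For [|x|] beyond [log_scale n] the score is smaller than [|x|],
    so the error is at most [2 |x|]. Here [N] stands for the number of other points below [x]. *)
Lemma score_error_pointwise n r (x N : R) : (0 < n)%N -> (0 < r <= n)%N -> r%:R = 1 + N ->
  (x - normal_score n r) ^+ 2 <=
   2 * lipschitz_const * (log_scale n + 1) ^+ 4 / n.+1%:R ^+ 2 *
    (inner_weight (log_scale n) x ^+ 2 * (N - n.-1%:R * Phi x) ^+ 2 + inner_weight (log_scale n) x ^+ 2)
   + 4 * x ^+ 2 * (log_scale n < `|x|)%R%:R.
Proof.
move=> n0 hr rN.
set l := log_scale n; set L := l + 1; set y := normal_score n r.
have l0 : 0 <= l by exact: log_scale_ge0.
have yl : `|y| <= l by exact: normal_score_bound.
have [xl|xl] := leP `|x| l; last first.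
  rewrite /inner_weight (leNgt `|x| l) xl mulr0 expr0n /= mul0r addr0 mulr0 add0r mulr1.
  have : `|x - y| <= 2 * `|x|.
    by apply: (le_trans (ler_normB _ _)); lra.
  rewrite -[X in _ -> X <= _]real_normK ?num_real // => h.
  have -> : 4 * x ^+ 2 = (2 * `|x|) ^+ 2 by rewrite exprMn real_normK ?num_real //; ring.
  by rewrite ler_sqr ?nnegrE ?mulr_ge0.
rewrite mulr0 addr0 /inner_weight xl mulr1.
have L1 : 1 <= L by rewrite lerDr.
have := @std_normal_cdf_inverse_lipschitz R L x y L1 (le_trans xl _) (le_trans yl _).
rewrite !lerDl ler01 => /(_ isT isT) H.
set c := gauss_const * expR (- 2) in H *; set e := gauss_kernel x in H *.
have c0 : 0 < c by rewrite mulr_gt0 ?gauss_const_gt0 ?expR_gt0.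
have e0 : 0 < e by exact: gauss_kernel_gt0.
set D := N - n.-1%:R * Phi x.
have n1 : 0 < n.+1%:R :> R by rewrite ltr0n.
have PD : (Phi x - Phi y) ^+ 2 <= 2 * (D ^+ 2 + 1) / n.+1%:R ^+ 2.
  rewrite normal_scoreK // rN ler_pdivlMr ?exprn_gt0 // -exprMn.
  (* The bias [1 - 2 Phi x] arises because the rank counts the point itself and because [n + 1]
     exceeds the number [n - 1] of other points by 2. It is at most 1 in absolute value. *)
  have -> : (Phi x - (1 + N) / n.+1%:R) * n.+1%:R = - (D + (1 - 2 * Phi x)).
    rewrite mulrBl mulfVK ?gt_eqF // /D -(prednK n0) /= -!natr1; ring.
  have := std_normal_cdf_ge0 x; have := std_normal_cdf_le1 x => p1 p0.
  have t1 : (1 - 2 * Phi x) ^+ 2 <= 1 by nra.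
  have gen (a t : R) : t ^+ 2 <= 1 -> (a + t) ^+ 2 <= 2 * (a ^+ 2 + 1).
    have -> : (a + t) ^+ 2 = 2 * a ^+ 2 + 2 * t ^+ 2 - (a - t) ^+ 2 by ring.
    by move=> ht; have := sqr_ge0 (a - t); lra.
  by rewrite sqrrN; exact: gen.
have H2 : c ^+ 2 * e ^+ 2 * (x - y) ^+ 2 <= 4 * L ^+ 4 * (Phi x - Phi y) ^+ 2.
  have -> : c ^+ 2 * e ^+ 2 * (x - y) ^+ 2 = (c * e * `|x - y|) ^+ 2.
    by rewrite !exprMn real_normK ?num_real.
  have -> : 4 * L ^+ 4 * (Phi x - Phi y) ^+ 2 = (2 * L ^+ 2 * `|Phi x - Phi y|) ^+ 2.
    by rewrite !exprMn real_normK ?num_real //; ring.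
  have ce0 : 0 <= c * e by apply: mulr_ge0; exact: ltW.
  have L20 : 0 <= 2 * L ^+ 2 by apply: mulr_ge0 => //; exact: sqr_ge0.
  by rewrite ler_sqr // nnegrE; exact: mulr_ge0.
have -> : 2 * lipschitz_const * L ^+ 4 / n.+1%:R ^+ 2 * (e^-1 ^+ 2 * D ^+ 2 + e^-1 ^+ 2) =
   (c ^+ 2 * e ^+ 2)^-1 * (4 * L ^+ 4 * (2 * (D ^+ 2 + 1) / n.+1%:R ^+ 2)).
  rewrite /lipschitz_const -/c; field.
  by rewrite !gt_eqF.
have ce2 : 0 < c ^+ 2 * e ^+ 2 by apply: mulr_gt0; exact: exprn_gt0.
rewrite (ler_pdivlMl _ _ ce2).
apply: (le_trans H2); apply: ler_wpM2l => //.
by apply: mulr_ge0 => //; apply: exprn_ge0; lra.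
Qed.

End score_error.

(** * Mean square error of the normal scores *)

Section sample_score_error.
Context {d : measure_display} {T : measurableType d} {R : realType}.
Variable P : probability T R.
Local Notation gamma := (@normal_prob R 0 1).
Local Notation Phi := (@std_normal_cdf R).

Lemma measurable_rank n (x : 'I_n -> T -> R) i :
  (forall j, measurable_fun [set: T] (x j)) ->
  measurable_fun [set: T] (fun w => rank (fun j => x j w) i).
Proof.
move=> mx; rewrite /rank.
suff H (s : seq 'I_n) : measurable_fun [set: T] (fun w => \sum_(j <- s) (x j w <= x i w)%R : nat)%N.
  exact: H.
elim: s => [|j s IH]; first by under eq_fun do rewrite big_nil; exact: measurable_cst.
under eq_fun do rewrite big_cons; apply: measurable_fun_addn => //.
apply: (@measurableT_comp _ _ _ _ _ _ nat_of_bool) => //; exact: measurable_fun_ler.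
Qed.

Lemma measurable_rank_comp n (x : 'I_n -> T -> R) i (F : nat -> R) :
  (forall j, measurable_fun [set: T] (x j)) ->
  measurable_fun [set: T] (fun w => F (rank (fun j => x j w) i)).
Proof.
by move=> mx; apply: (@measurableT_comp _ _ _ _ _ _ F) => //; exact: measurable_rank.
Qed.

(** The squared Lipschitz loss gives the fourth power. In the fluctuation term one inverse density
    is cancelled by the binomial variance, in the bias term one is bounded by [n + 1]; the remaining
    weight integrates to at most [2 * log_scale n], the fifth power. The prefactor [1/(n + 1)^2]
    times [n + 1] leaves the order [1/n]. *)
Lemma sample_score_error : exists2 C : R, 0 <= C & forall n (xi : 'I_n -> T -> R) i,
  iid_normal_sample P xi ->
  (\int[P]_w ((xi i w - normal_score n (rank (fun j => xi j w) i)) ^+ 2)%:E <=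
    (C * (log_scale n + 1) ^+ 5 / n.+1%:R)%:E)%E.
Proof.
have [m2 m20 hm2] := @normal_second_moment R.
pose K : R := lipschitz_const.
have K0 : 0 <= K by exact: sqr_ge0.
exists (8 * K + 16 * (1 + m2)); first by lra.
move=> n xi i iid.
have n0 : (0 < n)%N by case: n i {xi iid} => [[]|].
have mxi := iid.1.
set l := log_scale n; set L := l + 1.
have l0 : 0 <= l by exact: log_scale_ge0.
pose h x := inner_weight l x ^+ 2.
have mh : measurable_fun [set: R] h by apply: measurable_funX; exact: measurable_inner_weight.
have kl : (gauss_kernel l)^-1 = n.+1%:R by rewrite gauss_kernel_log_scale invrK.
have wl x : inner_weight l x <= n.+1%:R by rewrite -kl inner_weight_le.
have w0 x : 0 <= inner_weight l x by exact: inner_weight_ge0.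
have hB x : 0 <= h x <= n.+1%:R ^+ 2.
  by rewrite sqr_ge0 /= ler_sqr ?nnegrE.
pose N w : R := \sum_(j | j != i) (xi j w <= xi i w)%R%:R.
pose kap := 2 * K * L ^+ 4 / n.+1%:R ^+ 2.
have n1 : 0 < n.+1%:R :> R by rewrite ltr0n.
have kap0 : 0 <= kap.
  apply: divr_ge0; last by apply: exprn_ge0; exact: ltW.
  by apply: mulr_ge0; [exact: mulr_ge0|apply: exprn_ge0; exact: addr_ge0].
pose f1 w := h (xi i w) * (N w - n.-1%:R * Phi (xi i w)) ^+ 2.
pose f2 w := h (xi i w).
pose f3 w := 4 * xi i w ^+ 2 * (l < `|xi i w|)%R%:R.
have mN : measurable_fun [set: T] N.
  by apply: measurable_sum_cond => j; exact: measurable_le_indicator.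
have mf2 : measurable_fun [set: T] f2 by exact: measurableT_comp.
have mf1 : measurable_fun [set: T] f1.
  apply: measurable_funM => //; apply: measurable_funX; apply: measurable_funB => //.
  by apply: measurable_funM => //; apply: measurableT_comp => //; exact: measurable_std_normal_cdf.
have mlt : measurable_fun [set: R] (fun x : R => (l < `|x|)%R%:R : R).
  apply: (@measurableT_comp _ _ _ _ _ _ (fun b : bool => b%:R : R)) => //.
  by apply: measurable_fun_ltr => //; exact: measurableT_comp.
have mg3 : measurable_fun [set: R] (fun x : R => 4 * x ^+ 2 * (l < `|x|)%R%:R).
  by apply: measurable_funM => //; apply: measurable_funM => //; exact: measurable_funX.
have mf3 : measurable_fun [set: T] f3 by apply: (measurableT_comp mg3).
have f10 w : 0 <= f1 w by apply: mulr_ge0; exact: sqr_ge0.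
have f20 w : 0 <= f2 w by exact: sqr_ge0.
have f30 w : 0 <= f3 w by apply: mulr_ge0 => //; apply: mulr_ge0 => //; exact: sqr_ge0.
have B0 : (\int[gamma]_x (inner_weight l x)%:E <= (2 * l)%:E)%E by exact: integral_inner_weight.
have B1 : (\int[P]_w (f1 w)%:E <= (n.-1%:R * (2 * l))%:E)%E.
  rewrite (@integral_rank_noise _ _ _ P n xi iid h (n.+1%:R ^+ 2) i mh hB) EFinM.
  apply: lee_wpmul2l => //; apply: le_trans B0; apply: ge0_le_integral => //.
  - move=> x _; rewrite lee_fin; apply: mulr_ge0; first exact: sqr_ge0.
    apply: mulr_ge0; first exact: std_normal_cdf_ge0.
    by rewrite subr_ge0 std_normal_cdf_le1.
  - apply/measurable_EFinP; apply: measurable_funM => //; apply: measurable_funM => //.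
      exact: measurable_std_normal_cdf.
    by apply: measurable_funB => //; exact: measurable_std_normal_cdf.
  - by apply/measurable_EFinP; exact: measurable_inner_weight.
  - move=> x _; rewrite lee_fin; apply: (@le_trans _ _ (h x * gauss_kernel x)).
      by apply: ler_wpM2l; [exact: sqr_ge0|exact: std_normal_cdf_variance].
    rewrite /h /inner_weight; case: (_ <= l); rewrite ?mulr1 ?mulr0 ?expr0n ?mul0r //=.
    by rewrite expr2 mulfVK // gt_eqF // gauss_kernel_gt0.
have B2 : (\int[P]_w (f2 w)%:E <= (n.+1%:R * (2 * l))%:E)%E.
  rewrite (@iid_integral _ _ _ P n xi iid i (fun x => (h x)%:E)); last 2 first.
  - exact/measurable_EFinP.
  - by move=> x; rewrite lee_fin sqr_ge0.
  apply: (@le_trans _ _ (\int[gamma]_x (n.+1%:R%:E * (inner_weight l x)%:E))%E).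
    apply: ge0_le_integral => //.
    - by move=> x _; rewrite lee_fin sqr_ge0.
    - exact/measurable_EFinP.
    - under eq_fun do rewrite -EFinM; apply/measurable_EFinP; apply: measurable_funM => //.
      exact: measurable_inner_weight.
    - by move=> x _; rewrite -EFinM lee_fin /h expr2; apply: ler_wpM2r.
  rewrite ge0_integralZl_EFin //; last 2 first.
  - by move=> x _; rewrite lee_fin.
  - by apply/measurable_EFinP; exact: measurable_inner_weight.
  by rewrite EFinM; apply: lee_wpmul2l.
have B3 : (\int[P]_w (f3 w)%:E <= (16 * n.+1%:R^-1 * (l ^+ 2 + m2))%:E)%E.
  rewrite (@iid_integral _ _ _ P n xi iid i (fun x => (4 * x ^+ 2 * (l < `|x|)%R%:R)%:E)); last 2 first.
  - exact/measurable_EFinP.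
  - by move=> x; rewrite lee_fin mulr_ge0 // mulr_ge0 // sqr_ge0.
  rewrite -(gauss_kernel_log_scale n); exact: integral_far_square.
apply: (@le_trans _ _ (\int[P]_w ((kap%:E * (f1 w)%:E + kap%:E * (f2 w)%:E) + (f3 w)%:E))%E).
  apply: ge0_le_integral => //.
  - by move=> w _; rewrite lee_fin sqr_ge0.
  - apply/measurable_EFinP; apply: measurable_funX; apply: measurable_funB => //.
    exact: measurable_rank_comp.
  - under eq_fun do rewrite -!EFinM -!EFinD; apply/measurable_EFinP.
    by do 2 (apply: measurable_funD => //); exact: measurable_funM.
  - move=> w _; rewrite -!EFinM -!EFinD lee_fin -mulrDr.
    apply: score_error_pointwise => //; last exact: rank_below.
    by rewrite rank_ge1 rank_len.
rewrite ge0_integralD //; last 4 first.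
- by move=> w _; rewrite -!EFinM -EFinD lee_fin addr_ge0 // mulr_ge0.
- under eq_fun do rewrite -!EFinM -!EFinD; apply/measurable_EFinP.
  by apply: measurable_funD; exact: measurable_funM.
- by move=> w _; rewrite lee_fin.
- exact/measurable_EFinP.
rewrite ge0_integralD //; last 4 first.
- by move=> w _; rewrite -EFinM lee_fin mulr_ge0.
- by under eq_fun do rewrite -EFinM; apply/measurable_EFinP; exact: measurable_funM.
- by move=> w _; rewrite -EFinM lee_fin mulr_ge0.
- by under eq_fun do rewrite -EFinM; apply/measurable_EFinP; exact: measurable_funM.
rewrite !ge0_integralZl_EFin //; try exact/measurable_EFinP; try by move=> w _; rewrite lee_fin.
apply: (@le_trans _ _ ((kap%:E * (n.-1%:R * (2 * l))%:E + kap%:E * (n.+1%:R * (2 * l))%:E) +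
   (16 * n.+1%:R^-1 * (l ^+ 2 + m2))%:E)%E).
  by apply: leeD => //; apply: leeD; apply: lee_wpmul2l.
rewrite -!EFinM -!EFinD lee_fin.
have nn : n.-1%:R <= n.+1%:R :> R by rewrite ler_nat (leq_trans (leq_pred _)).
have L1 : 1 <= L by rewrite lerDr.
have L41 : 1 <= L ^+ 4 by rewrite expr_ge1 //; lra.
have i0 : 0 < n.+1%:R^-1 :> R by rewrite invr_gt0.
apply: (@le_trans _ _ (8 * K * (L ^+ 4 * l) / n.+1%:R + 16 * n.+1%:R^-1 * (l ^+ 2 + m2))).
  rewrite lerD2r -mulrDr -mulrDl.
  apply: (@le_trans _ _ (kap * ((n.+1%:R + n.+1%:R) * (2 * l)))).
    by rewrite ler_wpM2l // ler_wpM2r ?mulr_ge0 // lerD2r.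
  rewrite le_eqVlt; apply/orP; left; apply/eqP; rewrite /kap; field.
  by rewrite gt_eqF.
have -> : (8 * K + 16 * (1 + m2)) * L ^+ 5 / n.+1%:R =
   8 * K * (L ^+ 4 * L) / n.+1%:R + 16 * n.+1%:R^-1 * ((1 + m2) * L ^+ 5).
  by field; rewrite gt_eqF.
apply: lerD.
  apply: ler_wpM2r; first exact: ltW.
  apply: ler_wpM2l; first exact: mulr_ge0.
  by apply: ler_wpM2l; [apply: exprn_ge0; lra|rewrite lerDl].
rewrite ler_wpM2l ?mulr_ge0 ?(ltW i0) //.
have L5 : L ^+ 2 <= L ^+ 5 by rewrite ler_weXn2l.
have lL : l ^+ 2 <= L ^+ 2 by rewrite ler_sqr ?nnegrE ?lerDl // (le_trans ler01).
have L51 : 1 <= L ^+ 5 by rewrite expr_ge1 //; lra.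
have L52 : l ^+ 2 <= L ^+ 5 by exact: le_trans L5.
rewrite mulrDl mul1r lerD // ler_peMr //.
Qed.

End sample_score_error.

(** * Exchangeable vectors of pairs *)

Section exchangeability.
Context {d : measure_display} {T : measurableType d} {R : realType}.
Variables (P : probability T R) (n : nat).

Definition pair_box (A B : 'I_n -> set (measurableTypeR R)) : set ('I_n -> R * R) :=
  [set f | forall i, A i (f i).1 /\ B i (f i).2].

Definition pair_boxes : set (set ('I_n -> R * R)) :=
  [set E | exists A B, [/\ (forall i, measurable (A i)), (forall i, measurable (B i))
    & E = pair_box A B]].

(** The product sigma-algebra, presented by boxes: these are stable under intersection, so two laws
    on vectors of pairs agree once they agree on boxes. *)
Definition pair_vectors := g_sigma_algebraType pair_boxes.

Lemma measurable_pair_box (A B : 'I_n -> set (measurableTypeR R)) :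
  (forall i, measurable (A i)) -> (forall i, measurable (B i)) ->
  measurable (pair_box A B : set pair_vectors).
Proof. by move=> mA mB; apply: sub_sigma_algebra; exists A, B. Qed.

Lemma measurable_coord1 i : measurable_fun [set: pair_vectors] (fun f : pair_vectors => (f i).1).
Proof.
move=> _ A mA; rewrite setTI.
have -> : (fun f : pair_vectors => (f i).1) @^-1` A =
   pair_box (fun j => if j == i then A else setT) (fun=> setT).
  apply/seteqP; split => f /=.
    by move=> Af j; split => //; case: eqP => // ->.
  by move=> /(_ i)[]; rewrite eqxx.
by apply: measurable_pair_box => // j; case: ifP.
Qed.

Lemma measurable_coord2 i : measurable_fun [set: pair_vectors] (fun f : pair_vectors => (f i).2).
Proof.
move=> _ A mA; rewrite setTI.
have -> : (fun f : pair_vectors => (f i).2) @^-1` A =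
   pair_box (fun=> setT) (fun j => if j == i then A else setT).
  apply/seteqP; split => f /=.
    by move=> Af j; split => //; case: eqP => // ->.
  by move=> /(_ i)[]; rewrite eqxx.
by apply: measurable_pair_box => // j; case: ifP.
Qed.

Lemma pair_boxes_setI : setI_closed pair_boxes.
Proof.
move=> _ _ [A [B [mA mB ->]]] [A' [B' [mA' mB' ->]]].
exists (fun i => A i `&` A' i), (fun i => B i `&` B' i); split.
- by move=> i; exact: measurableI.
- by move=> i; exact: measurableI.
apply/seteqP; split => f /=.
  by move=> [h h'] i; have [] := h i; have [] := h' i.
by move=> h; split => i; have [[] ? ? []] := h i.
Qed.

Variable Z : T -> 'I_n -> R * R.
Hypothesis mZ1 : forall i, measurable_fun [set: T] (fun w => (Z w i).1).
Hypothesis mZ2 : forall i, measurable_fun [set: T] (fun w => (Z w i).2).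
Variable a : set (measurableTypeR R) -> set (measurableTypeR R) -> \bar R.
Hypothesis law : forall A B : 'I_n -> set (measurableTypeR R),
  (forall i, measurable (A i)) -> (forall i, measurable (B i)) ->
  P (Z @^-1` pair_box A B) = (\prod_i a (A i) (B i))%E.

Definition permuted (s : {perm 'I_n}) (w : T) : pair_vectors := fun i => Z w (s i).

Lemma measurable_permuted s : measurable_fun [set: T] (permuted s).
Proof.
apply: (@measurability _ _ T pair_vectors setT (permuted s) pair_boxes erefl).
move=> _ [_ [A [B [mA mB ->]]] <-]; rewrite setTI.
have -> : permuted s @^-1` pair_box A B =
   \big[setI/setT]_(i < n) (((fun w => (Z w (s i)).1) @^-1` A i) `&` ((fun w => (Z w (s i)).2) @^-1` B i)).
  apply/seteqP; split => w /=.
    by move=> h; rewrite -bigcap_seq => i _ /=; exact: h.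
  by rewrite -bigcap_seq => h i; apply: (h i); rewrite /= mem_index_enum.
apply: bigsetI_measurable => i _; apply: measurableI.
  by rewrite -[X in measurable X]setTI; exact: (mZ1 (s i) measurableT (mA i)).
by rewrite -[X in measurable X]setTI; exact: (mZ2 (s i) measurableT (mB i)).
Qed.

Lemma exchangeable s (E : set pair_vectors) : measurable E ->
  P (permuted s @^-1` E) = P (permuted 1%g @^-1` E).
Proof.
move=> mE.
pose m1' : {measure set pair_vectors -> \bar R} := pushforward P (permuted s).
pose m1 := m1' (measurable_permuted s).
pose m2' : {measure set pair_vectors -> \bar R} := pushforward P (permuted 1%g).
pose m2 := m2' (measurable_permuted 1%g).
rewrite -[LHS]/(m1 E) -[RHS]/(m2 E).
have setTb : pair_box (fun=> setT) (fun=> setT) = setT.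
  by apply/seteqP; split.
apply: (@measure_unique _ R pair_vectors pair_boxes (fun=> setT) erefl) => //.
- exact: pair_boxes_setI.
- by move=> _; exists (fun=> setT), (fun=> setT).
- by rewrite bigcup_const.
- move=> _ [A [B [mA mB ->]]].
  have E1 : m1 (pair_box A B) = P (Z @^-1` pair_box (fun i => A (s^-1%g i)) (fun i => B (s^-1%g i))).
    rewrite /m1 /m1' /=; congr (P _); apply/seteqP; split => w /= h i.
      by have := h (s^-1%g i); rewrite /permuted permKV.
    by have := h (s i); rewrite permK.
  have E2 : m2 (pair_box A B) = P (Z @^-1` pair_box A B).
    rewrite /m2 /m2' /=; congr (P _); apply/seteqP; split => w /= h i.
      by have := h i; rewrite /permuted perm1.
    by have := h i; rewrite /permuted perm1.
  rewrite E1 E2 !law // (reindex_inj (@perm_inj _ s)) /=.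
  by apply: eq_bigr => i _; rewrite permK.
- by move=> _; apply: (le_lt_trans (probability_le1 _ _)); rewrite ?ltry // ?preimage_setT.
Qed.

Variable D : 'I_n -> pair_vectors -> R.
Hypothesis mD : forall i, measurable_fun [set: pair_vectors] (D i).
Hypothesis equivariant : forall (s : {perm 'I_n}) i f, D i (f \o s) = D (s i) f.

Definition centered i f := D i f - (\sum_j D j f) / n%:R.

Definition centered_psum k f := \sum_(i < n | (i < k)%N) centered i f.

Lemma measurable_centered_psum k : measurable_fun [set: pair_vectors] (centered_psum k).
Proof.
apply: measurable_sum_cond => i; apply: measurable_funB => //.
by apply: measurable_funM => //; apply: measurable_sum.
Qed.

Lemma sum_centered f : \sum_i centered i f = 0.
Proof.
rewrite sumrB sumr_const card_ord -[X in _ - X]mulr_natr.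
case: (posnP n) => n0; last by rewrite mulfVK ?subrr // pnatr_eq0 -lt0n.
have E0 : n%:R = 0 :> R by rewrite n0.
by rewrite E0 mulr0 subr0 big1 // => -[i hi]; exfalso; lia.
Qed.

Lemma sum_centered_sqr f : \sum_i centered i f ^+ 2 <= \sum_i D i f ^+ 2.
Proof.
set m := (\sum_j D j f) / n%:R.
have E : \sum_i D i f ^+ 2 = \sum_i centered i f ^+ 2 + (2 * m) * (\sum_i centered i f) + m ^+ 2 *+ n.
  rewrite mulr_sumr -[n in m ^+ 2 *+ n]card_ord -sumr_const -!big_split.
  apply: eq_bigr => i _ /=; rewrite /centered -/m; ring.
by rewrite E sum_centered mulr0 addr0 lerDl mulrn_wge0 // sqr_ge0.
Qed.

(** The event has the same probability after any permutation of the pairs, and by equivariance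
    permuting the pairs permutes the values [D i]. Averaging over all [n!] permutations therefore
    reduces the claim to [perm_maximal], applied outcome by outcome to the centred values. *)
Lemma exchangeable_maximal (lam : R) : 0 < lam ->
  (P [set w | exists2 k, (k <= n)%N & (lam <= `|centered_psum k (Z w)|)%R] <=
   (64 / lam ^+ 2)%:E * \int[P]_w (\sum_i D i (Z w) ^+ 2)%:E)%E.
Proof.
move=> lam0.
pose E : set pair_vectors := [set f | exists2 k, (k <= n)%N & lam <= `|centered_psum k f|].
have mE : measurable E.
  have -> : E = \bigcup_(k in [set k | (k < n.+1)%N]) [set f | lam <= `|centered_psum k f|].
    by apply/seteqP; split => f [k kn h]; exists k.
  apply: bigcup_measurable => k _.
  rewrite -[X in measurable X]setTI.
  have mf : measurable_fun [set: pair_vectors] (fun f => `|centered_psum k f|).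
    by apply: measurableT_comp => //; exact: measurable_centered_psum.
  have := mf measurableT _ (measurable_itv `[lam, +oo[).
  by congr measurable; apply/seteqP; split => f /=; rewrite in_itv /= andbT.
have ZE w : permuted 1%g w = Z w by apply/funext => i; rewrite /permuted perm1.
have psumE k s w : centered_psum k (permuted s w) =
    perm_psum (fun i => centered i (Z w)) k s.
  apply: eq_bigr => i _; rewrite /centered.
  have -> : permuted s w = Z w \o s by [].
  rewrite equivariant; congr (_ - _ / _).
  by rewrite [RHS](reindex_inj (@perm_inj _ s)); apply: eq_bigr => j _; exact: equivariant.
pose c : R := n`!%:R.
have c0 : 0 < c by rewrite ltr0n fact_gt0.
have mEs s : measurable (permuted s @^-1` E).
  by rewrite -[X in measurable X]setTI; exact: (measurable_permuted s measurableT).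
have -> : [set w | exists2 k, (k <= n)%N & lam <= `|centered_psum k (Z w)|] = permuted 1%g @^-1` E.
  by apply/seteqP; split => w /=; rewrite ZE.
(* On the event some squared partial sum is at least [lam^2], so this multiple of the indicator is
   an admissible [F] in [perm_maximal]. *)
pose F s w : R := lam ^+ 2 * \1_(permuted s @^-1` E) w.
have F0 s w : 0 <= F s w by rewrite mulr_ge0 // sqr_ge0.
have mF s : measurable_fun [set: T] (F s).
  by apply: measurable_funM => //; exact: measurable_indic.
have IF s : (\int[P]_w (F s w)%:E = (lam ^+ 2)%:E * P (permuted 1%g @^-1` E))%E.
  under eq_integral do rewrite EFinM.
  rewrite ge0_integralZl_EFin ?sqr_ge0 //; last by apply/measurable_EFinP; exact: measurable_indic.
  congr (_ * _)%E; rewrite -[RHS](exchangeable s mE).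
  by rewrite integral_indic // setIT.
have mDZ i : measurable_fun [set: T] (fun w => D i (Z w)).
  have := measurableT_comp (mD i) (measurable_permuted 1%g).
  by congr (measurable_fun _ _); apply/funext => w /=; rewrite ZE.
have FD w : \sum_s F s w <= 64 * c * \sum_i D i (Z w) ^+ 2.
  apply: (@le_trans _ _ (64 * c * \sum_i centered i (Z w) ^+ 2)); last first.
    by rewrite ler_pM2l ?mulr_gt0 // sum_centered_sqr.
  apply: perm_maximal; first exact: sum_centered.
  move=> s; rewrite /F indicE; case: (boolP (w \in _)) => [/set_mem[k kn h]|_].
    exists k => //; rewrite mulr1 -psumE -[leRHS]real_normK ?num_real // ler_sqr ?nnegrE //.
    exact: ltW.
  by exists 0%N => //; rewrite mulr0 sqr_ge0.
have mDD : measurable_fun [set: T] (fun w => \sum_i D i (Z w) ^+ 2).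
  by apply: measurable_sum => i; exact: measurable_funX.
have DD0 w : 0 <= \sum_i D i (Z w) ^+ 2 by apply: sumr_ge0 => i _; exact: sqr_ge0.
have main : ((c * lam ^+ 2)%:E * P (permuted 1%g @^-1` E) <=
     (64 * c)%:E * \int[P]_w (\sum_i D i (Z w) ^+ 2)%:E)%E.
  rewrite -ge0_integralZl_EFin //; last 3 first.
  - by move=> w _; rewrite lee_fin.
  - exact/measurable_EFinP.
  - by rewrite mulr_ge0 // ltW.
  apply: (@le_trans _ _ (\int[P]_w (\sum_(s in [set: {perm 'I_n}]%SET) F s w)%:E)%E); last first.
    apply: ge0_le_integral => //.
    - by move=> w _; rewrite lee_fin sumr_ge0.
    - by apply/measurable_EFinP; exact: measurable_sum_cond.
    - by under eq_fun do rewrite -EFinM; apply/measurable_EFinP; exact: measurable_funM.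
    - by move=> w _; rewrite -EFinM lee_fin; under eq_bigl do rewrite finset.in_setT.
  rewrite integral_sum_cond // (eq_bigr _ (fun s _ => IF s)).
  have [r ->] : exists r, P (permuted 1%g @^-1` E) = r%:E.
    by exists (fine (P (permuted 1%g @^-1` E))); rewrite fineK // fin_num_measure.
  rewrite (eq_bigr (fun=> (lam ^+ 2 * r)%:E)); last by move=> s _; rewrite EFinM.
  rewrite sumEFin sumr_const cardsT card_Sn -EFinM lee_fin -mulrA /c mulr_natl.
  exact: lexx.
have cl0 : 0 < c * lam ^+ 2 by rewrite mulr_gt0 // exprn_gt0.
have -> : (64 / lam ^+ 2)%:E = ((c * lam ^+ 2)^-1%:E * (64 * c)%:E)%E.
  by rewrite -EFinM; congr (_%:E); field; rewrite !gt_eqF.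
rewrite -muleA -[leLHS]mul1e -(_ : ((c * lam ^+ 2)^-1%:E * (c * lam ^+ 2)%:E = 1)%E); last first.
  by rewrite -EFinM mulVf // gt_eqF.
by rewrite -muleA; apply: lee_wpmul2l => //; rewrite lee_fin invr_ge0 ltW.
Qed.

End exchangeability.

(** * Trigonometric inequalities *)

Section trigonometric_bounds.
Context {R : realType}.
Implicit Types x z : R.

Lemma derive_ge0_le (f df : R -> R) (b x : R) :
  (forall y : R, is_derive y 1 f (df y)) -> (forall y : R, 0 < y < b -> 0 <= df y) ->
  0 <= x <= b -> f 0 <= f x.
Proof.
move=> fd df0 /andP[x0 xb].
have [x00|x00] := eqVneq x 0; first by rewrite x00.
have xp : 0 < x by rewrite lt_neqAle eq_sym x00.
have cf : {within `[0, x], continuous f}.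
  by apply: derivable_within_continuous => y _; have [] := fd y.
have [c] := @MVT R f df 0 x xp (fun y _ => fd y) cf.
rewrite in_itv /= => /andP[c0 cx] E.
by rewrite -subr_ge0 E subr0 mulr_ge0 // df0 // c0 (lt_le_trans cx).
Qed.

Lemma sin_le_id x : 0 <= x -> sin x <= x.
Proof.
move=> x0; have := @derive_ge0_le (fun y => y - sin y) (fun y => 1 - cos y) x x.
rewrite sin0 subrr subr_ge0; apply; last by rewrite x0 lexx.
by move=> y _; rewrite subr_ge0 cos_le1.
Qed.

Lemma normr_sin_le x : `|sin x| <= `|x|.
Proof.
have H (y : R) : 0 <= y -> `|sin y| <= y.
  move=> y0; rewrite ler_norml sin_le_id // andbT.
  have := @derive_ge0_le (fun y => y + sin y) (fun y => 1 + cos y) y y.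
  rewrite sin0 addr0 => H; suff : 0 <= y + sin y by lra.
  apply: H; last by rewrite y0 lexx.
  by move=> z _; rewrite -lerBlDl sub0r cos_geN1.
by case: (ger0P x) => [/H //|/ltW h]; rewrite -[x in sin x]opprK sinN normrN H // oppr_ge0.
Qed.

Lemma one_minus_cosE x : 1 - cos x = 2 * sin (x / 2) ^+ 2.
Proof.
have -> : cos x = cos ((x / 2) *+ 2) by congr cos; rewrite -mulr_natr; field.
rewrite cos_mulr2n; have := cos2Dsin2 (x / 2); rewrite mulr2n; lra.
Qed.

Lemma one_minus_cos_ge0 x : 0 <= 1 - cos x.
Proof. by rewrite subr_ge0 cos_le1. Qed.

Lemma one_minus_cos_le x : 1 - cos x <= x ^+ 2 / 2.
Proof.
rewrite one_minus_cosE.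
have : sin (x / 2) ^+ 2 <= (x / 2) ^+ 2.
  by rewrite -[leLHS]real_normK ?num_real // -[leRHS]real_normK ?num_real // ler_sqr ?nnegrE // normr_sin_le.
by rewrite exprMn; lra.
Qed.

Lemma sin_ge_half x : 0 <= x <= 1 -> x / 2 <= sin x.
Proof.
move=> x01.
have := @derive_ge0_le (fun y => sin y - y / 2) (fun y => cos y - 2^-1) 1 x.
rewrite sin0 mul0r subrr subr_ge0; apply => //.
  move=> y; have h1 := is_derive_sin y.
  have h2 : is_derive y 1 (fun y : R => y / 2) (2^-1 : R).
    have := @is_deriveZ R R R (id : R -> R) (2^-1) y 1 1 (is_derive_id y 1).
    have -> : (2^-1 : R) \*: (id : R -> R) = (fun y => y / 2) by apply/funext => t /=; rewrite /GRing.scale /= mulrC.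
    by rewrite /GRing.scale /= mulr1.
  exact: is_deriveB.
move=> y /andP[y0 y1]; have := one_minus_cos_le y.
have : y ^+ 2 <= 1 by rewrite expr_le1 // ltW.
lra.
Qed.

Lemma one_minus_cos_ge x : `|x| <= 2 -> x ^+ 2 / 8 <= 1 - cos x.
Proof.
move=> x2; have -> : cos x = cos `|x| by case: (ger0P x) => // _; rewrite cosN.
rewrite -[x ^+ 2]real_normK ?num_real //.
have := normr_ge0 x; move: (`|x| : R) x2 => y y2 y0.
rewrite one_minus_cosE.
have h : y / 2 / 2 <= sin (y / 2) by apply: sin_ge_half; apply/andP; split; lra.
have : (y / 2 / 2) ^+ 2 <= sin (y / 2) ^+ 2.
  by rewrite ler_sqr ?nnegrE //; [lra|apply: le_trans h; lra].
rewrite !exprMn; lra.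
Qed.

Lemma sin_le_cubic z : 0 <= z <= 2 -> sin z <= z - z ^+ 3 / 24.
Proof.
move=> z02.
have := @derive_ge0_le (fun y => y - y ^+ 3 / 24 - sin y) (fun y => 1 - y ^+ 2 / 8 - cos y) 2 z.
rewrite sin0 expr0n /= mul0r !subrr subr_ge0; apply => //.
  move=> y; have h1 := is_derive_sin y.
  have h2 : is_derive y 1 (fun y : R => y ^+ 3 / 24) (y ^+ 2 / 8 : R).
    have h3 : is_derive y 1 (fun y : R => y ^+ 3) (3%:R * y ^+ 2 : R).
      have := @is_deriveX R R (id : R -> R) 3 y 1 1 (is_derive_id y 1).
      by rewrite /GRing.scale /= mulr1.
    have h5 : is_derive y 1 ((24^-1 : R) \*: (fun y : R => y ^+ 3)) ((24^-1 : R) *: (3%:R * y ^+ 2 : R)).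
      exact: is_deriveZ.
    have E : (fun y : R => y ^+ 3 / 24) = (24^-1 : R) \*: (fun y : R => y ^+ 3).
      by apply/funext => t /=; rewrite /GRing.scale /= mulrC.
    rewrite E (_ : y ^+ 2 / 8 = (24^-1 : R) *: (3%:R * y ^+ 2 : R)) //.
    by rewrite /GRing.scale /=; field.
  have h4 : is_derive y 1 (fun y : R => y - y ^+ 3 / 24) (1 - y ^+ 2 / 8) by exact: is_deriveB.
  exact: is_deriveB.
move=> y /andP[y0 y2]; have := @one_minus_cos_ge y.
by rewrite (ger0_norm (ltW y0)) => /(_ (ltW y2)); lra.
Qed.

(** The right side is the mean of [1 - cos (u z)] over [u] in [0, 1]. The constant 24 comes from
    [sin_le_cubic], obtained by integrating [1 - cos y >= y^2 / 8]; beyond 2 the bound [sin <= 1]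
    suffices. *)
Lemma sinc_bound z : z != 0 -> Num.min (z ^+ 2) 1 / 24 <= 1 - sin z / z.
Proof.
move=> z0; have -> : sin z / z = sin `|z| / `|z|.
  by case: (ger0P z) => // _; rewrite sinN invrN mulrNN.
rewrite -[z ^+ 2]real_normK ?num_real //.
have : 0 < `|z| by rewrite normr_gt0.
move: (`|z| : R) => y y0.
have [y2|y2] := leP y 2.
  have := @sin_le_cubic y; rewrite (ltW y0) y2 => /(_ isT) h.
  apply: (@le_trans _ _ (y ^+ 2 / 24)); first by rewrite ler_pM2r ?invr_gt0 // ge_min lexx.
  rewrite lerBrDr -lerBrDl ler_pdivrMr // mulrBl mul1r mulrAC.
  by rewrite -exprSr.
apply: (@le_trans _ _ (1 / 24)); first by rewrite ler_pM2r ?invr_gt0 // ge_min lexx orbT.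
have : sin y / y <= 1 / 2.
  by rewrite ler_pdivrMr //; have := sin_le1 y; lra.
lra.
Qed.

Lemma integral_one_minus_cos z : z != 0 ->
  (\int[@lebesgue_measure R]_(u in `[0%R, 1%R]) (1 - cos (u * z))%:E = (1 - sin z / z)%:E)%E.
Proof.
move=> z0.
pose F u := u - sin (u * z) / z.
have dF (u : R) : is_derive u 1 F (1 - cos (u * z)).
  have h1 : is_derive u 1 (fun u : R => u * z) (z : R).
    have := @is_deriveZ R R R (id : R -> R) z u 1 1 (is_derive_id u 1).
    have -> : (z : R) \*: (id : R -> R) = (fun y => y * z) by apply/funext => t /=; rewrite /GRing.scale /= mulrC.
    by rewrite /GRing.scale /= mulr1.
  have h2 : is_derive u 1 (sin \o (fun u : R => u * z)) (z *: cos (u * z)).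
    have h : is_derive ((fun u : R => u * z) u) 1 sin (cos (u * z)) by exact: is_derive_sin.
    by have := @is_derive1_comp R sin (fun u : R => u * z) u _ _ h h1; rewrite mulrC.
  have h3 : is_derive u 1 ((z^-1 : R) \*: (sin \o (fun u : R => u * z))) (z^-1 *: (z *: cos (u * z))).
    exact: is_deriveZ.
  have -> : F = id \- ((z^-1 : R) \*: (sin \o (fun u : R => u * z))).
    by apply/funext => t /=; rewrite /F /GRing.scale /= [_ * sin _]mulrC.
  have -> : 1 - cos (u * z) = 1 - z^-1 *: (z *: cos (u * z)).
    by rewrite /GRing.scale /= mulrA mulVf // mul1r.
  exact: is_deriveB.
have cF : continuous F by move=> u; apply/differentiable_continuous/derivable1_diffP; have [] := dF u.
rewrite (@continuous_FTC2 R (fun u => 1 - cos (u * z)) F 0 1) //.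
- by rewrite -EFinB /F mul1r mul0r sin0 mul0r !subr0.
- apply: continuous_subspaceT => u; apply: cvgB; first exact: cvg_cst.
  apply: (@continuous_comp _ _ _ (fun u : R => u * z) cos); last exact: continuous_cos.
  by apply: cvgM; [exact: cvg_id|exact: cvg_cst].
- split.
  + by move=> u _; have [] := dF u.
  + by apply: cvg_at_right_filter; exact: cF.
  + by apply: cvg_at_left_filter; exact: cF.
- by move=> u _; rewrite derive1E; have [_ ->] := dF u.
Qed.

End trigonometric_bounds.

(** * Truncated second moments from characteristic functions *)

Section centering.
Context {d : measure_display} {T : measurableType d} {R : realType}.
Variable P : probability T R.
Local Notation mu := (@lebesgue_measure R).

Lemma bounded_integrable (f : T -> R) (M : R) :
  measurable_fun [set: T] f -> (forall w, `|f w| <= M) ->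
  P.-integrable [set: T] (EFin \o f).
Proof.
move=> mf fM; apply: measurable_bounded_integrable => //.
  by apply: (le_lt_trans (probability_le1 _ _)); rewrite ?ltry.
by exists M; split; [exact: num_real|move=> x Mx w _; exact: le_trans (fM w) (ltW Mx)].
Qed.

Lemma EFin_Rintegral (f : T -> R) : P.-integrable [set: T] (EFin \o f) ->
  (\int[P]_w (f w)%:E = (\int[P]_w f w)%R%:E)%E.
Proof. by move=> fi; rewrite /Rintegral fineK //; exact: integrable_fin_num. Qed.

Section charfun.
Variable V : T -> R.
Hypothesis mV : measurable_fun [set: T] V.

Let muV u : measurable_fun [set: T] (fun w => u * V w).
Proof. exact: measurable_funM. Qed.

Let icos u : P.-integrable [set: T] (EFin \o (fun w => cos (u * V w))).
Proof.
apply: (@bounded_integrable _ 1).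
  by apply: (measurableT_comp (continuous_measurable_fun (@continuous_cos R)) (muV u)).
by move=> w; rewrite ler_norml cos_geN1 cos_le1.
Qed.

Let isin u : P.-integrable [set: T] (EFin \o (fun w => sin (u * V w))).
Proof.
apply: (@bounded_integrable _ 1).
  by apply: (measurableT_comp (continuous_measurable_fun (@continuous_sin R)) (muV u)).
by move=> w; rewrite ler_norml sin_geN1 sin_le1.
Qed.

(** The characteristic function of the difference of two independent copies is the squared modulus
    of that of [V]; here the copies are the two integration variables. *)
Lemma integral_symmetrized u :
  (\int[P]_w \int[P]_w' (1 - cos (u * (V w - V w')))%:E =
   (1 - ((\int[P]_w cos (u * V w)) ^+ 2 + (\int[P]_w sin (u * V w)) ^+ 2)%R)%:E)%E.
Proof.
set A := \int[P]_w cos (u * V w); set B := \int[P]_w sin (u * V w).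
have ione : P.-integrable [set: T] (EFin \o (cst 1 : T -> R)).
  by apply: (@bounded_integrable _ 1) => // w; rewrite /= normr1.
have lin (a b : R) : (\int[P]_w (1 - (a * cos (u * V w) + b * sin (u * V w)))%:E =
   (1 - (a * A + b * B))%:E)%E.
  have ia : P.-integrable [set: T] (EFin \o (fun w => a * cos (u * V w))).
    rewrite (_ : EFin \o _ = (fun w => a%:E * (cos (u * V w))%:E)%E) //.
    exact: (integrableZl measurableT a (icos u)).
  have ib : P.-integrable [set: T] (EFin \o (fun w => b * sin (u * V w))).
    rewrite (_ : EFin \o _ = (fun w => b%:E * (sin (u * V w))%:E)%E) //.
    exact: (integrableZl measurableT b (isin u)).
  have iab : P.-integrable [set: T] (EFin \o (fun w => a * cos (u * V w) + b * sin (u * V w))).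
    rewrite (_ : EFin \o _ = ((EFin \o (fun w => a * cos (u * V w))%R) \+
      (EFin \o (fun w => b * sin (u * V w))%R))%E) //.
    exact: integrableD.
  rewrite EFin_Rintegral; last first.
    rewrite (_ : EFin \o _ = ((EFin \o (cst 1%R : T -> R)) \-
      (EFin \o (fun w => a * cos (u * V w) + b * sin (u * V w))%R))%E) //.
    exact: integrableB.
  congr (_%:E); rewrite (@RintegralB _ _ _ P setT (cst 1)) // RintegralD // !RintegralZl //.
  by rewrite Rintegral_cst // mul1r /= probability_setT.
transitivity (\int[P]_w (1 - (A * cos (u * V w) + B * sin (u * V w)))%:E)%E.
  apply: eq_integral => w _.
  rewrite [A * _]mulrC [B * _]mulrC -lin; apply: eq_integral => w' _; congr (_%:E).
  by rewrite mulrBr cosB.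
by rewrite lin !expr2.
Qed.

Lemma integral_one_minus_cos_ge (z : R) :
  ((Num.min (z ^+ 2) 1 / 24)%:E <=
   \int[mu]_(u in `[0%R, 1%R]) (1 - cos (u * z))%:E)%E.
Proof.
have [->|z0] := eqVneq z 0.
  rewrite expr0n /= min_l // mul0r; apply: integral_ge0 => u _.
  by rewrite lee_fin one_minus_cos_ge0.
by rewrite integral_one_minus_cos // lee_fin sinc_bound.
Qed.

(* The centring is found by averaging over an independent copy of V, so neither the drift
   nor the imaginary part of the characteristic exponent enters. *)
Lemma centering_of_charfun (K K' : R) : K < K' ->
  (forall u, 0 <= u <= 1 ->
    1 - K <= (\int[P]_w cos (u * V w)) ^+ 2 + (\int[P]_w sin (u * V w)) ^+ 2) ->
  exists c, (\int[P]_w (Num.min ((V w - c) ^+ 2) 1)%:E <= (24 * K')%:E)%E.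
Proof.
(* If every [c] failed, the values [V w'] would fail too; averaging over [w'] would put the
   symmetrised integral above [K'], against its upper bound [K]. *)
move=> KK' hK; apply: contrapT => nex.
have far c : ((24 * K')%:E < \int[P]_w (Num.min ((V w - c) ^+ 2) 1)%:E)%E.
  by rewrite ltNge; apply/negP => h; apply: nex; exists c.
have mcos : measurable_fun [set: R] (fun x : R => 1 - cos x).
  apply: measurable_funB => //; exact: (continuous_measurable_fun (@continuous_cos R)).
pose D : set (measurableTypeR R) := `[0%R, 1%R]%classic.
have mD : measurable D by exact: measurable_itv.
pose g (t : (T * T) * measurableTypeR R) : \bar R :=
  (\1_D t.2 * (1 - cos (t.2 * (V t.1.1 - V t.1.2))))%:E.
have mg : measurable_fun [set: (T * T) * measurableTypeR R] g.
  apply/measurable_EFinP; apply: measurable_funM.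
    by apply: (measurableT_comp (f := \1_D : measurableTypeR R -> R)) => //; exact: measurable_indic.
  apply: (measurableT_comp mcos).
  apply: (@measurable_funM _ _ _ _ (fun t : (T * T) * measurableTypeR R => t.2) (fun t => V t.1.1 - V t.1.2)).
    exact: measurable_snd.
  apply: measurable_funB; apply: measurableT_comp => //.
    exact: (measurableT_comp measurable_fst measurable_fst).
  exact: (measurableT_comp measurable_snd measurable_fst).
have g0 t : (0 <= g t)%E by rewrite lee_fin mulr_ge0 // one_minus_cos_ge0.
have restrict (f : R -> R) : (\int[mu]_u (\1_D u * f u)%:E = \int[mu]_(u in D) (f u)%:E)%E.
  rewrite [RHS]integral_mkcond; apply: eq_integral => u _.
  by rewrite patchE indicE; case: ifP => _; rewrite ?mul1r ?mul0r.
pose PP : probability (T * T)%type R := (P \x P)%E.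
have inner (u : measurableTypeR R) :
    (\int[PP]_z g (z, u) <= (\1_D u * K)%:E)%E.
  rewrite [leLHS](@fubini_tonelli1 _ _ _ _ _ P P (fun z => g (z, u))) //; last 1 first.
    by apply: (measurableT_comp mg); exact: measurable_fun_pair.
  rewrite /fubini_F /g /= indicE; case: (boolP (u \in D)) => [/set_mem|_]; last first.
    rewrite mul0r; under eq_integral do under eq_integral do rewrite mul0r.
    by under eq_integral do rewrite integral0; rewrite integral0.
  rewrite /D /= in_itv /= => u01.
  under eq_integral do under eq_integral do rewrite mul1r.
  by rewrite integral_symmetrized mul1r lee_fin; have := hK u u01; lra.
have total : (\int[mu]_u \int[PP]_z g (z, u) <= K%:E)%E.
  apply: (@le_trans _ _ (\int[mu]_u (\1_D u * K)%:E)%E).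
    apply: ge0_le_integral => //.
    - by move=> u _; exact: integral_ge0.
    - exact: (@measurable_fun_fubini_tonelli_G _ _ _ _ _ PP g mg g0).
    - by apply/measurable_EFinP; apply: measurable_funM => //; exact: measurable_indic.
  rewrite (restrict (fun=> K)) (_ : (fun=> K%:E) = cst K%:E) // integral_cst //.
  by rewrite /D /= lebesgue_measure_itv /= lte_fin ltr01 oppr0 adde0 mule1.
have swap : (\int[P]_w' \int[P]_w \int[mu]_u g ((w, w'), u) <= K%:E)%E.
  apply: le_trans total.
  rewrite -(@fubini_tonelli _ _ _ _ _ PP mu g mg g0).
  rewrite [leRHS](@fubini_tonelli2 _ _ _ _ _ P P (fun z => \int[mu]_u g (z, u))%E) //.
  - exact: (measurable_fun_fubini_tonelli_F (m2 := mu) g mg g0).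
  - by move=> z; exact: integral_ge0.
have : (K'%:E <= K%:E :> \bar R)%E; last by rewrite lee_fin leNgt KK'.
apply: le_trans swap.
have mH := measurable_fun_fubini_tonelli_F (m2 := mu) g mg g0.
have -> : (K'%:E = \int[P]_w' cst K'%:E w')%E.
  by rewrite integral_cst // [X in (_ * X)%E]probability_setT mule1.
(* At frequency 0 the characteristic function is 1, which forces [K >= 0]. *)
have K'0 : 0 <= K'.
  have := hK 0; rewrite lexx ler01 => /(_ isT).
  have -> : \int[P]_w cos (0 * V w) = 1.
    under eq_Rintegral do rewrite mul0r cos0.
    by rewrite Rintegral_cst // mul1r /= probability_setT.
  have -> : \int[P]_w sin (0 * V w) = 0.
    under eq_Rintegral do rewrite mul0r sin0.
    by rewrite Rintegral_cst // mul0r.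
  by rewrite expr1n expr0n addr0; move: KK'; lra.
apply: ge0_le_integral => //.
  exact: (@measurable_fun_fubini_tonelli_G _ _ _ _ _ P _ mH (fun z => integral_ge0 _ (fun u _ => g0 (z, u)))).
move=> w' _.
have -> : (K'%:E = (24^-1)%:E * (24 * K')%:E :> \bar R)%E.
  by rewrite -EFinM; congr (_%:E); field.
apply: (@le_trans _ _ ((24^-1)%:E * \int[P]_w (Num.min ((V w - V w') ^+ 2) 1)%:E)%E).
  by apply: lee_wpmul2l; [rewrite lee_fin|exact/ltW/far].
have mmin : measurable_fun [set: T] (fun w => Num.min ((V w - V w') ^+ 2) 1).
  by apply: measurable_minr => //; apply: measurable_funX; exact: measurable_funB.
have min0 (z : R) : 0 <= Num.min (z ^+ 2) 1 by rewrite le_min sqr_ge0 ler01.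
rewrite -ge0_integralZl_EFin //; last 2 first.
- by move=> w _; rewrite lee_fin.
- exact/measurable_EFinP.
apply: ge0_le_integral => //.
- by move=> w _; rewrite -EFinM lee_fin mulr_ge0.
- by under eq_fun do rewrite -EFinM; apply/measurable_EFinP; exact: measurable_funM.
- by apply: (measurableT_comp mH); exact: measurable_fun_pair.
- move=> w _; rewrite -EFinM mulrC; apply: le_trans (integral_one_minus_cos_ge _) _.
  by rewrite /g /= (restrict (fun u => 1 - cos (u * (V w - V w')))).
Qed.

End charfun.
End centering.

(** * Small jumps and the Lévy exponent *)

Section small_jumps.
Context {R : realType}.
Variable Pi : {measure set (measurableTypeR R) -> \bar R}.
Local Notation TR := (measurableTypeR R).

(** This is [t] times the integral of [min(x^2 / t, 1)]: the expected sum, over the jumps during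
    time [t], of the truncated squares of the jumps rescaled by [sqrt t]. *)
Definition jump_moment (t : R) : R := \int[Pi]_(x in [set: TR]) Num.min (x ^+ 2) t.

Hypothesis levyPi : levy_measure Pi.

Lemma measurable_truncated_square (a t : R) :
  measurable_fun [set: TR] (fun x : TR => Num.min ((a * (x : R)) ^+ 2) t : R).
Proof.
apply: measurable_minr => //; apply: measurable_funX.
by apply: (@measurable_funM _ _ _ _ (cst a) (@id TR)).
Qed.

Lemma integrable_truncated_square (t : R) : 0 <= t <= 1 ->
  Pi.-integrable [set: TR] (EFin \o (fun x : TR => Num.min ((x : R) ^+ 2) t : R)).
Proof.
move=> /andP[t0 t1].
have mmin s : measurable_fun [set: TR] (fun x : TR => Num.min ((x : R) ^+ 2) s : R).
  by have := measurable_truncated_square 1 s; under eq_fun do rewrite mul1r.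
have [_ fin] := levyPi.
have i1 : Pi.-integrable [set: TR] (EFin \o (fun x : TR => Num.min ((x : R) ^+ 2) 1 : R)).
  apply/integrableP; split; first exact/measurable_EFinP.
  under eq_integral.
    move=> x _; rewrite /= ger0_norm; last by rewrite le_min sqr_ge0 ler01.
    over.
  exact: fin.
apply: le_integrable i1 => //; first exact/measurable_EFinP.
move=> x _ /=; rewrite lee_fin !ger0_norm ?le_min ?sqr_ge0 ?ler01 ?t0 //=.
by rewrite !ge_min lexx t1 orbT.
Qed.

Lemma jump_moment_ge0 t : 0 <= t -> 0 <= jump_moment t.
Proof. by move=> t0; apply: Rintegral_ge0 => x _; rewrite le_min sqr_ge0. Qed.

Lemma one_minus_cos_le_min (x : R) : 1 - cos x <= 2 * Num.min (x ^+ 2) 1.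
Proof.
have h1 := one_minus_cos_le x; have h2 := cos_geN1 x.
have h3 := sqr_ge0 x.
by case: (leP (x ^+ 2) 1) => _; move: h1 h2 h3; lra.
Qed.

(** At the rescaled frequency [v], [t (1 - cos (v x))] is at most twice [min(t v^2 x^2, t)], and
    [t v^2 = u^2 / sigma^2]. The maximum with 1 lets the factor [sigma^-2] leave the minimum. *)
Lemma levy_exponent_re_ge (t sigma u : R) : 0 < t <= 1 -> 0 < sigma -> 0 <= u <= 1 ->
  - (2 * Num.max (sigma ^- 2) 1 * jump_moment t) <=
  t * levy_exponent_re 0 Pi (u * (sigma * Num.sqrt t)^-1).
Proof.
move=> /andP[t0 t1] s0 /andP[u0 u1].
rewrite /levy_exponent_re mul0r mul0r oppr0 add0r.
set v := u * _; set M := Num.max _ _.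
have M0 : 0 < M by rewrite lt_max ltr01 orbT.
have t01 : 0 <= t <= 1 by rewrite ltW.
have key (x : R) : t * (1 - cos (v * x)) <= 2 * M * Num.min (x ^+ 2) t.
  have -> : 2 * M * Num.min (x ^+ 2) t = 2 * (M * Num.min (x ^+ 2) t) by ring.
  apply: (@le_trans _ _ (t * (2 * Num.min ((v * x) ^+ 2) 1))).
    by rewrite ler_pM2l // one_minus_cos_le_min.
  rewrite mulrCA ler_pM2l // (minr_pMr _ _ (ltW t0)) mulr1 (minr_pMr _ _ (ltW M0)).
  have tv : t * (v * x) ^+ 2 = u ^+ 2 * sigma ^- 2 * x ^+ 2.
    have E : (sigma * Num.sqrt t) ^- 2 = sigma ^- 2 * t^-1.
      by rewrite exprMn sqr_sqrtr ?ltW // invfM.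
    rewrite exprMn /v exprMn exprVn E.
    by have t00 : t != 0 by [rewrite gt_eqF]; field; rewrite t00 gt_eqF.
  rewrite tv le_min !ge_min; apply/andP; split; apply/orP.
    left; apply: ler_wpM2r; first exact: sqr_ge0.
    apply: (@le_trans _ _ (sigma ^- 2)); last by rewrite le_max lexx.
    apply: ler_piMl; first by rewrite invr_ge0 sqr_ge0.
    by rewrite expr_le1.
  by right; apply: ler_peMl; [exact: ltW|rewrite le_max lexx orbT].
have imin := integrable_truncated_square t01.
have mcos : measurable_fun [set: TR] (fun x : TR => cos (v * (x : R)) - 1 : R).
  apply: measurable_funB => //.
  apply: (measurableT_comp (continuous_measurable_fun (@continuous_cos R))).
  exact: (@measurable_funM _ _ _ _ (cst v) (@id TR)).
have icos : Pi.-integrable [set: TR] (EFin \o (fun x : TR => cos (v * (x : R)) - 1 : R)).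
  have iM : Pi.-integrable [set: TR]
      (fun x : TR => (2 * M / t)%:E * (Num.min ((x : R) ^+ 2) t)%:E)%E.
    exact: integrableZl.
  apply: le_integrable iM => //; first exact/measurable_EFinP.
  move=> x _ /=; rewrite lee_fin distrC.
  rewrite ger0_norm ?one_minus_cos_ge0 // ger0_norm; last first.
    by rewrite mulr_ge0 ?divr_ge0 ?mulr_ge0 ?le_min ?sqr_ge0 ?ltW.
  have -> : 2 * M / t * Num.min ((x : R) ^+ 2) t = (2 * M * Num.min ((x : R) ^+ 2) t) / t.
    by rewrite mulrAC.
  by rewrite ler_pdivlMr // mulrC key.
rewrite -RintegralZl // /jump_moment -mulNr -RintegralZl //.
apply: le_Rintegral => //.
- rewrite (_ : EFin \o _ = (fun x : TR => (- (2 * M))%:E * (Num.min ((x : R) ^+ 2) t)%:E)%E) //.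
  exact: integrableZl.
- rewrite (_ : EFin \o _ = (fun x : TR => t%:E * (cos (v * (x : R)) - 1)%:E)%E) //.
  exact: (integrableZl measurableT t icos).
- by move=> x _; have := key x; lra.
Qed.

Lemma jump_moment_cvg0 : jump_moment n%:R^-1 @[n --> \oo] --> (0 : R).
Proof.
have inv01 n : 0 <= (n%:R^-1 : R) <= 1.
  rewrite invr_ge0 ler0n /=; case: n => [|n]; first by rewrite invr0.
  by rewrite invf_le1 ?ltr0n // ler1n.
have mmin s : measurable_fun [set: TR] (fun x : TR => Num.min ((x : R) ^+ 2) s : R).
  by have := measurable_truncated_square 1 s; under eq_fun do rewrite mul1r.
have min0 (x t : R) : 0 <= t -> 0 <= Num.min (x ^+ 2) t.
  by move=> t0; rewrite le_min sqr_ge0.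
have inv_cvg : (n%:R^-1 : R) @[n --> \oo] --> (0 : R).
  by rewrite -cvg_shiftS; exact: cvg_harmonic.
have [] := @dominated_convergence _ _ _ Pi setT measurableT
  (fun n (x : TR) => (Num.min ((x : R) ^+ 2) n%:R^-1)%:E) (cst 0%E)
  (fun x : TR => (Num.min ((x : R) ^+ 2) 1)%:E).
- by move=> n; exact/measurable_EFinP.
- exact: measurable_cst.
- apply: aeW => x _; apply: cvg_EFin; first by near=> n.
  apply: (squeeze_cvgr _ (cvg_cst 0) inv_cvg); near=> n.
  by rewrite /= min0 ?invr_ge0 // ge_min lexx orbT.
- by apply: integrable_truncated_square; rewrite ler01 lexx.
- apply: aeW => x n _ /=; have /andP[i0 i1] := inv01 n.
  by rewrite lee_fin ger0_norm ?min0 // le_min !ge_min lexx /= i1 orbT.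
move=> _ _; rewrite integral0 => /fine_cvgP[_]; apply: cvg_trans.
by apply: near_eq_cvg; near=> n.
Unshelve. all: by end_near.
Qed.

(** Interpolation: [min(x^2, t) <= t^(1 - q/2) |x|^q] for small jumps, and [t <= t^(1 - q/2)] for
    the others, whose total mass is finite. *)
Lemma jump_moment_le (q : R) : 0 < q < 2 ->
  (\int[Pi]_(x in [set` `]-1, 1[%R]) (`|x| `^ q)%:E < +oo)%E ->
  exists2 C, 0 <= C & forall t, 0 < t <= 1 -> jump_moment t <= C * t `^ (1 - q / 2).
Proof.
move=> /andP[q0 q2] fin.
pose D : set TR := [set` `]-1, 1[%R].
have mD : measurable D by exact: measurable_itv.
have mpow : measurable_fun [set: TR] (fun x : TR => `|(x : R)| `^ q : R).
  apply: (measurableT_comp (measurable_powR q)).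
  exact: (measurableT_comp (@normr_measurable R setT) (@measurable_id _ TR setT)).
have min0 (x t : R) : 0 <= t -> 0 <= Num.min (x ^+ 2) t.
  by move=> t0; rewrite le_min sqr_ge0.
pose g (x : TR) : R := \1_D x * `|(x : R)| `^ q.
have mg : measurable_fun [set: TR] g.
  by apply: measurable_funM => //; exact: measurable_indic.
have g0 x : 0 <= g x by rewrite /g mulr_ge0 // powR_ge0.
have ig : Pi.-integrable [set: TR] (EFin \o g).
  apply/integrableP; split; first exact/measurable_EFinP.
  rewrite [X in (X < _)%E](_ : _ = \int[Pi]_(x in D) (`|x| `^ q)%:E)%E //.
  rewrite [RHS]integral_mkcond; apply: eq_integral => x _ /=.
  rewrite ger0_norm // patchE /g indicE; case: ifP => _; by rewrite ?mul1r ?mul0r.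
have i1 : Pi.-integrable [set: TR] (EFin \o (fun x : TR => Num.min ((x : R) ^+ 2) 1 : R)).
  by apply: integrable_truncated_square; rewrite ler01 lexx.
have ih : Pi.-integrable [set: TR] (EFin \o (fun x : TR => g x + Num.min ((x : R) ^+ 2) 1 : R)).
  rewrite (_ : EFin \o _ = ((EFin \o g) \+ (EFin \o (fun x : TR => Num.min ((x : R) ^+ 2) 1 : R)%R))%E) //.
  exact: integrableD.
exists (\int[Pi]_(x in [set: TR]) (g x + Num.min ((x : R) ^+ 2) 1)).
  by apply: Rintegral_ge0 => x _; rewrite addr_ge0 ?min0.
move=> t /andP[t0 t1].
rewrite mulrC -RintegralZl //.
apply: le_Rintegral => //.
- by apply: integrable_truncated_square; rewrite ltW.
- rewrite (_ : EFin \o _ = (fun x : TR => (t `^ (1 - q / 2))%:E * (g x + Num.min ((x : R) ^+ 2) 1)%:E)%E) //.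
  exact: (integrableZl measurableT _ ih).
have tpow : t <= t `^ (1 - q / 2).
  rewrite -[leLHS](powRr1 (ltW t0)) ger_powR ?t0 //; move: q0; lra.
move=> x _; set z : R := x; have z2 := sqr_ge0 z.
rewrite /g indicE; case: (boolP (x \in D)) => [/set_mem|]; last first.
  move=> xD; have z1 : 1 <= `|z|.
    rewrite leNgt; apply: contra xD => z1; apply/mem_set.
    by rewrite /D /= in_itv /= -ltr_norml.
  have z21 : 1 <= z ^+ 2 by rewrite -real_normK ?num_real // expr_ge1.
  by rewrite mul0r add0r (min_r z21) mulr1 ge_min tpow orbT.
rewrite /D /= in_itv /= -ltr_norml => z1; rewrite mul1r.
apply: (@le_trans _ _ (t `^ (1 - q / 2) * `|z| `^ q)); last first.
  by rewrite ler_wpM2l ?powR_ge0 // lerDl min0.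
have [z00|z0] := eqVneq z 0.
  by rewrite z00 expr0n /= (min_l (ltW t0)) mulr_ge0 ?powR_ge0.
have az0 : 0 < `|z| by rewrite normr_gt0.
have split (y : R) : 0 < y -> y `^ (1 - q / 2) * y `^ (q / 2) = y.
  move=> y0; rewrite -powRD; last by rewrite (gt_eqF y0) implybT.
  by rewrite subrK powRr1 // ltW.
have zq : `|z| `^ q = (z ^+ 2) `^ (q / 2).
  rewrite -real_normK ?num_real // -powR_mulrn // -powRrM.
  by congr (_ `^ _); field.
have z20 : 0 < z ^+ 2 by rewrite exprn_even_gt0.
rewrite zq; have [zt|tz] := leP (z ^+ 2) t.
  rewrite -[leLHS](split _ z20) ler_wpM2r ?powR_ge0 //.
  by apply: ge0_ler_powR; rewrite ?nnegrE ?(ltW t0) //; move: q2; lra.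
rewrite -[leLHS](split _ t0) ler_wpM2l ?powR_ge0 //.
by apply: ge0_ler_powR; rewrite ?nnegrE ?(ltW t0) ?(ltW tz) //; move: q0; lra.
Qed.

Lemma beta_star_set_nonempty : [set p : R | 0 < p /\
  (\int[Pi]_(x in [set` `]-1, 1[%R]) (`|x| `^ p)%:E < +oo)%E] !=set0.
Proof.
exists 2; split => //; have [_] := levyPi; apply: le_lt_trans.
rewrite integral_mkcond; apply: ge0_le_integral => //.
- by move=> x _; rewrite patchE; case: ifP => // _; rewrite lee_fin powR_ge0.
- have mD : measurable ([set` `]-1, 1[%R] : set TR) by exact: measurable_itv.
  apply/(measurable_restrictT _ mD).
  apply/measurable_EFinP/measurable_funTS.
  apply: (measurableT_comp (measurable_powR 2)).
  exact: (measurableT_comp (@normr_measurable R setT) (@measurable_id _ TR setT)).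
- apply/measurable_EFinP.
  by have := measurable_truncated_square 1 1; under eq_fun do rewrite mul1r.
- move=> x _; rewrite patchE; case: ifP => [/set_mem|_]; last first.
    by rewrite lee_fin le_min sqr_ge0 ler01.
  rewrite /= in_itv /= -ltr_norml => z1.
  rewrite lee_fin powR_mulrn // real_normK ?num_real // le_min lexx /=.
  by rewrite -real_normK ?num_real // expr_le1 // ltW.
Qed.

Lemma beta_star_witness (p : R) : beta_star Pi < p ->
  exists q, [/\ 0 < q, q < p &
    (\int[Pi]_(x in [set` `]-1, 1[%R]) (`|x| `^ q)%:E < +oo)%E].
Proof.
by move=> bp; have [q [q0 fin] qp] := inf_lt beta_star_set_nonempty bp; exists q.
Qed.

Lemma beta_star_ge0 : 0 <= beta_star Pi.
Proof. by apply: lb_le_inf; [exact: beta_star_set_nonempty|move=> q [/ltW]]. Qed.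

Context {d : measure_display} {T : measurableType d}.
Variable P : probability T R.

(** The squared modulus of the characteristic function of [Y t] is the exponential of [2 t] times
    the real part of the exponent, bounded below by its linearisation. The summand [t] is the slack
    for the strict inequality in [centering_of_charfun]. *)
Lemma increment_centering (b sigma t : R) (Y : R -> T -> R) :
  has_levy_triplet P b 0 Pi Y -> 0 < t <= 1 -> 0 < sigma ->
  measurable_fun [set: T] (Y t) ->
  exists c, (\int[P]_w (Num.min ((Y t w / (sigma * Num.sqrt t) - c) ^+ 2) 1)%:E <=
    (24 * (4 * Num.max (sigma ^- 2) 1 * jump_moment t + t))%:E)%E.
Proof.
move=> tri /[dup] t01 /andP[t0 t1] s0 mY.
pose s := (sigma * Num.sqrt t)^-1.
apply: (@centering_of_charfun _ _ _ P (fun w => Y t w / (sigma * Num.sqrt t)) _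
  (4 * Num.max (sigma ^- 2) 1 * jump_moment t)).
- exact: measurable_funM.
- by rewrite ltrDl.
- move=> u u01.
  have assoc w : u * (Y t w / (sigma * Num.sqrt t)) = (u * s) * Y t w.
    by rewrite /s mulrCA mulrC.
  under [X in _ <= X ^+ 2 + _]eq_Rintegral do rewrite assoc.
  under [X in _ <= _ + X ^+ 2]eq_Rintegral do rewrite assoc.
  have t01' : 0 <= t <= 1 by rewrite ltW.
  have [-> ->] := tri t (u * s) t01'.
  rewrite !exprMn -mulrDr cos2Dsin2 mulr1 -expRM_natl.
  have h := levy_exponent_re_ge t01 s0 u01.
  apply: le_trans (expR_ge1Dx _).
  by rewrite mulr_natl mulr2n; move: h; rewrite -/s; lra.
Qed.

End small_jumps.

(** * Dyadic chaining of continuous paths *)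

Section dyadic_chaining.
Context {R : realType}.

Lemma within_continuous_dist (D : set R) (f : R -> R) (t e : R) :
  {within D, continuous f} -> D t -> 0 < e ->
  exists2 delta, 0 < delta & forall s, D s -> `|t - s| < delta -> `|f t - f s| < e.
Proof.
move=> cf Dt e0; have : f x @[x --> within D (nbhs t)] --> f t.
  by rewrite (nbhs_subspace_in Dt); exact: cf.
move=> /cvgrPdist_lt /(_ e e0).
rewrite near_withinE => /nbhs_ballP [delta /= d0 h].
by exists delta => // s Ds ts; exact: h.
Qed.

Definition grid_point (N : nat) (t : R) : R := (Num.truncn (N%:R * t))%:R / N%:R.

Lemma grid_point_itv N t : (0 < N)%N -> 0 <= t ->
  grid_point N t <= t /\ t - grid_point N t < N%:R^-1.
Proof.
move=> N0 t0; have NR : 0 < N%:R :> R by rewrite ltr0n.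
have /andP[h1 h2] : (Num.truncn (N%:R * t))%:R <= N%:R * t < (Num.truncn (N%:R * t)).+1%:R.
  by apply: truncn_itv; rewrite mulr_ge0.
rewrite /grid_point; split; first by rewrite ler_pdivrMr // [t * _]mulrC.
rewrite -(ltr_pM2l NR) mulrBr mulfV ?gt_eqF // [in X in _ - X]mulrC divfK ?gt_eqF //.
by rewrite ltrBlDr -natr1 addrC in h2 *.
Qed.

Lemma grid_point_double N t : (0 < N)%N -> 0 <= t <= 1 ->
  grid_point (N * 2) t = grid_point N t \/
  exists2 j, (j < N * 2)%N & grid_point N t = j%:R / (N * 2)%:R /\
    grid_point (N * 2) t = j.+1%:R / (N * 2)%:R.
Proof.
move=> N0 /andP[t0 t1]; have NR : 0 < N%:R :> R by rewrite ltr0n.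
have x0 : 0 <= N%:R * t by rewrite mulr_ge0.
set k := Num.truncn (N%:R * t).
have /andP[h1 h2] : k%:R <= N%:R * t < k.+1%:R by exact: truncn_itv.
have E : (N * 2)%:R * t = 2 * (N%:R * t) :> R by rewrite natrM; ring.
have dbl : k%:R / N%:R = (k * 2)%:R / (N * 2)%:R :> R.
  by rewrite !natrM; field; rewrite gt_eqF.
rewrite /grid_point -/k; have [h|h] := ltP (2 * (N%:R * t)) (k * 2).+1%:R.
  left; rewrite (@truncn_def _ _ (k * 2)%N) ?dbl // E h andbT natrM; move: h1; lra.
right; exists (k * 2)%N.
  rewrite -(ltr_nat R); move: h; rewrite -natr1 => h.
  apply: (@lt_le_trans _ _ ((k * 2)%:R + 1)); first by rewrite ltrDl.
  apply: le_trans h _; rewrite natrM mulrC ler_pM2r //.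
  by rewrite -[leRHS]mulr1 ler_pM2l.
split => //; rewrite (@truncn_def _ _ (k * 2).+1) // E h /= -!natr1 natrM.
by move: h2; rewrite -natr1; lra.
Qed.

(* The thresholds lam (4/5)^m / 4, m >= 1, add up to lam, while 4/5 > 2^(-1/2) leaves room
   over the typical size of the dyadic increments. *)
Lemma grid_chain (f : R -> R) (n : nat) (lam : R) : (0 < n)%N ->
  (forall m j, (j < n * 2 ^ m.+1)%N ->
    `|f (j.+1%:R / (n * 2 ^ m.+1)%:R) - f (j%:R / (n * 2 ^ m.+1)%:R)| <=
    lam * (4 / 5) ^+ m.+1 / 4) ->
  0 <= lam -> forall t, 0 <= t <= 1 -> forall m,
  `|f (grid_point (n * 2 ^ m) t) - f (grid_point n t)| <= lam * (1 - (4 / 5) ^+ m).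
Proof.
move=> n0 hf lam0 t t01; elim=> [|m IH].
  by rewrite expn0 muln1 subrr normr0 expr0 subrr mulr0.
have N0 : (0 < n * 2 ^ m)%N by rewrite muln_gt0 n0 expn_gt0.
have r0 : 0 <= (4 / 5 : R) ^+ m by apply: exprn_ge0; lra.
have step : `|f (grid_point (n * 2 ^ m.+1) t) - f (grid_point (n * 2 ^ m) t)| <=
    lam * (4 / 5) ^+ m.+1 / 4.
  rewrite expnSr mulnA; case: (grid_point_double N0 t01) => [->|[j jN [-> ->]]].
    by rewrite subrr normr0 !mulr_ge0 // exprn_ge0.
  by rewrite -mulnA -expnSr; apply: hf; rewrite expnSr mulnA.
apply: le_trans (ler_distD (f (grid_point (n * 2 ^ m) t)) _ _) _.
apply: le_trans (lerD step IH) _; rewrite exprS.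
set r := _ ^+ m; have -> : lam * (1 - 4 / 5 * r) =
  lam * (4 / 5 * r) / 4 + lam * (1 - r) by field.
by [].
Qed.

(** The chaining bound is uniform in the level, and continuity at [t] lets the refined grid points
    tend to [t]. *)
Lemma grid_oscillation (f : R -> R) (n : nat) (lam : R) : (0 < n)%N ->
  {within `[0, 1], continuous f} ->
  (forall m j, (j < n * 2 ^ m.+1)%N ->
    `|f (j.+1%:R / (n * 2 ^ m.+1)%:R) - f (j%:R / (n * 2 ^ m.+1)%:R)| <=
    lam * (4 / 5) ^+ m.+1 / 4) ->
  0 <= lam -> forall t, 0 <= t <= 1 -> `|f t - f (grid_point n t)| <= lam.
Proof.
move=> n0 cf hf lam0 t /[dup] t01 /andP[t0 t1]; apply/ler_addgt0Pr => e e0.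
have Dt : (`[0, 1]%classic : set R) t by rewrite /= in_itv /= t0 t1.
have [delta d0 hd] := within_continuous_dist cf Dt e0.
have [m hm] : exists m, ((n * 2 ^ m)%:R^-1 : R) < delta.
  exists (Num.truncn delta^-1); set k := Num.truncn _.
  have kd : delta^-1 < k.+1%:R.
    have di : 0 <= delta^-1 by rewrite invr_ge0 ltW.
    by have /andP[] := truncn_itv di.
  rewrite -(invrK delta) ltf_pV2 ?posrE ?invr_gt0 ?ltr0n ?muln_gt0 ?n0 ?expn_gt0 //.
  apply: lt_le_trans kd _; rewrite ler_nat.
  by apply: leq_trans (ltn_expl k (ltnSn 1)) _; rewrite leq_pmull.
have N0 : (0 < n * 2 ^ m)%N by rewrite muln_gt0 n0 expn_gt0.
have [g1 g2] := grid_point_itv N0 t0.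
have close : `|f t - f (grid_point (n * 2 ^ m) t)| < e.
  apply: hd.
    rewrite /= in_itv /= (le_trans g1 t1) andbT.
    by rewrite /grid_point divr_ge0.
  by rewrite ger0_norm ?subr_ge0 // (lt_trans g2 hm).
apply: le_trans (ler_distD (f (grid_point (n * 2 ^ m) t)) _ _) _.
rewrite addrC lerD ?(ltW close) //.
apply: le_trans (grid_chain n0 hf lam0 t01 m) _.
by rewrite ler_piMr // gerBl exprn_ge0.
Qed.

Lemma geometric_sum_le (theta : R) N : 0 <= theta < 1 ->
  \sum_(i < N) theta ^+ i <= (1 - theta)^-1.
Proof.
move=> /andP[h0 h1]; have d0 : 0 < 1 - theta by rewrite subr_gt0.
suff -> : \sum_(i < N) theta ^+ i = (1 - theta ^+ N) / (1 - theta).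
  by rewrite ler_pdivrMr // mulVf ?gt_eqF // gerBl exprn_ge0.
elim: N => [|N IH]; first by rewrite big_ord0 expr0 subrr mul0r.
by rewrite big_ord_recr /= IH exprSr; field; rewrite gt_eqF.
Qed.

End dyadic_chaining.

(** * Oscillation of Brownian motion between grid points *)

Section brownian_oscillation.
Context {R : realType}.
Local Notation gamma := (@normal_prob R 0 1).

(** From [exp y = (exp (y / k))^k >= (y / k)^k]. Polynomial tails of a free order are easy to sum
    over the dyadic levels. *)
Lemma gauss_kernel_le_pow (k : nat) (x : R) : (0 < k)%N -> 0 < x ->
  gauss_kernel x <= ((2 * k)%:R / x ^+ 2) ^+ k.
Proof.
move=> k0 x0; have kR : 0 < k%:R :> R by rewrite ltr0n.
have x20 : 0 < x ^+ 2 by rewrite exprn_gt0.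
rewrite /gauss_kernel expRN -[leRHS]invrK lef_pV2 ?posrE ?expR_gt0 //; last first.
  by rewrite invr_gt0 exprn_gt0 // divr_gt0 // natrM mulr_gt0.
have -> : x ^+ 2 / 2 = k%:R * (x ^+ 2 / (2 * k)%:R).
  by rewrite natrM; field; rewrite gt_eqF.
rewrite expRM_natl -exprVn invf_div; apply: lerXn2r; rewrite ?nnegrE ?expR_ge0 //.
  by rewrite divr_ge0 // ltW.
by apply: le_trans (expR_ge1Dx _); rewrite lerDr.
Qed.

Lemma measurable_abs_gt (lam : R) :
  measurable ([set x | (lam < `|x|)%R] : set (measurableTypeR R)).
Proof.
rewrite (_ : [set x | _] = (fun x : measurableTypeR R => `|(x : R)| : R) @^-1` `]lam, +oo[%classic).
  by rewrite -[X in measurable X]setTI; exact: (@normr_measurable R setT).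
by apply/seteqP; split => x /=; rewrite in_itv /= andbT.
Qed.

Lemma gamma_abs_tail (M : R) : 0 <= M ->
  (gamma [set x | (M < `|x|)%R] <= (2 * gauss_kernel M)%:E)%E.
Proof.
move=> M0; pose D : set (measurableTypeR R) := [set x | (M < `|x : R|)%R].
have mD : measurable D := measurable_abs_gt M.
have := @gamma_tail_le R M (\1_D) (cst 1) M0.
rewrite integral_gamma_cst1 mule1 integral_gamma_indic //; apply=> //.
- by move=> x xM; rewrite indicE memNset //= => /lt_le_trans/(_ xM); rewrite ltxx.
- by move=> y y0; rewrite !indicE; split; case: (_ \in _).
Qed.

Context {d : measure_display} {T : measurableType d}.
Variable P : probability T R.
Variable W : R -> T -> R.
Hypothesis bmW : standard_brownian_motion P W.

Lemma measurable_brownian_increment (s t : R) : 0 <= s <= 1 -> 0 <= t <= 1 ->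
  measurable_fun [set: T] (incr W s t : T -> measurableTypeR R).
Proof. by case: bmW => [mW _ _ _ _] s01 t01; apply: measurable_funB; exact: mW. Qed.

Lemma brownian_increment_tail (s t lam : R) :
  0 <= s -> s < t -> t <= 1 -> 0 <= lam ->
  (P [set w | (lam < `|incr W s t w|)%R] <=
    (2 * gauss_kernel (lam / Num.sqrt (t - s)))%:E)%E.
Proof.
case: bmW => [_ _ _ law _] s0 st t1 lam0.
have q0 : 0 < Num.sqrt (t - s) by rewrite sqrtr_gt0 subr_gt0.
have mD := measurable_abs_gt lam.
rewrite [X in (X <= _)%E](law s t s0 st t1 _ mD) normal_prob_scale //.
rewrite (_ : _ @^-1` _ = [set x | (lam / Num.sqrt (t - s) < `|x|)%R]).
  by apply: gamma_abs_tail; rewrite divr_ge0 // ltW.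
apply/seteqP; split => x /=; rewrite normrM (gtr0_norm q0) ltr_pdivrMr // mulrC //.
Qed.

Let level_lam (lam : R) (m : nat) : R := lam * (4 / 5) ^+ m.+1 / 4.

Let bad n lam m j := [set w | (level_lam lam m <
  `|incr W (j%:R / (n * 2 ^ m.+1)%:R) (j.+1%:R / (n * 2 ^ m.+1)%:R) w|)%R].

Let level_bad n lam m : set T := \big[setU/set0]_(j < (n * 2 ^ m.+1)%N) bad n lam m j.

Let itv01 (j N : nat) : (j <= N)%N -> (0 < N)%N -> 0 <= (j%:R / N%:R : R) <= 1.
Proof. by move=> jN N0; rewrite divr_ge0 //= ler_pdivrMr ?ltr0n // mul1r ler_nat. Qed.

Let measurable_bad n lam m j : (0 < n)%N -> (j < n * 2 ^ m.+1)%N -> measurable (bad n lam m j).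
Proof.
move=> n0 jN; have N0 : (0 < n * 2 ^ m.+1)%N by exact: leq_ltn_trans jN.
have mi := measurable_brownian_increment (itv01 (ltnW jN) N0) (itv01 jN N0).
have := mi measurableT _ (measurable_abs_gt (level_lam lam m)).
by rewrite setTI.
Qed.

Let measurable_level_bad n lam m : (0 < n)%N -> measurable (level_bad n lam m).
Proof. by move=> n0; apply: bigsetU_measurable => j _; exact: measurable_bad. Qed.

(** A union bound over [n * 2^(m+1)] increments of variance [1 / (n * 2^(m+1))]. The ratio of
    variance to squared threshold decays like [(25/32)^m], as [25/32 = (5/4)^2 / 2], while the
    number of increments doubles; [2 * (25/32)^k < 1] requires [k >= 3]. The factor 32 is 2 from
    [gauss_kernel_le_pow] times the 16 of the squared threshold. *)
Lemma level_bad_le k n lam m : (3 <= k)%N -> (0 < n)%N -> 0 < lam ->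
  (P (level_bad n lam m) <=
   ((2 * (32 * k)%:R ^+ k) * (n%:R * (lam ^+ 2 * n%:R) ^- k) * (2 * (25 / 32) ^+ 3) ^+ m)%:E)%E.
Proof.
move=> k3 n0 lam0; set N := (n * 2 ^ m.+1)%N.
have N0 : (0 < N)%N by rewrite muln_gt0 n0 expn_gt0.
have NR : 0 < N%:R :> R by rewrite ltr0n.
have nR : 0 < n%:R :> R by rewrite ltr0n.
have l0 : 0 < level_lam lam m.
  by rewrite /level_lam !mulr_gt0 // exprn_gt0 //; lra.
apply: le_trans (Boole_inequality P _) _; first by move=> j jN; exact: measurable_bad.
pose B : R := 2 * ((32 * k)%:R / (lam ^+ 2 * n%:R) * (25 / 32) ^+ m.+1) ^+ k.
have one (j : 'I_N) : (P (bad n lam m j) <= B%:E)%E.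
  apply: le_trans (brownian_increment_tail _ _ _ (ltW l0)) _.
  - by have /andP[] := itv01 (ltnW (ltn_ord j)) N0.
  - by rewrite ltr_pM2r ?invr_gt0 // ltr_nat.
  - by have /andP[] := itv01 (ltn_ord j) N0.
  have -> : (j.+1%:R / N%:R - j%:R / N%:R : R) = N%:R^-1 by rewrite -mulrBl -natr1 addrAC subrr add0r mul1r.
  rewrite lee_fin /B ler_pM2l // .
  have s0 : 0 < level_lam lam m / Num.sqrt N%:R^-1 by rewrite divr_gt0 // sqrtr_gt0 invr_gt0.
  apply: le_trans (gauss_kernel_le_pow (leq_trans _ k3) s0) _ => //.
  rewrite le_eqVlt; apply/orP; left; apply/eqP; congr (_ ^+ _).
  rewrite expr_div_n sqr_sqrtr ?invr_ge0 ?ltW // invrK /level_lam /N !natrM natrX.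
  have -> : (25 / 32 : R) ^+ m.+1 = ((4 / 5) ^+ m.+1 * (4 / 5) ^+ m.+1 * 2 ^+ m.+1)^-1.
    by rewrite -!exprMn -exprVn; congr (_ ^+ _); field.
  have r0 : (4 / 5 : R) ^+ m.+1 != 0 by rewrite expf_neq0 //; apply/eqP; lra.
  have q0 : (2 : R) ^+ m.+1 != 0 by rewrite expf_neq0.
  move: r0 q0; set r := _ ^+ _; set q := _ ^+ _ => r0 q0.
  by field; rewrite r0 q0 !gt_eqF.
apply: (@le_trans _ _ (\sum_(j < N) B%:E)%E); first by apply: lee_sum => j _; exact: one.
rewrite sumEFin lee_fin sumr_const card_ord -[_ *+ N]mulr_natr /B.
set th := (25 / 32 : R); set L := lam ^+ 2 * n%:R.
have L0 : 0 < L by rewrite mulr_gt0 // exprn_gt0.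
rewrite 2!exprMn exprVn (_ : N%:R = n%:R * 2 ^+ m.+1); last by rewrite /N natrM natrX.
have thk : (th ^+ m.+1) ^+ k <= (th ^+ 3) ^+ m.+1.
  rewrite -!exprM mulnC; apply: ler_wiXn2l; rewrite ?leq_mul2r ?k3 ?orbT // /th; lra.
apply: (@le_trans _ _ (2 * (32 * k)%:R ^+ k * (n%:R * L ^- k) * ((th ^+ 3) ^+ m.+1 * 2 ^+ m.+1))).
  have -> : 2 * ((32 * k)%:R ^+ k * L ^- k * (th ^+ m.+1) ^+ k) * (n%:R * 2 ^+ m.+1) =
    2 * (32 * k)%:R ^+ k * (n%:R * L ^- k) * ((th ^+ m.+1) ^+ k * 2 ^+ m.+1) by ring.
  apply: ler_wpM2l; last by rewrite ler_pM2r ?exprn_gt0.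
  by rewrite !mulr_ge0 ?exprn_ge0 ?invr_ge0 ?exprn_ge0 ?(ltW nR) ?(ltW L0).
apply: ler_wpM2l.
  by rewrite !mulr_ge0 ?exprn_ge0 ?invr_ge0 ?exprn_ge0 ?(ltW nR) ?(ltW L0).
rewrite -exprMn mulrC exprS; apply: ler_piMl; rewrite ?exprn_ge0 // /th; lra.
Qed.

(** Outside the countable union of bad dyadic events and a null set, [grid_oscillation] covers every
    [t] at once, which bounds the outer measure of an event over uncountably many times. The order
    [k] is left free to reach any polynomial rate. *)
Lemma brownian_oscillation k : (3 <= k)%N ->
  exists2 C, 0 <= C & forall n lam, (0 < n)%N -> 0 < lam ->
  (mu_ext P [set w | exists2 t, (0 <= t <= 1)%R &
      (lam < `|W t w - W (grid_point n t) w|)%R] <=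
    (C * (n%:R * (lam ^+ 2 * n%:R) ^- k))%:E)%E.
Proof.
move=> k3; pose th : R := 2 * (25 / 32) ^+ 3.
have th01 : 0 <= th < 1 by rewrite /th; lra.
exists (2 * (32 * k)%:R ^+ k * (1 - th)^-1).
  by rewrite !mulr_ge0 ?exprn_ge0 // invr_ge0; case/andP: th01; lra.
move=> n lam n0 lam0; set K := n%:R * _.
have K0 : 0 <= K by rewrite /K mulr_ge0 // invr_ge0 exprn_ge0 // mulr_ge0 // sqr_ge0.
have [_ _ _ _ [N [mN PN hN]]] := bmW.
pose A := \bigcup_m level_bad n lam m.
have mA : measurable A by apply: bigcupT_measurable => m; exact: measurable_level_bad.
have PA : (P A <= (2 * (32 * k)%:R ^+ k * (1 - th)^-1 * K)%:E)%E.
  apply: le_trans (measure_sigma_subadditive P (fun m => measurable_level_bad lam m n0) mA (@subset_refl _ _)) _.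
  apply: lime_le; first exact: is_cvg_nneseries.
  apply: nearW => M.
  apply: (@le_trans _ _ (\sum_(0 <= m < M) (2 * (32 * k)%:R ^+ k * K * th ^+ m)%:E)%E).
    by apply: lee_sum => m _; exact: level_bad_le.
  rewrite sumEFin lee_fin -mulr_sumr big_mkord.
  have -> : 2 * (32 * k)%:R ^+ k * (1 - th)^-1 * K = 2 * (32 * k)%:R ^+ k * K * (1 - th)^-1 by ring.
  apply: ler_wpM2l; last exact: geometric_sum_le.
  by apply: mulr_ge0 => //; apply: mulr_ge0 => //; exact: exprn_ge0.
apply: (@le_trans _ _ (mu_ext P (A `|` N))); last first.
  rewrite measurable_mu_extE; last exact: measurableU.
  apply: le_trans PA; apply: le_trans (measureU2 _ mA mN) _.
  by rewrite [X in (_ + X)%E](_ : _ = 0%E) ?adde0.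
apply: le_mu_ext => w [t t01 osc]; apply: contrapT => wAN.
have wN : ~ N w by move=> h; apply: wAN; right.
have wA : ~ A w by move=> h; apply: wAN; left.
have cW : {within `[0%R, 1%R], continuous (W ^~ w)} by apply: contrapT => h; apply: wN; exact: hN.
suff : `|W t w - W (grid_point n t) w| <= lam by rewrite leNgt osc.
apply: (@grid_oscillation _ (W ^~ w) n lam n0 cW _ (ltW lam0) t t01) => m j jN.
rewrite leNgt; apply/negP => h.
apply: wA; exists m => //; rewrite /level_bad -bigcup_mkord; exists j => //.
Qed.

End brownian_oscillation.

(** * Events of a process and almost sure absence of ties *)

Section process_sigma_algebra.
Context {d : measure_display} {T : measurableType d} {R : realType}.

Lemma sigma_of_process_incr (V : R -> T -> R) (s t : R) (A : set (measurableTypeR R)) :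
  0 <= s <= 1 -> 0 <= t <= 1 -> measurable A ->
  sigma_of_process V (incr V s t @^-1` A).
Proof.
move=> s01 t01 mA; rewrite /sigma_of_process.
set G := [set E | _].
have mV u : 0 <= u <= 1 ->
    measurable_fun [set: g_sigma_algebraType G] (V u : g_sigma_algebraType G -> measurableTypeR R).
  by move=> u01 _ B mB; rewrite setTI; apply: sub_sigma_algebra; exists u, B.
have mVst := measurable_funB (mV t t01) (mV s s01).
by have := mVst measurableT _ mA; rewrite setTI.
Qed.

Lemma sigma_of_process_bigcap (V : R -> T -> R) (n : nat) (E : nat -> set T) :
  (forall i, (i < n)%N -> sigma_of_process V (E i)) ->
  sigma_of_process V (\bigcap_(i < n) E i).
Proof.
rewrite /sigma_of_process; set G := [set E | _] => mE.
apply: (@fin_bigcap_measurable _ (g_sigma_algebraType G) _ `I_n E); first exact: finite_II.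
by move=> i; exact: mE.
Qed.

Variable P : probability T R.

Lemma ae_iff_measure_le (E F : set T) : measurable E -> measurable F ->
  (\forall w \ae P, E w -> F w) -> (P E <= P F)%E.
Proof.
move=> mE mF [N [mN PN hN]].
apply: (@le_trans _ _ (P (F `|` N))).
  apply: le_measure; [exact: mem_set|exact/mem_set/measurableU|].
  move=> w Ew; have [Fw|nF] := pselect (F w); [by left|right; apply: hN => /= h].
  exact: nF (h Ew).
by apply: le_trans (measureU2 _ mF mN) _; rewrite [X in (_ + X)%E](_ : _ = 0%E) ?adde0.
Qed.

Lemma measurable_eq_set (U V : T -> R) :
  measurable_fun [set: T] U -> measurable_fun [set: T] V ->
  measurable [set w | U w = V w].
Proof.
move=> mU mV; rewrite (_ : [set w | _] = (fun w => U w - V w) @^-1` [set 0]).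
  by rewrite -[X in measurable X]setTI; exact: (measurable_funB mU mV).
apply/seteqP; split => w /=; first by move=> ->; rewrite subrr.
by move/eqP; rewrite subr_eq0 => /eqP.
Qed.

(** With [V] frozen at a value, an independent [U] without atoms hits that value with probability
    zero. *)
Lemma ties_null (U V : T -> R) :
  measurable_fun [set: T] (U : T -> measurableTypeR R) ->
  measurable_fun [set: T] (V : T -> measurableTypeR R) ->
  independent_pair P (V : T -> measurableTypeR R) (U : T -> measurableTypeR R) ->
  (forall c, P [set w | U w = c] = 0) -> P [set w | U w = V w] = 0.
Proof.
move=> mU mV VU U0.
pose D : set (measurableTypeR R * measurableTypeR R) := [set z | (z.2 : R) - z.1 = 0].
have mD : measurable D.
  have md : measurable_fun setT (fun z : measurableTypeR R * measurableTypeR R => (z.2 : R) - z.1 : R).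
    by apply: measurable_funB; [exact: measurable_snd|exact: measurable_fst].
  have := md measurableT [set 0] (measurable_set1 0); rewrite setTI.
  by congr measurable; apply/seteqP; split.
pose f (z : measurableTypeR R * measurableTypeR R) : \bar R := (\1_D z)%:E.
have mf : measurable_fun setT f by apply/measurable_EFinP; exact: measurable_indic.
have mE := measurable_eq_set mU mV.
have mc c : measurable [set w | U w = c].
  by have := mU measurableT [set c] (measurable_set1 c); rewrite setTI.
transitivity (\int[P]_w f (V w, U w))%E.
  rewrite -[in LHS](setIT [set w | U w = V w]) -(integral_indic P measurableT mE).
  apply: eq_integral => w _; rewrite /f !indicE; congr ((nat_of_bool _)%:R%:E).
  apply/idP/idP => /set_mem /= h; apply/mem_set; rewrite /D /=; first by rewrite h subrr.
  by apply/eqP; rewrite -subr_eq0; apply/eqP.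
rewrite (integral_independent (f := f) mV mU VU mf); last by move=> z; rewrite lee_fin.
transitivity (\int[P]_w (0 : \bar R))%E; last exact: integral0.
apply: eq_integral => w _.
rewrite -(U0 (V w)) -[in RHS](setIT [set w' | U w' = V w]) -(integral_indic P measurableT (mc (V w))).
apply: eq_integral => w' _; rewrite /f !indicE; congr ((nat_of_bool _)%:R%:E).
apply/idP/idP => /set_mem /= h; apply/mem_set; rewrite /D /=; last by rewrite h subrr.
by apply/eqP; rewrite -subr_eq0; apply/eqP.
Qed.

Lemma ae_injective (n : nat) (f : 'I_n -> T -> R) :
  (forall i, measurable_fun [set: T] (f i)) ->
  (forall i j, i != j -> P [set w | f i w = f j w] = 0) ->
  \forall w \ae P, injective (f ^~ w).
Proof.
move=> mf neq.
have : \forall w \ae P, forall i j : 'I_n, i != j -> f i w <> f j w.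
  apply: filter_forall => i; apply: filter_forall => j.
  have [->|ij] := eqVneq i j; first exact: aeW.
  exists [set w | f i w = f j w]; split; last 2 first.
  - exact: neq.
  - by move=> w /= h; apply: contrapT => h'; apply: h => _.
  - exact: measurable_eq_set.
apply: filterS => w h i j hij; apply: contrapT => /eqP ij; exact: (h i j ij).
Qed.

End process_sigma_algebra.

(** * Joint law of the normalised increments *)

Section normalized_increments.
Context {d : measure_display} {T : measurableType d} {R : realType}.
Variable P : probability T R.
Local Notation gamma := (@normal_prob R 0 1).
Local Notation TR := (measurableTypeR R).

Variables (X Y W : R -> T -> R) (sigma : R).
Hypothesis hX : forall t w, 0 <= t <= 1 -> X t w = Y t w + sigma * W t w.
Hypothesis levyX : levy_process P X.
Hypothesis sigma0 : 0 < sigma.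
Hypothesis bmW : standard_brownian_motion P W.
Hypothesis levyY : levy_process P Y.
Hypothesis indYW : independent_processes P Y W.
Variables (n : nat) (c : R).
Hypothesis n0 : (0 < n)%N.

Let scale : R := Num.sqrt n%:R^-1.

Definition noise (i : 'I_n) (w : T) : R := grid_incr W w i / scale.
Definition jumps (i : 'I_n) (w : T) : R := grid_incr Y w i / (sigma * scale) - c.
Definition sample (w : T) : 'I_n -> R * R := fun i => (noise i w, jumps i w).

Let scale0 : 0 < scale.
Proof. by rewrite sqrtr_gt0 invr_gt0 ltr0n. Qed.

(** [independent_increments] quantifies over infinite sequences of times in [0, 1]; stopping the
    grid at 1 provides one without changing the first [n] steps. *)
Let tau (k : nat) : R := Num.min (k%:R / n%:R) 1.

Let tau01 k : 0 <= tau k <= 1.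
Proof. by rewrite /tau le_min ge_min lexx orbT ler01 divr_ge0. Qed.

Let tauE k : (k <= n)%N -> tau k = k%:R / n%:R.
Proof. by move=> kn; rewrite /tau min_l // ler_pdivrMr ?ltr0n // mul1r ler_nat. Qed.

Let tau_nd : nondecreasing_seq tau.
Proof.
move=> k l kl; rewrite /tau le_min !ge_min lexx orbT andbT; apply/orP; left.
by rewrite ler_pM2r ?invr_gt0 ?ltr0n // ler_nat.
Qed.

Let grid_incrE (V : R -> T -> R) (i : 'I_n) w : grid_incr V w i = incr V (tau i) (tau i.+1) w.
Proof. by rewrite /grid_incr /incr !tauE // ltnW. Qed.

Lemma grid_incr_processE w i :
  grid_incr X w i = sigma * scale * (noise i w + jumps i w + c).
Proof.
rewrite /noise /jumps !grid_incrE /incr !hX //.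
by field; rewrite !gt_eqF.
Qed.

Let mprocW : measurable_process W. Proof. by case: bmW. Qed.
Let mprocY : measurable_process Y. Proof. by case: levyY. Qed.

Let mgrid (V : R -> T -> R) (i : 'I_n) : measurable_process V ->
  measurable_fun [set: T] (fun w => grid_incr V w i).
Proof.
move=> mV; under eq_fun do rewrite grid_incrE.
by apply: measurable_funB; exact: mV.
Qed.

Lemma measurable_noise i : measurable_fun [set: T] (noise i).
Proof. by apply: measurable_funM => //; exact: mgrid. Qed.

Lemma measurable_jumps i : measurable_fun [set: T] (jumps i).
Proof. by apply: measurable_funB => //; apply: measurable_funM => //; exact: mgrid. Qed.

(** Extends a family indexed by ['I_n] to one indexed by [nat] with the whole line as default, the
    form [independent_rvs] expects. *)
Let extend (A : 'I_n -> set TR) (k : nat) : set TR := oapp A [set: TR] (insub k).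

Let measurable_extend A k : (forall i, measurable (A i)) -> measurable (extend A k).
Proof. by move=> mA; rewrite /extend; case: insub => //=. Qed.

Let extendE A (i : 'I_n) : extend A i = A i.
Proof. by rewrite /extend valK. Qed.

Let grid_law (V : R -> T -> R) (A : 'I_n -> set TR) : independent_increments P V ->
  (forall i, measurable (A i)) ->
  P (\bigcap_(i < n) (incr V (tau i) (tau i.+1) @^-1` extend A i)) =
  (\prod_(i < n) P ((fun w => grid_incr V w i) @^-1` A i))%E.
Proof.
move=> indV mA; rewrite (indV n tau tau01 tau_nd); last by move=> i; exact: measurable_extend.
apply: eq_bigr => i _; rewrite extendE.
by have -> : (fun w => grid_incr V w i) = incr V (tau i) (tau i.+1)
  by apply/funext => w; rewrite grid_incrE.
Qed.

Let joint_law (A B : 'I_n -> set TR) :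
  (forall i, measurable (A i)) -> (forall i, measurable (B i)) ->
  P [set w | forall i, A i (grid_incr W w i) /\ B i (grid_incr Y w i)] =
  (\prod_(i < n) (P ((fun w => grid_incr W w i) @^-1` A i) *
     P ((fun w => grid_incr Y w i) @^-1` B i)))%E.
Proof.
move=> mA mB.
have [_ _ indW _ _] := bmW; have [_ _ indY _ _] := levyY.
rewrite big_split /= -!grid_law //.
rewrite -[RHS]muleC -indYW; last 2 first.
- apply: sigma_of_process_bigcap => i _; apply: sigma_of_process_incr => //.
  exact: measurable_extend.
- apply: sigma_of_process_bigcap => i _; apply: sigma_of_process_incr => //.
  exact: measurable_extend.
congr (P _); apply/seteqP; split => w /=.
  move=> h; split => k /= kn; have [h1 h2] := h (Ordinal kn).
    by rewrite -(extendE B) grid_incrE in h2.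
  by rewrite -(extendE A) grid_incrE in h1.
move=> [hB hA] i; rewrite !grid_incrE -(extendE A) -(extendE B).
by split; [exact: (hA i (ltn_ord i))|exact: (hB i (ltn_ord i))].
Qed.

Let affine_preimage (a b : R) (A : set TR) : measurable A ->
  measurable ((fun x : TR => (x : R) / a - b : TR) @^-1` A).
Proof.
move=> mA; have mf : measurable_fun [set: TR] (fun x : TR => (x : R) / a - b : R).
  by apply: measurable_funB => //; apply: (@measurable_funM _ _ _ _ (@id TR) (cst a^-1)).
by rewrite -[X in measurable X]setTI; exact: mf.
Qed.

Lemma noise_law i (A : set TR) : measurable A -> P (noise i @^-1` A) = gamma A.
Proof.
move=> mA; have [_ _ _ law _] := bmW.
have mA' : measurable ((fun x : TR => (x : R) / scale : TR) @^-1` A).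
  have := affine_preimage scale 0 mA.
  by rewrite (_ : (fun x : TR => _) = (fun x : TR => (x : R) / scale : TR)) //; apply/funext => x; rewrite subr0.
have st : tau i < tau i.+1.
  by rewrite !tauE ?(ltnW (ltn_ord i)) // ltr_pM2r ?invr_gt0 ?ltr0n // ltr_nat.
have /andP[s0 _] := tau01 i; have /andP[_ t1] := tau01 i.+1.
transitivity (P (incr W (tau i) (tau i.+1) @^-1` ((fun x : TR => (x : R) / scale : TR) @^-1` A))).
  by congr (P _); apply/seteqP; split => w; rewrite /noise /= grid_incrE.
rewrite (law _ _ s0 st t1 _ mA').
have -> : tau i.+1 - tau i = n%:R^-1.
  by rewrite !tauE ?(ltnW (ltn_ord i)) // -mulrBl -natr1 addrAC subrr add0r mul1r.
rewrite -/scale normal_prob_scale //; congr (gamma _).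
by apply/seteqP; split => x; rewrite /= [scale * x]mulrC mulfK ?gt_eqF.
Qed.

Lemma jumps_law i (B : set TR) : measurable B ->
  P (jumps i @^-1` B) =
  P ((fun w => Y n%:R^-1 w / (sigma * scale) - c) @^-1` B).
Proof.
move=> mB; have [_ Y0 _ stat _] := levyY.
have mB' := affine_preimage (sigma * scale) c mB.
have inv01 : 0 <= (n%:R^-1 : R) <= 1.
  by rewrite invr_ge0 ler0n invf_le1 ?ltr0n // ler1n.
have E : tau i.+1 = tau i + n%:R^-1.
  by rewrite !tauE ?(ltnW (ltn_ord i)) // -natr1 mulrDl mul1r.
have /andP[s0 _] := tau01 i; have /andP[_ t1] := tau01 i.+1.
transitivity (P (incr Y (tau i) (tau i + n%:R^-1) @^-1`
    ((fun x : TR => (x : R) / (sigma * scale) - c : TR) @^-1` B))).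
  by congr (P _); apply/seteqP; split => w; rewrite /jumps /= grid_incrE E.
have inv0 : 0 <= n%:R^-1 :> R by case/andP: inv01.
rewrite E in t1; rewrite (stat _ _ s0 inv0 t1 _ mB').
have mY t : 0 <= t <= 1 -> measurable_fun [set: T] (fun w => Y t w / (sigma * scale) - c).
  by move=> t01; apply: measurable_funB => //; apply: measurable_funM => //; exact: mprocY.
have mYi : measurable_fun [set: T] (incr Y 0 n%:R^-1 : T -> TR).
  by apply: measurable_funB; apply: mprocY; rewrite ?lexx ?ler01.
have mY1 := mY _ inv01.
have mE : measurable (incr Y 0 n%:R^-1 @^-1`
    ((fun x : TR => (x : R) / (sigma * scale) - c : TR) @^-1` B)).
  by rewrite -[X in measurable X]setTI; exact: mYi.
have mF : measurable ((fun w => Y n%:R^-1 w / (sigma * scale) - c) @^-1` B).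
  by rewrite -[X in measurable X]setTI; exact: mY1.
apply/eqP; rewrite eq_le; apply/andP; split; apply: ae_iff_measure_le => //;
  apply: filterS Y0 => w Y0w; by rewrite /= /incr Y0w subr0.
Qed.

Lemma sample_law (A B : 'I_n -> set TR) :
  (forall i, measurable (A i)) -> (forall i, measurable (B i)) ->
  P (sample @^-1` pair_box A B) =
  (\prod_i (gamma (A i) * P ((fun w => Y n%:R^-1 w / (sigma * scale) - c)%R @^-1` B i)))%E.
Proof.
move=> mA mB; pose A' i := (fun x : TR => (x : R) / scale - 0 : TR) @^-1` A i.
pose B' i := (fun x : TR => (x : R) / (sigma * scale) - c : TR) @^-1` B i.
have := @joint_law A' B' (fun i => affine_preimage _ _ (mA i)) (fun i => affine_preimage _ _ (mB i)).
have -> : [set w | forall i, A' i (grid_incr W w i) /\ B' i (grid_incr Y w i)] =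
    sample @^-1` pair_box A B.
  by apply/seteqP; split => w /= h i; have := h i; rewrite /A' /B' /noise /jumps /= subr0.
move=> ->; apply: eq_bigr => i _; rewrite -(noise_law i (mA i)) -(jumps_law i (mB i)).
congr (P _ * P _)%E; apply/seteqP; split => w; by rewrite /A' /noise /= subr0.
Qed.

Lemma iid_noise : iid_normal_sample P noise.
Proof.
split=> [i|A mA]; first exact: measurable_noise.
have [_ _ indW _ _] := bmW.
pose pre i := (fun x : TR => (x : R) / scale - 0 : TR) @^-1` A i.
have noiseE i : noise i @^-1` A i = (fun w => grid_incr W w i) @^-1` pre i.
  by apply/seteqP; split => w; rewrite /pre /noise /= subr0.
have := grid_law indW (fun i => affine_preimage scale 0 (mA i)); rewrite -/pre => law.
transitivity (\prod_(i < n) P ((fun w => grid_incr W w i) @^-1` pre i))%E.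
  rewrite -law; congr (P _); apply/seteqP; split => w h.
    move=> k /= kn; have := h (Ordinal kn) I; rewrite noiseE.
    by rewrite -[k]/(nat_of_ord (Ordinal kn)) extendE -grid_incrE.
  by move=> i _; rewrite noiseE /= grid_incrE -extendE; exact: (h i (ltn_ord i)).
by apply: eq_bigr => i _; rewrite -noiseE noise_law.
Qed.

Let pair_law (i j : 'I_n) (A B : set TR) : measurable A -> measurable B ->
  P (noise i @^-1` A `&` jumps j @^-1` B) = (P (noise i @^-1` A) * P (jumps j @^-1` B))%E.
Proof.
move=> mA mB.
pose A' k := if k == i then A else [set: TR]; pose B' k := if k == j then B else [set: TR].
have mA' k : measurable (A' k) by rewrite /A'; case: ifP.
have mB' k : measurable (B' k) by rewrite /B'; case: ifP.
transitivity (P (sample @^-1` pair_box A' B')).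
  congr (P _); apply/seteqP; split => w /=.
    by move=> [h1 h2] k; rewrite /A' /B'; split; case: eqP => [->|].
  move=> h; split; first by have [] := h i; rewrite /A' eqxx.
  by have [_] := h j; rewrite /B' eqxx.
rewrite sample_law // big_split /= noise_law // jumps_law //; congr (_ * _)%E.
  rewrite (bigD1 i) //= /A' eqxx big1 ?mule1 // => k /negPf ->.
  by rewrite probability_setT.
rewrite (bigD1 j) //= /B' eqxx big1 ?mule1 // => k /negPf ->.
by rewrite preimage_setT [LHS](_ : _ = 1%E) //; exact: probability_setT.
Qed.

Let gamma_set1 (x : R) : gamma [set x] = 0%E.
Proof.
have /null_content_dominatesP dom := @normal_prob_dominates R 0 1.
by apply: dom; [exact: measurable_set1|exact: lebesgue_measure_set1].
Qed.

Lemma noise_injective : \forall w \ae P, injective (noise ^~ w).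
Proof.
apply: ae_injective => [|i j ij]; first exact: measurable_noise.
apply: ties_null.
- exact: measurable_noise.
- exact: measurable_noise.
- move=> A B mA mB; have [_ law] := iid_noise.
  pose C k := if k == j then A else if k == i then B else [set: TR].
  have mC k : measurable (C k) by rewrite /C; case: ifP => // _; case: ifP.
  transitivity (P (\bigcap_(k in setT) noise k @^-1` C k)).
    congr (P _); apply/seteqP; split => w /=.
      by move=> [h1 h2] k _; rewrite /C /=; case: eqP => [->//|_]; case: eqP => [->|].
    move=> h; split; first by have := h j I; rewrite /C eqxx.
    by have := h i I; rewrite /C (negPf ij) eqxx.
  rewrite law // (bigD1 j) // (bigD1 i) //= /C eqxx (negPf ij) eqxx.
  rewrite !noise_law // muleA big1 ?mule1 // => k /andP[/negPf -> /negPf ->].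
  exact: probability_setT.
- move=> x; transitivity (gamma [set x]); last exact: gamma_set1.
  by rewrite -(noise_law i (measurable_set1 x)).
Qed.

Let perturbedE i w : noise i w + jumps i w = grid_incr X w i / (sigma * scale) - c.
Proof. by rewrite grid_incr_processE mulrC mulKf ?mulf_neq0 ?gt_eqF // addrK. Qed.

(** [noise + jumps] is an affine image of the increment of [X], so independence across indices is
    read off from the Lévy property of [X]. *)
Let perturbed_pair_law (i j : 'I_n) (A B : set TR) : i != j -> measurable A -> measurable B ->
  let x k w := noise k w + jumps k w in
  P (x j @^-1` A `&` x i @^-1` B) = (P (x j @^-1` A) * P (x i @^-1` B))%E.
Proof.
move=> ij mA mB x; have [_ _ indX _ _] := levyX.
pose pre (A : set TR) := (fun x : TR => (x : R) / (sigma * scale) - c : TR) @^-1` A.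
have xE k (D : set TR) : x k @^-1` D = (fun w => grid_incr X w k) @^-1` pre D.
  by apply/seteqP; split => w; rewrite /pre /x /= perturbedE.
pose C k := if k == j then pre A else if k == i then pre B else [set: TR].
have mC k : measurable (C k).
  by rewrite /C; case: ifP => [_|_]; [exact: affine_preimage|case: ifP => // _; exact: affine_preimage].
have := grid_law indX mC.
rewrite (bigD1 j) // (bigD1 i) //= big1 ?mule1; last first.
  move=> k /andP[/negPf ki /negPf kj]; rewrite /C ki kj.
  exact: probability_setT.
rewrite {2 3}/C eqxx (negPf ij) eqxx -!xE => <-.
congr (P _); apply/seteqP; split => w.
  move=> [h1 h2] k /= kn; rewrite xE /= in h1; rewrite xE /= in h2.
  rewrite -[k]/(nat_of_ord (Ordinal kn)) extendE -grid_incrE /C.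
  by case: eqP => [->//|_]; case: eqP => [->|].
move=> h; split; rewrite xE /= grid_incrE.
  by have := h j (ltn_ord j); rewrite /= extendE /C eqxx.
by have := h i (ltn_ord i); rewrite /= extendE /C (negPf ij) eqxx.
Qed.

(** The sum at one index has no atoms because [noise i] has none and is independent of [jumps i];
    sums at different indices are independent, so ties are null. *)
Lemma perturbed_injective : \forall w \ae P, injective (fun i => noise i w + jumps i w).
Proof.
have mx i : measurable_fun [set: T] (fun w => noise i w + jumps i w).
  by apply: measurable_funD; [exact: measurable_noise|exact: measurable_jumps].
apply: (@ae_injective _ _ _ P n (fun i w => noise i w + jumps i w)) => [|i j ij]; first exact: mx.
apply: ties_null; [exact: mx|exact: mx|by move=> A B mA mB; exact: perturbed_pair_law|].
move=> x.
rewrite (_ : [set w | _] = [set w | noise i w = x - jumps i w]); last first.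
  by apply/seteqP; split => w /=; [move=> <-; rewrite addrK|move=> ->; rewrite subrK].
apply: (@ties_null _ _ _ P (noise i) (fun w => x - jumps i w)).
- exact: measurable_noise.
- by apply: measurable_funB => //; exact: measurable_jumps.
- move=> A B mA mB.
  have mA' : measurable ((fun y : TR => x - (y : R) : TR) @^-1` A).
    have mf : measurable_fun [set: TR] (fun y : TR => x - (y : R) : R) by exact: measurable_funB.
    by rewrite -[X in measurable X]setTI; exact: mf.
  by rewrite setIC muleC -(pair_law i i mB mA').
- move=> y; transitivity (gamma [set y]); last exact: gamma_set1.
  by rewrite -(noise_law i (measurable_set1 y)).
Qed.

End normalized_increments.

(** * Score errors of the sample and the deviation process *)

Section score_errors.
Context {R : realType}.

Definition score_error (n : nat) (i : 'I_n) (f : pair_vectors n) : R :=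
  (f i).1 - normal_score n (rank (fun j => (f j).1 + (f j).2) i).

Lemma measurable_score_error n (i : 'I_n) :
  measurable_fun [set: pair_vectors n] (score_error i).
Proof.
apply: measurable_funB; first exact: measurable_coord1.
apply: (@measurable_rank_comp _ _ _ _ (fun j (f : pair_vectors n) => (f j).1 + (f j).2)) => j.
by apply: measurable_funD; [exact: measurable_coord1|exact: measurable_coord2].
Qed.

Lemma score_error_perm n (s : {perm 'I_n}) (i : 'I_n) (f : 'I_n -> R * R) :
  score_error i (f \o s : pair_vectors n) = score_error (s i) f.
Proof.
rewrite /score_error; congr (_ - normal_score n _).
exact: (@rank_perm _ _ (fun j => (f j).1 + (f j).2)).
Qed.

Context {d : measure_display} {T : measurableType d}.
Variable P : probability T R.
Local Notation gamma := (@normal_prob R 0 1).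
Local Notation TR := (measurableTypeR R).

Lemma integral_same_law (U V : T -> TR) (f : TR -> \bar R) :
  measurable_fun [set: T] U -> measurable_fun [set: T] V ->
  (forall A, measurable A -> P (U @^-1` A) = P (V @^-1` A)) ->
  measurable_fun [set: TR] f -> (forall x, 0 <= f x)%E ->
  (\int[P]_w f (U w) = \int[P]_w f (V w))%E.
Proof.
move=> mU mV UV mf f0.
pose m' : {measure set TR -> \bar R} := pushforward P V.
pose m := m' mV.
rewrite (integral_law (m := m) mU) //; first by rewrite (integral_law (m := m) mV).
Qed.

Lemma measurable_norm_ge (f : T -> R) (lam : R) : measurable_fun [set: T] f ->
  measurable [set w | lam <= `|f w|].
Proof.
move=> mf; rewrite (_ : [set w | _] = (fun w => `|f w|) @^-1` `[lam, +oo[%classic).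
  by rewrite -[X in measurable X]setTI; exact: (measurableT_comp (@normr_measurable R setT) mf).
by apply/seteqP; split => w; rewrite /= in_itv /= andbT.
Qed.

Variables (X Y W : R -> T -> R) (sigma : R).
Hypothesis hX : forall t w, 0 <= t <= 1 -> X t w = Y t w + sigma * W t w.
Hypothesis levyX : levy_process P X.
Hypothesis sigma0 : 0 < sigma.
Hypothesis bmW : standard_brownian_motion P W.
Hypothesis levyY : levy_process P Y.
Hypothesis indYW : independent_processes P Y W.

Section sum_bound.
Variables (n : nat) (c K M : R).
Hypothesis n0 : (0 < n)%N.
Hypothesis centered_jump :
  (\int[P]_w (Num.min ((Y n%:R^-1 w / (sigma * Num.sqrt n%:R^-1) - c) ^+ 2) 1)%:E <= K%:E)%E.
Hypothesis M1 : 1 <= M.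

Let Z w : pair_vectors n := sample Y W sigma c w.
Let xi : 'I_n -> T -> R := fun i => noise W i.
Let zeta : 'I_n -> T -> R := fun i => jumps Y sigma c i.

Let mxi i : measurable_fun [set: T] (xi i).
Proof. exact: (measurable_noise bmW n0). Qed.

Let mzeta i : measurable_fun [set: T] (zeta i).
Proof. exact: (measurable_jumps sigma levyY c n0). Qed.

Let min0 (z : R) : 0 <= Num.min (z ^+ 2) 1.
Proof. by rewrite le_min sqr_ge0 ler01. Qed.

(** Integrates [rank_score_error], which requires samples without ties and hence holds almost
    everywhere. The factor 24 is 12 times the 2 of the two Gaussian tails. *)
Lemma sum_score_error_le (m2 C5 : R) :
  (\int[gamma]_x (x ^+ 2 : R)%:E <= m2%:E)%E ->
  (forall i : 'I_n, \int[P]_w ((xi i w - normal_score n (rank (xi ^~ w) i)) ^+ 2)%:E <=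
    (C5 * (log_scale n + 1) ^+ 5 / n.+1%:R)%:E)%E ->
  (\int[P]_w (\sum_i score_error i (Z w) ^+ 2)%:E <=
   (n%:R * (24 * m2 * gauss_kernel M + 48 * M ^+ 2 * K +
     4 * (C5 * (log_scale n + 1) ^+ 5 / n.+1%:R)))%:E)%E.
Proof.
move=> hm2 hC5.
have M0 : 0 <= M by exact: le_trans M1.
have mD i : measurable_fun [set: T] (fun w => score_error i (Z w)).
  apply: measurable_funB; first exact: mxi.
  apply: (@measurable_rank_comp _ _ _ _ (fun j w => xi j w + zeta j w)) => j.
  exact: measurable_funD.
have mexc i : measurable_fun [set: T] (fun w => excess M (xi i w) ^+ 2).
  by apply: measurable_funX; exact: (measurableT_comp (measurable_excess M) (mxi i)).
have mmin i : measurable_fun [set: T] (fun w => Num.min (zeta i w ^+ 2) 1).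
  by apply: measurable_minr => //; exact: measurable_funX.
have msc i : measurable_fun [set: T] (fun w => (xi i w - normal_score n (rank (xi ^~ w) i)) ^+ 2).
  apply: measurable_funX; apply: measurable_funB; first exact: mxi.
  exact: (@measurable_rank_comp _ _ _ _ xi).
pose g i w := 12 * excess M (xi i w) ^+ 2 + 48 * M ^+ 2 * Num.min (zeta i w ^+ 2) 1 +
  4 * (xi i w - normal_score n (rank (xi ^~ w) i)) ^+ 2.
have g0 i w : 0 <= g i w.
  by apply: addr_ge0; [apply: addr_ge0|]; apply: mulr_ge0 => //; rewrite ?sqr_ge0 // mulr_ge0 ?sqr_ge0.
have mg i : measurable_fun [set: T] (g i).
  by apply: measurable_funD; [apply: measurable_funD|]; exact: measurable_funM.
apply: (@le_trans _ _ (\int[P]_w (\sum_i g i w)%:E)%E).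
  apply: ae_ge0_le_integral => //.
  - by move=> w _; rewrite lee_fin sumr_ge0 // => i _; exact: sqr_ge0.
  - by apply/measurable_EFinP; apply: measurable_sum => i; exact: measurable_funX.
  - by move=> w _; rewrite lee_fin sumr_ge0.
  - by apply/measurable_EFinP; apply: measurable_sum.
  have h1 := noise_injective bmW n0.
  have h2 := perturbed_injective hX levyX sigma0 bmW levyY indYW c n0.
  apply: filterS2 h1 h2 => w h1 h2 _; rewrite lee_fin.
  apply: (rank_score_error M1 h1 h2) => k /andP[k0 kn].
  by apply: normal_score_le; rewrite ?k0 ?kn ?ltnS // ltnW.
rewrite (_ : (fun w => (\sum_i g i w)%:E) = (fun w => \sum_i (g i w)%:E)%E); last first.
  by apply/funext => w; rewrite sumEFin.
rewrite ge0_integral_sum //; last 2 first.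
- by move=> i; exact/measurable_EFinP.
- by move=> i w _; rewrite lee_fin.
set B := 24 * m2 * _ + _ + _.
have -> : (n%:R * B)%:E = (\sum_(i < n) B%:E)%E by rewrite sumEFin sumr_const card_ord mulr_natl.
apply: lee_sum => i _; rewrite /B.
have iexc : (\int[P]_w (excess M (xi i w) ^+ 2)%:E <= (2 * gauss_kernel M * m2)%:E)%E.
  rewrite (@integral_law _ _ _ P _ TR (xi i) gamma (fun x => (excess M x ^+ 2)%:E)) //.
  - apply: le_trans (integral_excess M0) _; rewrite [leRHS]EFinM; apply: lee_wpmul2l => //.
    by rewrite lee_fin mulr_ge0 // ltW // gauss_kernel_gt0.
  - exact: mxi.
  - by move=> A mA; exact: (noise_law bmW n0).
  - by apply/measurable_EFinP; apply: measurable_funX; exact: measurable_excess.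
  - by move=> x; rewrite lee_fin sqr_ge0.
have imin : (\int[P]_w (Num.min (zeta i w ^+ 2) 1)%:E <= K%:E)%E.
  apply: le_trans centered_jump.
  have inv01 : 0 <= (n%:R^-1 : R) <= 1.
    by rewrite invr_ge0 ler0n invf_le1 ?ltr0n // ler1n.
  rewrite (@integral_same_law (zeta i) (fun w => Y n%:R^-1 w / (sigma * Num.sqrt n%:R^-1) - c)
    (fun x : TR => (Num.min ((x : R) ^+ 2) 1)%:E)) //.
  - exact: mzeta.
  - apply: measurable_funB => //; apply: measurable_funM => //.
    by have [mY _ _ _ _] := levyY; exact: mY.
  - by move=> A mA; exact: (jumps_law sigma levyY c n0).
  - by apply/measurable_EFinP; apply: measurable_minr => //; exact: (@measurable_funX _ TR _ _ id).
rewrite /g (_ : (fun w => _%:E) = (fun w => 12%:E * (excess M (xi i w) ^+ 2)%:E +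
  (48 * M ^+ 2)%:E * (Num.min (zeta i w ^+ 2) 1)%:E +
  4%:E * ((xi i w - normal_score n (rank (xi ^~ w) i)) ^+ 2)%:E)%E) //.
have e1 w : [set: T] w -> (0 <= 12%:E * (excess M (xi i w) ^+ 2)%:E)%E.
  by move=> _; rewrite -EFinM lee_fin mulr_ge0 // sqr_ge0.
have e2 w : [set: T] w -> (0 <= (48 * M ^+ 2)%:E * (Num.min (zeta i w ^+ 2) 1)%:E)%E.
  by move=> _; rewrite -EFinM lee_fin !mulr_ge0 // sqr_ge0.
have e3 w : [set: T] w -> (0 <= 4%:E * ((xi i w - normal_score n (rank (xi ^~ w) i)) ^+ 2)%:E)%E.
  by move=> _; rewrite -EFinM lee_fin mulr_ge0 // sqr_ge0.
have em (a : R) (h : T -> R) : measurable_fun [set: T] h ->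
    measurable_fun [set: T] (fun w => a%:E * (h w)%:E)%E.
  by move=> mh; under eq_fun do rewrite -EFinM; apply/measurable_EFinP; exact: measurable_funM.
rewrite ge0_integralD; [|by []|by move=> w Tw; apply: adde_ge0; [exact: e1|exact: e2]
  |by apply: emeasurable_funD; exact: em|exact: e3|exact: em].
rewrite ge0_integralD; [|by []|exact: e1|exact: em|exact: e2|exact: em].
have scal (a : R) (h : T -> R) : 0 <= a -> measurable_fun [set: T] h -> (forall w, 0 <= h w) ->
    (\int[P]_w (a%:E * (h w)%:E) = a%:E * \int[P]_w (h w)%:E)%E.
  by move=> a0 mh h0; rewrite ge0_integralZl_EFin //; [move=> w _; rewrite lee_fin|exact/measurable_EFinP].
have M20 : 0 <= 48 * M ^+ 2 by rewrite mulr_ge0 // sqr_ge0.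
rewrite (scal _ _ _ (mexc i)) //; last by move=> w; exact: sqr_ge0.
rewrite (scal _ _ M20 (mmin i)) // (scal _ _ _ (msc i)) //; last by move=> w; exact: sqr_ge0.
rewrite [leRHS]EFinD; apply: leeD; first (rewrite [leRHS]EFinD; apply: leeD).
- have -> : 24 * m2 * gauss_kernel M = 12 * (2 * gauss_kernel M * m2) by ring.
  by rewrite (EFinM 12); apply: lee_wpmul2l.
- by rewrite (EFinM (48 * M ^+ 2)); apply: lee_wpmul2l => //; rewrite lee_fin mulr_ge0 // sqr_ge0.
- by rewrite (EFinM 4); apply: lee_wpmul2l => //; exact: hC5.
Qed.

End sum_bound.

Section deviation.
Variables (n : nat) (c : R).
Hypothesis n0 : (0 < n)%N.

Let Z w : pair_vectors n := sample Y W sigma c w.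
Let scale : R := Num.sqrt n%:R^-1.

Let scale0 : 0 < scale. Proof. by rewrite sqrtr_gt0 invr_gt0 ltr0n. Qed.
Let nR : 0 < n%:R :> R. Proof. by rewrite ltr0n. Qed.

Lemma brownian_grid_sum w k : (k <= n)%N -> W 0 w = 0 ->
  W (k%:R / n%:R) w = scale * \sum_(i < n | (i < k)%N) noise W i w.
Proof.
move=> kn W0; rewrite mulr_sumr.
rewrite (eq_bigr (fun i : 'I_n => W (i.+1%:R / n%:R) w - W (i%:R / n%:R) w)); last first.
  by move=> i _; rewrite /noise /grid_incr mulrC divfK // gt_eqF.
rewrite -(@big_ord_widen _ _ _ k n (fun i => W (i.+1%:R / n%:R) w - W (i%:R / n%:R) w)) //.
rewrite -(big_mkord xpredT (fun i => W (i.+1%:R / n%:R) w - W (i%:R / n%:R) w)).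
by rewrite (telescope_sumr (fun i => W (i%:R / n%:R) w)) // mul0r W0 subr0.
Qed.

(** The increments of [X] are an increasing affine function of [noise + jumps], so they have the
    same ranks whatever the recentring [c]. *)
Lemma rank_process_scaled w t : rank_process X n t w =
  scale * \sum_(i < n | (i < Num.truncn (n%:R * t))%N)
    normal_score n (rank (fun j : 'I_n => noise W j w + jumps Y sigma c j w) i).
Proof.
rewrite /rank_process; congr (_ * _).
  by rewrite powRN powR12_sqrt // /scale sqrtrV.
apply: eq_bigr => i _; rewrite /normal_score; congr (std_normal_quantile (_%:R / _)).
apply: eq_rank => j; rewrite !(grid_incr_processE hX sigma0 c n0).
by rewrite ler_pM2l ?mulr_gt0 // lerD2r.
Qed.

Definition deviation (t : R) (w : T) : R :=
  W t w - rank_process X n t w - (W 1 w - rank_process X n 1 w) * t.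

Lemma truncn_grid_le (t : R) : 0 <= t <= 1 -> (Num.truncn (n%:R * t) <= n)%N.
Proof.
move=> /andP[t0 t1]; have x0 : 0 <= n%:R * t by rewrite mulr_ge0.
have /andP[h _] := truncn_itv x0.
by rewrite -(ler_nat R); apply: le_trans h _; rewrite ler_piMr.
Qed.

Lemma deviation_decomposition w t : W 0 w = 0 -> 0 <= t <= 1 ->
  let k := Num.truncn (n%:R * t) in
  deviation t w = (W t w - W (grid_point n t) w) +
    scale * (centered_psum (@score_error n) k (Z w) +
      (k%:R / n%:R - t) * \sum_i score_error i (Z w)).
Proof.
move=> W0 /andP[t0 t1] k.
have kn : (k <= n)%N by apply: truncn_grid_le; rewrite t0 t1.
have part m : (m <= n)%N -> W (m%:R / n%:R) w - rank_process X n (m%:R / n%:R) w =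
    scale * \sum_(i < n | (i < m)%N) score_error i (Z w).
  move=> mn; rewrite brownian_grid_sum // rank_process_scaled.
  have -> : Num.truncn (n%:R * (m%:R / n%:R) : R) = m.
    by rewrite mulrC divfK ?gt_eqF // natrK.
  by rewrite -mulrBr -sumrB.
have rk : rank_process X n t w = rank_process X n (k%:R / n%:R) w.
  by rewrite /rank_process [n%:R * (_ / _)]mulrC divfK ?gt_eqF // natrK.
have one : W 1 w - rank_process X n 1 w = scale * \sum_i score_error i (Z w).
  have := part n (leqnn n); rewrite divff ?gt_eqF // => ->; congr (_ * _).
  by apply: eq_bigl => i; rewrite ltn_ord.
have := part k kn; rewrite -rk => E.
have Ek : centered_psum (@score_error n) k (Z w) =
    \sum_(i < n | (i < k)%N) score_error i (Z w) - k%:R * ((\sum_i score_error i (Z w)) / n%:R).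
  rewrite /centered_psum /centered sumrB; congr (_ - _).
  by rewrite -(@big_ord_widen _ _ _ k n (fun=> (\sum_j score_error j (Z w)) / n%:R)) //
    sumr_const card_ord mulr_natl.
rewrite /deviation one Ek /grid_point -/k.
move: E; set A := \sum_(i < n | _) _; set S := \sum_i _; set b := W (_ / _) w => E.
have -> : rank_process X n t w = b - scale * A by rewrite -E opprB addrC subrK.
by field; rewrite gt_eqF.
Qed.

Let mDZ i : measurable_fun [set: T] (fun w => score_error i (Z w)).
Proof.
apply: measurable_funB; first exact: (measurable_noise bmW n0).
apply: (@measurable_rank_comp _ _ _ _ (fun j w => noise W j w + jumps Y sigma c j w)) => j.
by apply: measurable_funD; [exact: (measurable_noise bmW n0)|exact: (measurable_jumps _ levyY _ n0)].
Qed.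

Lemma sqr_sum_le (D : 'I_n -> R) : (\sum_i D i) ^+ 2 <= n%:R * \sum_i D i ^+ 2.
Proof.
set S := \sum_i D i.
have : 0 <= \sum_i (D i - S / n%:R) ^+ 2 by apply: sumr_ge0 => i _; exact: sqr_ge0.
have -> : \sum_i (D i - S / n%:R) ^+ 2 = \sum_i D i ^+ 2 - S ^+ 2 / n%:R.
  have -> : \sum_i (D i - S / n%:R) ^+ 2 =
      \sum_i D i ^+ 2 + (- (2 * S / n%:R)) * (\sum_i D i) + (S / n%:R) ^+ 2 *+ n.
    rewrite mulr_sumr -[n in _ ^+ 2 *+ n]card_ord -sumr_const -!big_split.
    by apply: eq_bigr => i _ /=; ring.
  by rewrite -/S -mulr_natr; field; rewrite gt_eqF.
by rewrite subr_ge0 ler_pdivrMr // mulrC.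
Qed.

Let sumsq w := \sum_i score_error i (Z w) ^+ 2.

Let msumsq : measurable_fun [set: T] sumsq.
Proof. by apply: measurable_sum => i; exact: measurable_funX. Qed.

(** Markov and Cauchy-Schwarz. They would allow a further factor [1/n], given up so that the bound
    has the shape of the maximal inequality. *)
Lemma total_error_tail (lam : R) : 0 < lam ->
  (P [set w | (lam * n%:R <= `|\sum_i score_error i (Z w)|)%R] <=
   (lam ^- 2)%:E * \int[P]_w (sumsq w)%:E)%E.
Proof.
move=> lam0.
have mS : measurable_fun [set: T] (fun w => \sum_i score_error i (Z w)) by exact: measurable_sum.
set E := [set w | _].
have mE : measurable E := measurable_norm_ge _ mS.
rewrite -ge0_integralZl_EFin //; last 3 first.
- by move=> w _; rewrite lee_fin sumr_ge0 // => i _; exact: sqr_ge0.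
- exact/measurable_EFinP.
- by rewrite invr_ge0 sqr_ge0.
rewrite -[E in leLHS](setIT E) -(integral_indic P measurableT mE).
apply: ge0_le_integral => //.
- by apply/measurable_EFinP; exact: measurable_indic.
- by under eq_fun do rewrite -EFinM; apply/measurable_EFinP; exact: measurable_funM.
move=> w _; rewrite -EFinM lee_fin indicE; case: (boolP (w \in E)) => [/set_mem Ew|_]; last first.
  by rewrite mulr_ge0 ?invr_ge0 ?sqr_ge0 // sumr_ge0 // => i _; exact: sqr_ge0.
rewrite mulrC ler_pdivlMr ?exprn_gt0 // mul1r.
have h : (lam * n%:R) ^+ 2 <= n%:R * sumsq w.
  apply: le_trans (sqr_sum_le _); rewrite -[leRHS]real_normK ?num_real //.
  by rewrite lerXn2r ?nnegrE // mulr_ge0 // ltW.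
have h2 : n%:R * (lam ^+ 2 * n%:R) <= n%:R * sumsq w by apply: le_trans h; rewrite exprMn; lra.
move: h2; rewrite ler_pM2l // => h2; apply: le_trans h2.
by rewrite ler_peMr ?sqr_ge0 // ler1n.
Qed.

(** Each of the three terms of the decomposition gets a third of [a], and [lam] is that third
    divided by [scale]. The maximal inequality contributes 64 and the rounding term 1, and
    [lam^2 = a^2 n / 9], whence [585 = 65 * 9]. *)
Lemma deviation_tail (a : R) : 0 < a ->
  (mu_ext P [set w | exists2 t, (0 <= t <= 1)%R & (a < `|deviation t w|)%R] <=
   mu_ext P [set w | exists2 t, (0 <= t <= 1)%R &
      (a / 3 < `|W t w - W (grid_point n t) w|)%R] +
   (585 / (a ^+ 2 * n%:R))%:E * \int[P]_w (sumsq w)%:E)%E.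
Proof.
move=> a0; set O := [set w | exists2 t, _ & (a / 3 < _)%R].
pose lam := a / 3 / scale.
have lam0 : 0 < lam by rewrite !divr_gt0.
pose E2 := [set w | exists2 k, (k <= n)%N & lam <= `|centered_psum (@score_error n) k (Z w)|].
pose E3 := [set w | lam * n%:R <= `|\sum_i score_error i (Z w)|].
have [_ [N [mN PN hN]] _ _ _] := bmW.
have mZ1 i : measurable_fun [set: T] (fun w => (Z w i).1) by exact: (measurable_noise bmW n0).
have mZ2 i : measurable_fun [set: T] (fun w => (Z w i).2) by exact: (measurable_jumps _ levyY _ n0).
have mE2 : measurable E2.
  rewrite (_ : E2 = \bigcup_(k in `I_n.+1)
    [set w | lam <= `|centered_psum (@score_error n) k (Z w)|]); last first.
    by apply/seteqP; split => w [k kn h]; exists k.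
  apply: bigcup_measurable => k _; apply: measurable_norm_ge.
  apply: measurable_sum_cond => i; apply: measurable_funB => //.
  by apply: measurable_funM => //; exact: measurable_sum.
have mE3 : measurable E3 by apply: measurable_norm_ge; exact: measurable_sum.
have PE2 : (P E2 <= (64 / lam ^+ 2)%:E * \int[P]_w (sumsq w)%:E)%E.
  apply: (@exchangeable_maximal _ _ _ P n (sample Y W sigma c) mZ1 mZ2 (fun A B => gamma A *
      P ((fun w => Y n%:R^-1 w / (sigma * Num.sqrt n%:R^-1) - c)%R @^-1` B))%E _ (@score_error n)) => //.
  - by move=> A B mA mB; exact: (sample_law sigma bmW levyY indYW c n0 mA mB).
  - by move=> i; exact: measurable_score_error.
  - by move=> s i f; exact: score_error_perm.
have PE3 := total_error_tail lam0.
have lamE : 65 / lam ^+ 2 = 585 / (a ^+ 2 * n%:R).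
  rewrite /lam /scale !expr_div_n sqr_sqrtr ?invr_ge0 //.
  by field; rewrite !gt_eqF.
apply: (@le_trans _ _ (mu_ext P (O `|` (E2 `|` (E3 `|` N))))).
  apply: le_mu_ext => w [t t01 dev].
  have [W0|W0] := pselect (W 0 w = 0); last by right; right; right; apply: hN.
  have := deviation_decomposition W0 t01; set k := Num.truncn _ => /= dE.
  have [/andP[t0 t1]] := t01.
  have kn : (k <= n)%N by exact: truncn_grid_le.
  have [h1|h1] := ltP (a / 3) `|W t w - W (grid_point n t) w|; first by left; exists t.
  have [h2|h2] := leP lam `|centered_psum (@score_error n) k (Z w)|; first by right; left; exists k.
  have [h3|h3] := leP (lam * n%:R) `|\sum_i score_error i (Z w)|; first by right; right; left.
  exfalso; move: dev; rewrite ltNge dE => /negP; apply.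
  apply: le_trans (ler_normD _ _) _.
  have kt : `|k%:R / n%:R - t| <= n%:R^-1.
    have [g1 g2] := grid_point_itv n0 t0.
    by rewrite distrC ger0_norm ?subr_ge0 // ltW.
  have h : `|scale * (centered_psum (@score_error n) k (Z w) +
      (k%:R / n%:R - t) * \sum_i score_error i (Z w))| <= scale * (lam + lam).
    rewrite normrM (gtr0_norm scale0) ler_pM2l //; apply: le_trans (ler_normD _ _) _.
    apply: lerD; first exact: ltW.
    rewrite normrM; apply: (@le_trans _ _ (n%:R^-1 * (lam * n%:R))).
      by apply: ler_pM => //; exact: ltW.
    by rewrite mulrCA mulVf ?mulr1 // gt_eqF.
  apply: le_trans (lerD h1 h) _; rewrite /lam.
  have -> : scale * (a / 3 / scale + a / 3 / scale) = a / 3 + a / 3 by field; rewrite gt_eqF.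
  by lra.
apply: le_trans (outer_measureU2 (mu_ext P : {outer_measure set T -> \bar R}) _ _) _.
apply: leeD => //; rewrite [leLHS]measurable_mu_extE; last first.
  by apply: measurableU => //; exact: measurableU.
apply: le_trans (measureU2 _ mE2 (measurableU _ _ mE3 mN)) _.
apply: (@le_trans _ _ (P E2 + P E3)%E).
  apply: leeD => //; apply: le_trans (measureU2 _ mE3 mN) _.
  by rewrite [X in (_ + X)%E](_ : _ = 0%E) ?adde0.
apply: le_trans (leeD PE2 PE3) _.
rewrite -ge0_muleDl ?lee_fin ?divr_ge0 ?invr_ge0 ?sqr_ge0 // -EFinD -lamE.
by have -> : 64 / lam ^+ 2 + lam ^- 2 = 65 / lam ^+ 2 by field; rewrite gt_eqF.
Qed.

End deviation.
End score_errors.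

(** * Rates of the error terms *)

Section rates.
Context {R : realType}.

Lemma powR_neg_small (s delta : R) : 0 < s -> 0 < delta ->
  exists N, forall n, (N < n)%N -> n%:R `^ (- s) <= delta.
Proof.
move=> s0 d0; pose x := delta^-1 `^ s^-1.
have x0 : 0 <= x by exact: powR_ge0.
exists (Num.truncn x) => n xn.
have nx : x <= n%:R.
  have /andP[_ /ltW h] := truncn_itv x0; apply: le_trans h _.
  by rewrite ler_nat.
have nR : 0 < n%:R :> R by rewrite ltr0n; case: n xn {nx}.
rewrite powRN -(invrK delta) lef_pV2 ?posrE ?invr_gt0 ?powR_gt0 //.
have -> : delta^-1 = x `^ s.
  by rewrite /x -powRrM mulVf ?gt_eqF // powRr1 // invr_ge0 ltW.
by apply: ge0_ler_powR; rewrite ?nnegrE // ltW.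
Qed.

Lemma ln_le_powR (a x : R) : 0 < a -> 1 <= x -> ln x <= x `^ a / a.
Proof.
move=> a0 x1; have x0 : 0 < x by exact: lt_le_trans x1.
rewrite ler_pdivlMr // /powR (gt_eqF x0) mulrC.
by apply: le_trans (expR_ge1Dx _); rewrite lerDr.
Qed.

Lemma log_scale_growth (eta : R) : 0 < eta ->
  exists2 C, 0 <= C & forall n, (0 < n)%N -> (log_scale n + 1) ^+ 5 <= C * n%:R `^ eta.
Proof.
(* The fifth power is raised to the sixth, the cube of a square of order [ln (n + 1)]; each of the
   three logarithms may then cost the power [eta / 3]. The factor [2^eta] replaces [n + 1] by
   [2 n]. *)
move=> e0; pose a := eta / 3; have a0 : 0 < a by rewrite divr_gt0.
have a40 : 0 <= 4 / a + 2 by rewrite addr_ge0 // divr_ge0 // ltW.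
exists ((4 / a + 2) ^+ 3 * 2 `^ eta); first by rewrite mulr_ge0 ?powR_ge0 ?exprn_ge0.
move=> n n0; set L := log_scale n; have L0 : 0 <= L by exact: log_scale_ge0.
have x1 : 1 <= n.+1%:R :> R by rewrite ler1n.
have xa1 : 1 <= n.+1%:R `^ a by rewrite -[leLHS](powRr0 n.+1%:R); apply: ler_powR => //; exact: ltW.
have L2 : L ^+ 2 = 2 * ln n.+1%:R.
  by rewrite /L /log_scale sqr_sqrtr // mulr_ge0 // ln_ge0.
have lnx := ln_le_powR a0 x1.
have step : (L + 1) ^+ 2 <= (4 / a + 2) * n.+1%:R `^ a.
  have h : 0 <= (L - 1) ^+ 2 by exact: sqr_ge0.
  have h2 : (L + 1) ^+ 2 <= 2 * L ^+ 2 + 2 by rewrite -subr_ge0; apply: le_trans h _; rewrite le_eqVlt; apply/orP; left; apply/eqP; ring.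
  apply: le_trans h2 _; rewrite L2 [leRHS]mulrDl.
  by apply: lerD; [move: lnx; lra|move: xa1; lra].
have L11 : 1 <= L + 1 by rewrite lerDr.
apply: (@le_trans _ _ ((L + 1) ^+ 6)); first exact: ler_weXn2l.
rewrite (exprM _ 2 3).
apply: (@le_trans _ _ (((4 / a + 2) * n.+1%:R `^ a) ^+ 3)).
  by apply: lerXn2r => //; rewrite nnegrE ?sqr_ge0 // mulr_ge0 // powR_ge0.
rewrite exprMn -[leRHS]mulrA; apply: ler_wpM2l; first exact: exprn_ge0.
have -> : (n.+1%:R `^ a) ^+ 3 = n.+1%:R `^ eta.
  by rewrite -powR_mulrn ?powR_ge0 // -powRrM /a divfK.
rewrite -powRM //; apply: ge0_ler_powR; rewrite ?nnegrE ?(ltW e0) //.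
by rewrite -natrM ler_nat mul2n -addnn -addn1 leq_add2l.
Qed.

(** With [M = log_scale n + 1] the Gaussian tail is below [1/(n + 1)], and [M^2] is only
    logarithmic. *)
Lemma error_rate_subcritical (p q c1 c2 c3 c4 : R) (J : nat -> R) :
  0 < q -> q < p -> p < 2 ->
  0 <= c1 -> 0 <= c2 -> 0 <= c3 -> 0 <= c4 ->
  (forall n, (0 < n)%N -> J n <= c4 * (n%:R^-1) `^ (1 - q / 2)) ->
  forall delta, 0 < delta -> exists N, forall n, (N < n)%N -> exists2 M, 1 <= M &
    n%:R `^ (1 - p / 2) * (c1 * gauss_kernel M + c2 * M ^+ 2 * (J n + n%:R^-1) +
      c3 * (log_scale n + 1) ^+ 5 / n.+1%:R) <= delta.
Proof.
move=> q0 qp p2 h1 h2 h3 h4 hJ delta d0.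
(* The jump term has order [n^(-(p - q)/2) = n^(-2 s)] up to logarithms; these are allowed the power
   [n^s], so [n^(-s)] remains. The other two terms are no larger because [q > 0]. *)
pose s := (p - q) / 4; have s0 : 0 < s by rewrite divr_gt0 // subr_gt0.
have [C C0 hC] := log_scale_growth s0.
pose D := c1 + c2 * C * (c4 + 1) + c3 * C + 1.
have D0 : 0 < D.
  rewrite /D; apply: ltr_wpDl => //; apply: addr_ge0; last exact: mulr_ge0.
  by apply: addr_ge0 => //; rewrite !mulr_ge0 // addr_ge0.
have [N hN] := powR_neg_small s0 (divr_gt0 d0 D0).
exists N => n Nn; have n0 : (0 < n)%N by exact: leq_ltn_trans Nn.
have nR : 0 < n%:R :> R by rewrite ltr0n.
have n1 : 1 <= n%:R :> R by rewrite ler1n.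
have L0 := @log_scale_ge0 R n; set L := log_scale n in L0 *.
have L11 : 1 <= L + 1 by rewrite lerDr.
exists (L + 1) => //.
have pw x y : n%:R `^ x * n%:R `^ y = n%:R `^ (x + y) :> R.
  by rewrite -powRD // (gt_eqF nR) implybT.
have pmono x y : x <= y -> n%:R `^ x <= n%:R `^ y :> R by move=> xy; rewrite ler_powR.
have ninv : n%:R^-1 = n%:R `^ (-1) :> R by rewrite powR_inv1 // ltW.
have nSinv : n.+1%:R^-1 <= n%:R `^ (-1) :> R.
  by rewrite -ninv lef_pV2 ?posrE // ler_nat.
set Rn := n%:R `^ (1 - p / 2).
have Rn0 : 0 <= Rn by exact: powR_ge0.
have t1 : Rn * (c1 * gauss_kernel (L + 1)) <= c1 * n%:R `^ (- s).
  rewrite mulrCA; apply: ler_wpM2l => //.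
  apply: (@le_trans _ _ (Rn * n%:R `^ (-1))); last by rewrite pw; apply: pmono; rewrite /s; lra.
  apply: ler_wpM2l => //; apply: le_trans nSinv; rewrite -gauss_kernel_log_scale -/L.
  rewrite /gauss_kernel ler_expR lerN2 ler_pM2r // lerXn2r ?nnegrE ?lerDl //.
  exact: le_trans L11.
have Lsq : (L + 1) ^+ 2 <= C * n%:R `^ s by apply: le_trans (hC n n0); exact: ler_weXn2l.
have t2 : Rn * (c2 * (L + 1) ^+ 2 * (J n + n%:R^-1)) <= c2 * C * (c4 + 1) * n%:R `^ (- s).
  have Jn : J n + n%:R^-1 <= (c4 + 1) * n%:R `^ (- (1 - q / 2)).
    rewrite mulrDl mul1r; apply: lerD; last by rewrite ninv; apply: pmono; lra.
    by apply: le_trans (hJ n n0) _; rewrite ninv -powRrM mulN1r.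
  apply: (@le_trans _ _ (Rn * (c2 * (C * n%:R `^ s) * ((c4 + 1) * n%:R `^ (- (1 - q / 2)))))).
    apply: ler_wpM2l => //.
    apply: (@le_trans _ _ (c2 * (L + 1) ^+ 2 * ((c4 + 1) * n%:R `^ (- (1 - q / 2))))).
      by apply: ler_wpM2l => //; rewrite mulr_ge0 // sqr_ge0.
    apply: ler_wpM2r; last exact: ler_wpM2l.
    by rewrite mulr_ge0 ?powR_ge0 // addr_ge0.
  have -> : Rn * (c2 * (C * n%:R `^ s) * ((c4 + 1) * n%:R `^ (- (1 - q / 2)))) =
    c2 * C * (c4 + 1) * (Rn * n%:R `^ s * n%:R `^ (- (1 - q / 2))) by ring.
  apply: ler_wpM2l; first by rewrite !mulr_ge0 // addr_ge0.
  by rewrite !pw; apply: pmono; rewrite /s; lra.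
have t3 : Rn * (c3 * (L + 1) ^+ 5 / n.+1%:R) <= c3 * C * n%:R `^ (- s).
  apply: (@le_trans _ _ (Rn * (c3 * (C * n%:R `^ s) * n%:R `^ (-1)))).
    apply: ler_wpM2l => //; apply: ler_pM => //.
    - by rewrite mulr_ge0 // exprn_ge0 // (le_trans _ L11).
    - by apply: ler_wpM2l => //; exact: hC.
  have -> : Rn * (c3 * (C * n%:R `^ s) * n%:R `^ (-1)) =
    c3 * C * (Rn * n%:R `^ s * n%:R `^ (-1)) by ring.
  apply: ler_wpM2l; first exact: mulr_ge0.
  by rewrite !pw; apply: pmono; rewrite /s; lra.
rewrite [Rn * _]mulrDr [Rn * (_ + _)]mulrDr.
apply: (@le_trans _ _ (D * n%:R `^ (- s))).
  have ns0 : 0 <= n%:R `^ (- s) :> R by exact: powR_ge0.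
  apply: le_trans (lerD (lerD t1 t2) t3) _.
  by rewrite -!mulrDl; apply: ler_wpM2r => //; rewrite lerDl.
by rewrite mulrC -ler_pdivlMr // hN.
Qed.

(** Here [M] depends on [delta] only, so that mere convergence of [J] to 0 makes the middle term
    small. *)
Lemma error_rate_critical (c1 c2 c3 : R) (J : nat -> R) :
  0 <= c1 -> 0 <= c2 -> 0 <= c3 -> J n @[n --> \oo] --> 0 ->
  forall delta, 0 < delta -> exists N, forall n, (N < n)%N -> exists2 M, 1 <= M &
    c1 * gauss_kernel M + c2 * M ^+ 2 * (J n + n%:R^-1) +
      c3 * (log_scale n + 1) ^+ 5 / n.+1%:R <= delta.
Proof.
move=> h1 h2 h3 hJ delta d0.
have d3 : 0 < delta / 3 by rewrite divr_gt0.
(* [gauss_kernel M <= 2 / M^2 <= 2 / M], so this [M] brings the Gaussian tail term below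
   [delta / 3]. *)
pose M := 6 * c1 / delta + 1.
have M1 : 1 <= M by rewrite lerDr divr_ge0 ?mulr_ge0 // ltW.
have M0 : 0 < M by exact: lt_le_trans M1.
have t1 : c1 * gauss_kernel M <= delta / 3.
  apply: (@le_trans _ _ (c1 * (2 / M))).
    apply: ler_wpM2l => //; apply: le_trans (gauss_kernel_le_pow (ltnSn 0) M0) _.
    rewrite expr1 muln1; apply: ler_wpM2l => //.
    by rewrite lef_pV2 ?posrE ?exprn_gt0 // ler_eXnr.
  rewrite mulrA ler_pdivrMr // /M.
  have -> : delta / 3 * (6 * c1 / delta + 1) = c1 * 2 + delta / 3 by field; rewrite gt_eqF.
  by rewrite lerDl ltW.
have [C C0 hC] := log_scale_growth (divr_gt0 (@ltr01 R) (ltr0Sn R 1)).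
have half0 : 0 < 2^-1 :> R by rewrite invr_gt0.
have c30 : 0 < c3 * C + 1 by rewrite ltr_wpDl // mulr_ge0.
have [N1 hN1] := powR_neg_small half0 (divr_gt0 d3 c30).
have c2M : 0 < c2 * M ^+ 2 + 1 by rewrite ltr_wpDl // mulr_ge0 // sqr_ge0.
pose e := delta / 3 / (c2 * M ^+ 2 + 1) / 2.
have e0 : 0 < e by rewrite !divr_gt0.
have [N2 _ hN2] : \forall n \near \oo, `|0 - J n| <= e.
  by move/cvgrPdist_le : hJ => /(_ e e0).
have [N3 hN3] := powR_neg_small ltr01 e0.
exists (maxn N1 (maxn N2 N3)) => n; rewrite !gtn_max => /andP[n1 /andP[n2 n3]].
have n0 : (0 < n)%N by exact: leq_ltn_trans n1.
have nR : 0 < n%:R :> R by rewrite ltr0n.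
exists M => //.
have t2 : c2 * M ^+ 2 * (J n + n%:R^-1) <= delta / 3.
  have Jn : J n + n%:R^-1 <= e + e.
    apply: lerD; last by have := hN3 n n3; rewrite powR_inv1 // ltW.
    by have := hN2 n (ltnW n2); rewrite sub0r normrN; apply: le_trans; exact: ler_norm.
  apply: (@le_trans _ _ ((c2 * M ^+ 2) * (e + e))); first by apply: ler_wpM2l => //; rewrite mulr_ge0 // sqr_ge0.
  apply: (@le_trans _ _ ((c2 * M ^+ 2 + 1) * (e + e))).
    by apply: ler_wpM2r; rewrite ?addr_ge0 ?(ltW e0) // lerDl.
  rewrite /e le_eqVlt; apply/orP; left; apply/eqP; field; rewrite gt_eqF //.
have t3 : c3 * (log_scale n + 1) ^+ 5 / n.+1%:R <= delta / 3.
  apply: (@le_trans _ _ (c3 * (C * n%:R `^ (2^-1)) * n%:R^-1)).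
    apply: ler_pM; rewrite ?invr_ge0 //.
    - by rewrite mulr_ge0 // exprn_ge0 // addr_ge0 // log_scale_ge0.
    - by apply: ler_wpM2l => //; have := hC n n0; rewrite div1r.
    - by rewrite lef_pV2 ?posrE // ler_nat.
  have -> : c3 * (C * n%:R `^ (2^-1)) * n%:R^-1 = c3 * C * n%:R `^ (- 2^-1).
    rewrite -(powR_inv1 (ltW nR)) -!mulrA; congr (_ * (_ * _)).
    by rewrite -powRD ?(gt_eqF nR) ?implybT //; congr (_ `^ _); field.
  have := hN1 n n1; rewrite ler_pdivlMr // => h; apply: le_trans h.
  by rewrite mulrC ler_wpM2l ?powR_ge0 // lerDl.
by apply: le_trans (lerD (lerD t1 t2) t3) _; lra.
Qed.

End rates.


(** * Assembly of the estimates *)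

Lemma cvg0_of_eventually_le {R : realType} (u : nat -> \bar R) :
  (forall n, 0 <= u n)%E ->
  (forall delta, 0 < delta -> exists N, forall n, (N < n)%N -> (u n <= delta%:E)%E) ->
  u n @[n --> \oo] --> 0%E.
Proof.
move=> u0 hu; apply/fine_cvgP; split.
  have [N hN] := hu 1 ltr01; exists N.+1 => // n /= Nn.
  by rewrite ge0_fin_numE //; apply: le_lt_trans (hN n Nn) _; rewrite ltry.
apply/cvgrPdist_le => e e0; have [N hN] := hu e e0; exists N.+1 => // n /= Nn.
have h := hN n Nn; rewrite sub0r normrN ger0_norm ?fine_ge0 //.
rewrite -lee_fin fineK // ge0_fin_numE //.
by apply: le_lt_trans h _; rewrite ltry.
Qed.

Theorem theorem2 (R : realType) (d : measure_display) (T : measurableType d)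
  (P : probability T R) (X Y W : R -> T -> R) (sigma : R)
  (Pi : {measure set (measurableTypeR R) -> \bar R})
  (hX : forall t w, 0 <= t <= 1 -> X t w = Y t w + sigma * W t w)
  (hXlevy : levy_process P X)
  (hsigma : 0 < sigma)
  (hW : standard_brownian_motion P W)
  (hY : pure_jump_levy_process P Y Pi)
  (hYW : independent_processes P Y W)
  (p : R) (hp : beta_star Pi < p <= 2 \/ p = 2) :
  littleo_in_probability P
    (fun n w => ereal_sup
       [set (`| W t w - rank_process X n t w
                - (W 1 w - rank_process X n 1 w) * t |)%:E
       | t in [set t : R | 0 <= t <= 1]])
    (fun n => n%:R `^ (- 2^-1 + p / 4)).

Proof.
have [levyY levyPi [b tri]] := hY.
have [mY _ _ _ _] := levyY.
have p0 : 0 < p.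
  by case: hp => [/andP[h _]|->//]; apply: le_lt_trans h; exact: (beta_star_ge0 levyPi).
have p2 : p <= 2 by case: hp => [/andP[]//|->].
move=> eps eps0.
have [m2 m20 hm2] := @normal_second_moment R.
have [C5 C50 hC5] := sample_score_error P.
(* The oscillation bound is of order [n^(1 - k p / 2)], which is at most [n^(-1)] once [k >= 4 / p];
   the added 3 meets the condition of [brownian_oscillation]. *)
pose k : nat := (Num.truncn (4 / p) + 3)%N.
have k3 : (3 <= k)%N by rewrite leq_addl.
have [C6 C60 hosc] := brownian_oscillation hW k3.
pose mx := Num.max (sigma ^- 2) 1.
have mx0 : 0 < mx by rewrite lt_max ltr01 orbT.
pose J n := jump_moment Pi n%:R^-1.
have J0 n : 0 <= J n by apply: jump_moment_ge0; rewrite invr_ge0.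
pose A := 585 / eps ^+ 2.
have A0 : 0 <= A by apply: divr_ge0; [exact: ler0n|exact: sqr_ge0].
pose c1 := A * (24 * m2).
pose c2 := A * (48 * (24 * (4 * mx + 1))).
pose c3 := A * (4 * C5).
have c10 : 0 <= c1 by rewrite mulr_ge0 // mulr_ge0.
have c20 : 0 <= c2 by rewrite mulr_ge0 // mulr_ge0 // mulr_ge0 // addr_ge0 // mulr_ge0 // ltW.
have c30 : 0 <= c3 by rewrite mulr_ge0 // mulr_ge0.
pose a n : R := eps * n%:R `^ (- 2^-1 + p / 4).
(* The clipping level stays free here: it grows with [n] when [p < 2] and is fixed before [n] when
   [p = 2]. *)
have bound n M : (0 < n)%N -> 1 <= M ->
  (mu_ext P [set w | exists2 t, (0 <= t <= 1)%R & (a n < `|deviation X W n t w|)%R] <=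
   (C6 * (9 / eps ^+ 2) ^+ k * n%:R `^ (-1) +
    n%:R `^ (1 - p / 2) * (c1 * gauss_kernel M + c2 * M ^+ 2 * (J n + n%:R^-1) +
      c3 * (log_scale n + 1) ^+ 5 / n.+1%:R))%:E)%E.
  move=> n0 M1; have nR : 0 < n%:R :> R by rewrite ltr0n.
  have an0 : 0 < a n by rewrite mulr_gt0 // powR_gt0.
  have inv01 : 0 < (n%:R^-1 : R) <= 1.
    by rewrite invr_gt0 nR invf_le1 // ler1n.
  have inv01' : 0 <= (n%:R^-1 : R) <= 1 by case/andP: inv01 => /ltW -> ->.
  have [c hc] := increment_centering levyPi tri inv01 hsigma (mY _ inv01').
  pose K := 24 * (4 * mx * J n + n%:R^-1).
  have hsum := sum_score_error_le hX hXlevy hsigma hW levyY hYW n0 hc M1 hm2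
    (fun i => hC5 n _ i (iid_noise hW n0)).
  (* Together with the factor [n] of [hsum] this produces the power [n^(1 - p/2)] in front of the
     error terms. *)
  have a2 : a n ^+ 2 * n%:R = eps ^+ 2 * n%:R `^ (p / 2).
    rewrite /a exprMn -mulrA; congr (_ * _).
    rewrite -[_ ^+ 2]powR_mulrn ?powR_ge0 // -powRrM -[X in _ * X = _](powRr1 (ltW nR)).
    by rewrite -powRD ?(gt_eqF nR) ?implybT //; congr (_ `^ _); field.
  have pw x y : n%:R `^ x * n%:R `^ y = n%:R `^ (x + y) :> R.
    by rewrite -powRD // (gt_eqF nR) implybT.
  have hdev := deviation_tail hX hsigma hW levyY hYW c n0 an0.
  apply: le_trans hdev _.
  rewrite EFinD; apply: leeD.
    apply: le_trans (hosc n (a n / 3) n0 _) _; first by rewrite divr_gt0.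
    rewrite lee_fin -mulrA; apply: ler_wpM2l => //.
    have -> : (a n / 3) ^+ 2 * n%:R = eps ^+ 2 / 9 * n%:R `^ (p / 2).
      by rewrite expr_div_n mulrAC a2; field.
    rewrite exprMn invfM -exprVn invf_div mulrCA; apply: ler_wpM2l.
      by rewrite exprn_ge0 // divr_ge0 // sqr_ge0.
    rewrite -[(_ `^ _) ^+ k]powR_mulrn ?powR_ge0 // -powRrM -powRN.
    rewrite -[X in X * _](powRr1 (ltW nR)) pw; apply: ler_powR; first by rewrite ler1n.
    have kp : 4 / p < k%:R.
      have x0 : 0 <= 4 / p by rewrite divr_ge0 // ltW.
      have /andP[_ h] := truncn_itv x0; apply: lt_le_trans h _.
      by rewrite ler_nat /k -addn1 leq_add2l.
    by move: kp; rewrite ltr_pdivrMr // => kp; lra.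
  apply: le_trans (lee_wpmul2l _ hsum) _.
    rewrite lee_fin a2; apply: divr_ge0; first exact: ler0n.
    by apply: mulr_ge0; [exact: sqr_ge0|exact: powR_ge0].
  rewrite -EFinM lee_fin a2.
  have -> : 585 / (eps ^+ 2 * n%:R `^ (p / 2)) * (n%:R * (24 * m2 * gauss_kernel M +
      48 * M ^+ 2 * K + 4 * (C5 * (log_scale n + 1) ^+ 5 / n.+1%:R))) =
    n%:R `^ (1 - p / 2) * (A * (24 * m2 * gauss_kernel M +
      48 * M ^+ 2 * K + 4 * (C5 * (log_scale n + 1) ^+ 5 / n.+1%:R))).
    rewrite invfM -powRN mulrA [585 * _]mulrC.
    have -> : n%:R `^ (1 - p / 2) = n%:R * n%:R `^ (- (p / 2)) :> R.
      by rewrite -[X in _ = X * _](powRr1 (ltW nR)) pw.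
    by rewrite /A; ring.
  apply: ler_wpM2l; first exact: powR_ge0.
  rewrite !mulrDr; apply: lerD; first apply: lerD.
  - by rewrite /c1 le_eqVlt; apply/orP; left; apply/eqP; ring.
  - have h : 4 * mx * J n + n%:R^-1 <= (4 * mx + 1) * (J n + n%:R^-1).
      have i0 : 0 <= n%:R^-1 :> R by rewrite invr_ge0.
      have : 0 <= mx * n%:R^-1 by rewrite mulr_ge0 // ltW.
      by move: (J0 n) i0; lra.
    rewrite -mulrDr.
    have -> : A * (48 * M ^+ 2 * K) = (A * (48 * 24) * M ^+ 2) * (4 * mx * J n + n%:R^-1).
      by rewrite /K; ring.
    have -> : c2 * M ^+ 2 * (J n + n%:R^-1) =
      (A * (48 * 24) * M ^+ 2) * ((4 * mx + 1) * (J n + n%:R^-1)) by rewrite /c2; ring.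
    by apply: ler_wpM2l => //; rewrite mulr_ge0 ?sqr_ge0 // mulr_ge0.
  - by rewrite /c3 le_eqVlt; apply/orP; left; apply/eqP; ring.
have rate delta : 0 < delta -> exists N, forall n, (N < n)%N -> exists2 M, 1 <= M &
    n%:R `^ (1 - p / 2) * (c1 * gauss_kernel M + c2 * M ^+ 2 * (J n + n%:R^-1) +
      c3 * (log_scale n + 1) ^+ 5 / n.+1%:R) <= delta.
  (* At [p = 2] the prefactor is [n^0 = 1] and nothing about [beta_star] is known; for [p < 2] the
     hypothesis yields [beta_star Pi < p]. *)
  move=> d0; move: p2; rewrite le_eqVlt => /orP[/eqP pE|p2].
    have [N hN] := error_rate_critical c10 c20 c30 (jump_moment_cvg0 levyPi) d0.
    exists N => n Nn; have [M M1 hM] := hN n Nn; exists M => //.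
    by rewrite pE divff // subrr powRr0 mul1r.
  have bp : beta_star Pi < p.
    by case: hp => [/andP[]//|pE]; move: p2; rewrite pE ltxx.
  have [q [q0 qp fin]] := beta_star_witness levyPi bp.
  have q02 : 0 < q < 2 by rewrite q0 (lt_trans qp).
  have [C4 C40 hJ] := jump_moment_le levyPi q02 fin.
  apply: (error_rate_subcritical q0 qp p2 c10 c20 c30 C40 _ d0) => n n0.
  by apply: hJ; rewrite invr_gt0 ltr0n n0 invf_le1 ?ltr0n // ler1n.
apply: cvg0_of_eventually_le => [n|delta d0]; first exact: mu_ext_ge0.
have d20 : 0 < delta / 2 by rewrite divr_gt0.
have [N1 hN1] := rate _ d20.
pose B := C6 * (9 / eps ^+ 2) ^+ k.
have B0 : 0 <= B by rewrite mulr_ge0 // exprn_ge0 // divr_ge0 // sqr_ge0.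
have B1 : 0 < B + 1 by rewrite ltr_wpDl.
have [N2 hN2] := powR_neg_small (@ltr01 R) (divr_gt0 d20 B1).
exists (maxn N1 N2) => n; rewrite gtn_max => /andP[n1 n2].
have n0 : (0 < n)%N by exact: leq_ltn_trans n1.
have [M M1 hM] := hN1 n n1.
have an0 : 0 < n%:R `^ (- 2^-1 + p / 4) :> R by rewrite powR_gt0 // ltr0n.
(* A normalised supremum above [eps] means a deviation above [a n] at some time, and outer measure
   is monotone under this inclusion. *)
apply: (@le_trans _ _ (mu_ext P [set w | exists2 t, (0 <= t <= 1)%R & (a n < `|deviation X W n t w|)%R])).
  apply: le_mu_ext => w /=; set S := ereal_sup _.
  have S0 : (0 <= S)%E.
    apply: (@le_trans _ _ (`|deviation X W n 0 w|%:E)); first by rewrite lee_fin.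
    by apply: ereal_sup_ubound; exists 0 => //=; rewrite lexx ler01.
  rewrite gee0_abs; last by rewrite mule_ge0 // lee_fin invr_ge0 ltW.
  rewrite lte_pdivlMr // -EFinM => /ereal_sup_gt[_ [t t01 <-]].
  by rewrite lte_fin => h; exists t.
apply: le_trans (bound n M n0 M1) _; rewrite lee_fin.
have h2 : B * n%:R `^ (-1) <= delta / 2.
  have := hN2 n n2; rewrite ler_pdivlMr // => h; apply: le_trans h.
  by rewrite mulrC ler_wpM2l ?powR_ge0 // lerDl.
by apply: le_trans (lerD h2 hM) _; rewrite -splitr.
Qed.
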